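(* The system $\mathsf{ACA}_0^\omega+\Delta\text{-}\mathsf{CA}$ proves the implication $\mathsf{ORD}\rightarrow\mathsf{SEP}^1$, where $\mathsf{ORD}$ is the statement: every formally real field over $\mathbb{N}^{\mathbb{N}}$ is orderable; and $\mathsf{SEP}^1$ is the statement $$(\forall Y^{2}, Z^{2})\big[(\forall f^{1}, g^{1})(Y(f)\ne Z(g))\rightarrow (\exists X^{1})(\forall g^{1})(Y(g)\in X \wedge Z(g)\not\in X ) \big].$$
   Context: Finite types: $0$ is a type (natural numbers), and if $\sigma,\tau$ are types, so is $\sigma\to\tau$; $1\equiv 0\to 0$ and $n+1\equiv n\to 0$. Superscripts indicate types. Type $1$ objects are elements of $\mathbb{N}^{\mathbb{N}}$, type $2$ objects are functionals $\mathbb{N}^{\mathbb{N}}\to\mathbb{N}$. Pairs and finite sequences are coded as usual (finite sequences of type $1$ objects as type $1$ objects). $\mathsf{L}_\omega$ is the language with variables of every finite type, constants $0,1,<_0,+_0,\times_0,=_0$, the combinators $\Pi,\Sigma$ and the recursor $\mathbf{R}_0$. For $\tau=(\tau_1\to\dots\to\tau_k\to 0)$, $x=_\tau y$ means $(\forall z_1^{\tau_1}\dots z_k^{\tau_k})(xz_1\dots z_k=_0 yz_1\dots z_k)$. The system $\mathsf{RCA}_0^\omega$ has the axioms: (a) $0,1,<_0,+_0,\times_0$ form an ordered semi-ring with equality $=_0$; (b) the defining axioms of the combinators $\Pi,\Sigma$ (giving $\lambda$-abstraction); (c) $\mathbf{R}_0(f^1,m^0,0)=m$ and $\mathbf{R}_0(f,m,n+1)=f(n,\mathbf{R}_0(f,m,n))$;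 (d) extensionality: $(\forall x^\rho,y^\rho,\varphi^{\rho\to\tau})(x=_\rho y\to\varphi(x)=_\tau\varphi(y))$ for all types $\rho,\tau$; (e) induction for quantifier-free formulas of $\mathsf{L}_\omega$; (f) $\mathsf{QF}\text{-}\mathsf{AC}^{1,0}$, where $\mathsf{QF}\text{-}\mathsf{AC}^{\sigma,\tau}$ is $(\forall x^\sigma)(\exists y^\tau)A(x,y)\to(\exists Y^{\sigma\to\tau})(\forall x^\sigma)A(x,Y(x))$ for quantifier-free $A$ of $\mathsf{L}_\omega$. $\mathsf{ACA}_0^\omega$ is $\mathsf{RCA}_0^\omega+(\mu^2)$, where $(\mu^2)$ is $(\exists\mu^2)(\forall f^1)\big[(\exists n)(f(n)=0)\to[f(\mu(f))=0\wedge(\forall i<\mu(f))f(i)\neq0]\wedge[(\forall n)(f(n)\neq 0)\to\mu(f)=0]\big]$. $\Delta\text{-}\mathsf{CA}$ is: $(\forall Y^2,Z^2)\big[(\forall n^0)\big((\exists f^1)(Y(f,n)=0)\leftrightarrow(\forall g^1)(Z(g,n)=0)\big)\to(\exists X^1)(\forall n^0)(n\in X\leftrightarrow(\exists f^1)(Y(f,n)=0))\big]$. Sets are given by characteristic functions: $X\subseteq\mathbb{N}$ is a type $1$ object, a subset of $\mathbb{N}^{\mathbb{N}}$ is given by a type $2$ functional, and a binary relation on it by a functional of type $(1\times1)\to0$. A field $K$ over $\mathbb{N}^{\mathbb{N}}$ (Baire space) consists of a set $|K|\subseteq\mathbb{N}^{\mathbb{N}}$ with distinguished elements $0_K,1_K$,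 an equivalence relation $=_K$, and operations $+_K,-_K,\times_K$ on $|K|$ satisfying the usual field axioms (with $=_K$ as equality). $K$ is formally real if there is no finite sequence $c_0,\dots,c_n\in|K|$ such that $0=_K\sum_{i=0}^nc_i^2$. $K$ is orderable if there exists a binary relation $<_K$ on $|K|$ satisfying the usual axioms of an ordered field.
   Formalization: ''Formally real'' is taken to mean that no finite sequence of nonzero elements has sum of squares equal to 0; as literally defined, c_0 = 0 is allowed, so no field would be formally real and ORD would be vacuously true. *)

(* Defs.v *)
From Stdlib Require Import List.
Import ListNotations.

Set Implicit Arguments.
Unset Strict Implicit.
Unset Printing Implicit Defensive.

Inductive ty : Type :=
| tN : ty
| Arr : ty -> ty -> ty.

Declare Scope ty_scope.
Delimit Scope ty_scope with ty.
Bind Scope ty_scope with ty.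
Notation "s ~> t" := (Arr s t) (at level 60, right associativity) : ty_scope.
Local Open Scope ty_scope.

Notation t1 := (tN ~> tN).
Notation t2 := (t1 ~> tN).

(** Terms and formulas are intrinsically typed, with de Bruijn variables; a
    context lists the types of the free variables, innermost first. *)
Definition ctx := list ty.

Inductive var : ctx -> ty -> Type :=
| VZ : forall G s, var (s :: G) s
| VS : forall G s r, var G s -> var (r :: G) s.
Arguments VZ {G s}.
Arguments VS {G s r} _.

(** [Rec] takes its step function curried, of type [tN ~> tN ~> tN], since
    it is applied to two numbers in [R f m (n+1) = f n (R f m n)]. *)
Inductive tm (G : ctx) : ty -> Type :=
| Var : forall s, var G s -> tm G s
| App : forall s t, tm G (s ~> t) -> tm G s -> tm G t
| Zero : tm G tN
| One : tm G tN
| Add : tm G (tN ~> tN ~> tN)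
| Mul : tm G (tN ~> tN ~> tN)
| Pi : forall s t, tm G (s ~> t ~> s)
| Sigma : forall r s t, tm G ((r ~> s ~> t) ~> (r ~> s) ~> r ~> t)
| Rec : tm G ((tN ~> tN ~> tN) ~> tN ~> tN ~> tN).
Arguments Var {G s} _.
Arguments Zero {G}.
Arguments One {G}.
Arguments Add {G}.
Arguments Mul {G}.
Arguments Pi {G s t}.
Arguments Sigma {G r s t}.
Arguments Rec {G}.

Inductive fm (G : ctx) : Type :=
| Equ : tm G tN -> tm G tN -> fm G
| Less : tm G tN -> tm G tN -> fm G
| Bot : fm G
| And : fm G -> fm G -> fm G
| Or : fm G -> fm G -> fm G
| Imp : fm G -> fm G -> fm G
| All : forall s, fm (s :: G) -> fm G
| Ex : forall s, fm (s :: G) -> fm G.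
Arguments Bot {G}.
Arguments All {G} s _.
Arguments Ex {G} s _.

Definition sentence := fm [].

Definition Neg G (A : fm G) : fm G := Imp A Bot.
Definition Iff G (A B : fm G) : fm G := And (Imp A B) (Imp B A).

Declare Scope tm_scope.
Delimit Scope tm_scope with tm.
Bind Scope tm_scope with tm.
Notation "t @ u" := (App t u) (at level 25, left associativity) : tm_scope.
Notation "t + u" := (App (App Add t) u) : tm_scope.
Notation "t * u" := (App (App Mul t) u) : tm_scope.
Notation "0" := Zero : tm_scope.
Notation "1" := One : tm_scope.

Declare Scope fm_scope.
Delimit Scope fm_scope with fm.
Bind Scope fm_scope with fm.
Notation "t == u" := (Equ t u) (at level 70, no associativity) : fm_scope.
Notation "t < u" := (Less t u) : fm_scope.
Notation "~ A" := (Neg A) : fm_scope.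
Notation "A /\ B" := (And A B) : fm_scope.
Notation "A \/ B" := (Or A B) : fm_scope.
Notation "A --> B" := (Imp A B) (at level 90, right associativity) : fm_scope.
Notation "A <--> B" := (Iff A B) (at level 95, no associativity) : fm_scope.

Local Open Scope tm_scope.
Local Open Scope fm_scope.

Definition ren (G D : ctx) := forall s, var G s -> var D s.
Definition sub (G D : ctx) := forall s, var G s -> tm D s.

Definition up_ren G D r (f : ren G D) : ren (r :: G) (r :: D) :=
  fun s v =>
    match v in var E s
      return match E with [] => unit
             | r' :: G' => ren G' D -> var (r' :: D) s end
    with
    | VZ => fun _ => VZ
    | VS w => fun f => VS (f _ w)
    end f.

Fixpoint tren G D (f : ren G D) s (t : tm G s) : tm D s :=
  match t with
  | Var v => Var (f _ v)
  | App t u => App (tren f t) (tren f u)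
  | Zero => Zero
  | One => One
  | Add => Add
  | Mul => Mul
  | Pi => Pi
  | Sigma => Sigma
  | Rec => Rec
  end.

Fixpoint fren G D (f : ren G D) (A : fm G) : fm D :=
  match A with
  | Equ t u => Equ (tren f t) (tren f u)
  | Less t u => Less (tren f t) (tren f u)
  | Bot => Bot
  | And A B => And (fren f A) (fren f B)
  | Or A B => Or (fren f A) (fren f B)
  | Imp A B => Imp (fren f A) (fren f B)
  | All s A => All s (fren (up_ren f) A)
  | Ex s A => Ex s (fren (up_ren f) A)
  end.

Definition tshift G r s (t : tm G s) : tm (r :: G) s :=
  tren (fun _ v => VS v) t.
Definition fshift G r (A : fm G) : fm (r :: G) :=
  fren (fun _ v => VS v) A.

Definition scons G D r (t : tm D r) (f : sub G D) : sub (r :: G) D :=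
  fun s v =>
    match v in var E s
      return match E with [] => unit
             | r' :: G' => tm D r' -> sub G' D -> tm D s end
    with
    | VZ => fun t _ => t
    | VS w => fun _ f => f _ w
    end t f.

Definition up_sub G D r (f : sub G D) : sub (r :: G) (r :: D) :=
  scons (Var VZ) (fun s v => tshift r (f s v)).

Fixpoint tsub G D (f : sub G D) s (t : tm G s) : tm D s :=
  match t with
  | Var v => f _ v
  | App t u => App (tsub f t) (tsub f u)
  | Zero => Zero
  | One => One
  | Add => Add
  | Mul => Mul
  | Pi => Pi
  | Sigma => Sigma
  | Rec => Rec
  end.

Fixpoint fsub G D (f : sub G D) (A : fm G) : fm D :=
  match A with
  | Equ t u => Equ (tsub f t) (tsub f u)
  | Less t u => Less (tsub f t) (tsub f u)
  | Bot => Bot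
  | And A B => And (fsub f A) (fsub f B)
  | Or A B => Or (fsub f A) (fsub f B)
  | Imp A B => Imp (fsub f A) (fsub f B)
  | All s A => All s (fsub (up_sub f) A)
  | Ex s A => Ex s (fsub (up_sub f) A)
  end.

Definition inst G r (A : fm (r :: G)) (t : tm G r) : fm G :=
  fsub (scons t (fun _ v => Var v)) A.

Definition close G (A : sentence) : fm G :=
  fsub (fun s (v : var [] s) =>
          match v in var E _ return match E with [] => tm G s
                                    | _ :: _ => unit end with
          | VZ => tt
          | VS _ => tt
          end) A.

Definition v0 G a : tm (a :: G) a := Var VZ.
Definition v1 G a b : tm (b :: a :: G) a := Var (VS VZ).
Definition v2 G a b c : tm (c :: b :: a :: G) a := Var (VS (VS VZ)).
Definition v3 G a b c d : tm (d :: c :: b :: a :: G) a := Var (VS (VS (VS VZ))).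
Definition v4 G a b c d e : tm (e :: d :: c :: b :: a :: G) a :=
  Var (VS (VS (VS (VS VZ)))).
Definition v5 G a b c d e f : tm (f :: e :: d :: c :: b :: a :: G) a :=
  Var (VS (VS (VS (VS (VS VZ))))).
Definition v6 G a b c d e f g : tm (g :: f :: e :: d :: c :: b :: a :: G) a :=
  Var (VS (VS (VS (VS (VS (VS VZ)))))).
Arguments v0 {G a}.
Arguments v1 {G a b}.
Arguments v2 {G a b c}.
Arguments v3 {G a b c d}.
Arguments v4 {G a b c d e}.
Arguments v5 {G a b c d e f}.
Arguments v6 {G a b c d e f g}.

(** Extensional equality [=_s] at type [s]; an abbreviation, not a primitive. *)
Fixpoint eqt s : forall G, tm G s -> tm G s -> fm G :=
  match s with
  | tN => fun G t u => Equ t u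
  | Arr r s' => fun G t u =>
      All r (eqt (tshift r t @ v0) (tshift r u @ v0))
  end.

Fixpoint qf G (A : fm G) : Prop :=
  match A with
  | Equ _ _ | Less _ _ | Bot => True
  | And A B | Or A B | Imp A B => (qf A /\ qf B)%type
  | All _ _ | Ex _ _ => False
  end.

(** Axioms may have free variables, which act as parameters. *)
Definition theory := forall G, fm G -> Prop.

Inductive prv (T : theory) : forall G, list (fm G) -> fm G -> Prop :=
| P_ax : forall G (H : list (fm G)) A, T G A -> prv T H A
| P_hyp : forall G (H : list (fm G)) A, In A H -> prv T H A
| P_raa : forall G (H : list (fm G)) A, prv T ((~ A) :: H) Bot -> prv T H A
| P_andI : forall G (H : list (fm G)) A B,
    prv T H A -> prv T H B -> prv T H (A /\ B)
| P_andE1 : forall G (H : list (fm G)) A B, prv T H (A /\ B) -> prv T H A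
| P_andE2 : forall G (H : list (fm G)) A B, prv T H (A /\ B) -> prv T H B
| P_orI1 : forall G (H : list (fm G)) A B, prv T H A -> prv T H (A \/ B)
| P_orI2 : forall G (H : list (fm G)) A B, prv T H B -> prv T H (A \/ B)
| P_orE : forall G (H : list (fm G)) A B C,
    prv T H (A \/ B) -> prv T (A :: H) C -> prv T (B :: H) C -> prv T H C
| P_impI : forall G (H : list (fm G)) A B, prv T (A :: H) B -> prv T H (A --> B)
| P_impE : forall G (H : list (fm G)) A B,
    prv T H (A --> B) -> prv T H A -> prv T H B
| P_allI : forall G (H : list (fm G)) s (A : fm (s :: G)),
    prv T (map (fshift s) H) A -> prv T H (All s A)
| P_allE : forall G (H : list (fm G)) s (A : fm (s :: G)) t,
    prv T H (All s A) -> prv T H (inst A t)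
| P_exI : forall G (H : list (fm G)) s (A : fm (s :: G)) t,
    prv T H (inst A t) -> prv T H (Ex s A)
| P_exE : forall G (H : list (fm G)) s (A : fm (s :: G)) C,
    prv T H (Ex s A) -> prv T (A :: map (fshift s) H) (fshift s C) -> prv T H C.

Definition proves (T : theory) (A : sentence) : Prop := prv T [] A.

Inductive extend (T : theory) (A : sentence) : theory :=
| ext_base : forall G B, T G B -> extend T A B
| ext_new : forall G, extend T A (close G A).

(** Non-negativity and discreteness of [<] follow from these axioms by
    quantifier-free induction; congruence of [+] and [*] with respect to [==]
    is an instance of extensionality. *)
Inductive semiring_ax : sentence -> Prop :=
| eq_refl_ax : semiring_ax (All tN (v0 == v0))
| eq_sym_ax : semiring_ax (All tN (All tN (v1 == v0 --> v0 == v1)))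
| eq_trans_ax : semiring_ax
    (All tN (All tN (All tN (v2 == v1 --> v1 == v0 --> v2 == v0))))
| lt_congr_ax : semiring_ax
    (All tN (All tN (All tN (All tN
      (v3 == v2 --> v1 == v0 --> v3 < v1 --> v2 < v0)))))
| add_assoc_ax : semiring_ax
    (All tN (All tN (All tN ((v2 + v1) + v0 == v2 + (v1 + v0)))))
| add_comm_ax : semiring_ax (All tN (All tN (v1 + v0 == v0 + v1)))
| add_0_ax : semiring_ax (All tN (v0 + 0 == v0))
| mul_assoc_ax : semiring_ax
    (All tN (All tN (All tN ((v2 * v1) * v0 == v2 * (v1 * v0)))))
| mul_comm_ax : semiring_ax (All tN (All tN (v1 * v0 == v0 * v1)))
| mul_1_ax : semiring_ax (All tN (v0 * 1 == v0))
| mul_0_ax : semiring_ax (All tN (v0 * 0 == 0))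
| distr_ax : semiring_ax
    (All tN (All tN (All tN (v2 * (v1 + v0) == v2 * v1 + v2 * v0))))
| lt_irrefl_ax : semiring_ax (All tN (~ v0 < v0))
| lt_trans_ax : semiring_ax
    (All tN (All tN (All tN (v2 < v1 --> v1 < v0 --> v2 < v0))))
| lt_total_ax : semiring_ax
    (All tN (All tN (v1 < v0 \/ v1 == v0 \/ v0 < v1)))
| lt_add_ax : semiring_ax
    (All tN (All tN (All tN (v2 < v1 --> v2 + v0 < v1 + v0))))
| lt_mul_ax : semiring_ax
    (All tN (All tN (All tN (0 < v0 --> v2 < v1 --> v2 * v0 < v1 * v0))))
| lt_0_1_ax : semiring_ax (0 < 1).

Inductive RCA0w : theory :=
| ax_semiring : forall G A, semiring_ax A -> RCA0w (close G A)
| ax_Pi : forall G s t,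
    @RCA0w G (All s (All t (eqt (Pi @ v1 @ v0) v1)))
| ax_Sigma : forall G r s t,
    @RCA0w G (All (r ~> s ~> t) (All (r ~> s) (All r
      (eqt (Sigma @ v2 @ v1 @ v0) (v2 @ v0 @ (v1 @ v0))))))
| ax_Rec0 : forall G,
    @RCA0w G (All (tN ~> tN ~> tN) (All tN (Rec @ v1 @ v0 @ 0 == v0)))
| ax_RecS : forall G,
    @RCA0w G (All (tN ~> tN ~> tN) (All tN (All tN
      (Rec @ v2 @ v1 @ (v0 + 1) == v2 @ v0 @ (Rec @ v2 @ v1 @ v0)))))
| ax_ext : forall G r s,
    @RCA0w G (All r (All r (All (r ~> s)
      (eqt v2 v1 --> eqt (v0 @ v2) (v0 @ v1)))))
| ax_ind : forall G (A : fm (tN :: G)), qf A ->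
    @RCA0w G (inst A 0
      --> All tN (A --> fsub (scons (v0 + 1) (fun _ v => Var (VS v))) A)
      --> All tN A)
(* In [A], [v0] is the number variable y and [v1] the type 1 variable x. *)
| ax_QFAC10 : forall G (A : fm (tN :: t1 :: G)), qf A ->
    @RCA0w G (All t1 (Ex tN A)
      --> Ex t2 (All t1
            (fsub (scons (v1 @ v0) (scons v0 (fun _ v => Var (VS (VS v))))) A))).

Definition mu2 : sentence :=
  Ex t2 (All t1
    ((Ex tN (v1 @ v0 == 0)
        --> v0 @ (v1 @ v0) == 0 /\ All tN (v0 < v2 @ v1 --> ~ v1 @ v0 == 0))
     /\ (All tN (~ v1 @ v0 == 0) --> v1 @ v0 == 0))).

Definition ACA0w : theory := extend RCA0w mu2.

(** A characteristic function takes the value 1 on the elements of the set;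
    every functional of the right type is read in this way. *)
Definition mem G (n : tm G tN) (X : tm G t1) : fm G := X @ n == 1.

(** The code of the pair (f,n): the type 1 object with value [n] at [0] and
    [f k] at [k + 1].  Here [Sigma (Pi Pi) f] is the step function which sends
    [k] and [m] to [f k]. *)
Definition pair10 G (f : tm G t1) (n : tm G tN) : tm G t1 :=
  Rec @ (Sigma @ (Pi @ Pi) @ f) @ n.

Definition DeltaCA : sentence :=
  All t2 (All t2
    (All tN (Ex t1 (v3 @ pair10 v0 v1 == 0) <--> All t1 (v2 @ pair10 v0 v1 == 0))
     --> Ex t1 (All tN (mem v0 v1 <--> Ex t1 (v4 @ pair10 v0 v1 == 0))))).

Definition SEP1 : sentence :=
  All t2 (All t2
    (All t1 (All t1 (~ v3 @ v1 == v2 @ v0))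
     --> Ex t1 (All t1 (mem (v3 @ v0) v1 /\ ~ mem (v2 @ v0) v1)))).

Record field_data (G : ctx) := FieldData {
  K_set : tm G t2;
  K_zero : tm G t1;
  K_one : tm G t1;
  K_eq : tm G (t1 ~> t1 ~> tN);
  K_add : tm G (t1 ~> t1 ~> t1);
  K_opp : tm G (t1 ~> t1);
  K_mul : tm G (t1 ~> t1 ~> t1) }.

Definition kshift G r (K : field_data G) : field_data (r :: G) :=
  FieldData (tshift r (K_set K)) (tshift r (K_zero K)) (tshift r (K_one K))
    (tshift r (K_eq K)) (tshift r (K_add K)) (tshift r (K_opp K))
    (tshift r (K_mul K)).

Definition kshift3 G r s t (K : field_data G) : field_data (t :: s :: r :: G) :=
  kshift t (kshift s (kshift r K)).

Definition memK G (K : field_data G) (a : tm G t1) : fm G := K_set K @ a == 1.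
Definition eqK G (K : field_data G) (a b : tm G t1) : fm G :=
  K_eq K @ a @ b == 1.
Definition addK G (K : field_data G) (a b : tm G t1) : tm G t1 :=
  K_add K @ a @ b.
Definition oppK G (K : field_data G) (a : tm G t1) : tm G t1 := K_opp K @ a.
Definition mulK G (K : field_data G) (a b : tm G t1) : tm G t1 :=
  K_mul K @ a @ b.

Definition AllK G (K : field_data G) (A : fm (t1 :: G)) : fm G :=
  All t1 (memK (kshift t1 K) v0 --> A).
Definition ExK G (K : field_data G) (A : fm (t1 :: G)) : fm G :=
  Ex t1 (memK (kshift t1 K) v0 /\ A).
Definition AllK3 G (K : field_data G) (A : fm (t1 :: t1 :: t1 :: G)) : fm G :=
  AllK K (AllK (kshift t1 K) (AllK (kshift t1 (kshift t1 K)) A)).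

Definition field_laws G (K : field_data G) (a b c : tm G t1) : fm G :=
  memK K (addK K a b) /\ memK K (oppK K a) /\ memK K (mulK K a b)
  /\ eqK K a a
  /\ (eqK K a b --> eqK K b a)
  /\ (eqK K a b --> eqK K b c --> eqK K a c)
  /\ (eqK K a b --> eqK K (addK K a c) (addK K b c))
  /\ (eqK K a b --> eqK K (oppK K a) (oppK K b))
  /\ (eqK K a b --> eqK K (mulK K a c) (mulK K b c))
  /\ eqK K (addK K (addK K a b) c) (addK K a (addK K b c))
  /\ eqK K (addK K a b) (addK K b a)
  /\ eqK K (addK K a (K_zero K)) a
  /\ eqK K (addK K a (oppK K a)) (K_zero K)
  /\ eqK K (mulK K (mulK K a b) c) (mulK K a (mulK K b c))
  /\ eqK K (mulK K a b) (mulK K b a)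
  /\ eqK K (mulK K a (K_one K)) a
  /\ eqK K (mulK K a (addK K b c)) (addK K (mulK K a b) (mulK K a c)).

Definition is_field G (K : field_data G) : fm G :=
  memK K (K_zero K) /\ memK K (K_one K)
  /\ AllK3 K (field_laws (kshift3 t1 t1 t1 K) v2 v1 v0)
  /\ ~ eqK K (K_zero K) (K_one K)
  /\ AllK K (let K1 := kshift t1 K in
       ~ eqK K1 v0 (K_zero K1)
       --> ExK K1 (let K2 := kshift t1 K1 in
             eqK K2 (mulK K2 v1 v0) (K_one K2))).

(** There are no [n], [c] and [s] such that [c 0, ..., c n] are nonzero
    elements of [K] (because of [0 = 0^2] no field would be formally real if
    zero were allowed) and [s i] is the sum of the squares of [c 0, ..., c i] for
    [i <= n], with [s n] equal to zero.  Finite sequences of type 1 objects are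
    initial segments of objects of type [tN ~> t1]. *)
Definition formally_real G (K : field_data G) : fm G :=
  ~ Ex tN (Ex (tN ~> t1) (Ex (tN ~> t1) (
      let K := kshift3 tN (tN ~> t1) (tN ~> t1) K in
      let n := v2 in let c := v1 in let s := v0 in
      All tN (v0 < tshift tN n + 1 -->
        let K := kshift tN K in
        let c := tshift tN c in let s := tshift tN s in let i := v0 in
        memK K (c @ i) /\ ~ eqK K (c @ i) (K_zero K) /\ memK K (s @ i))
      /\ eqK K (s @ 0) (mulK K (c @ 0) (c @ 0))
      /\ All tN (v0 < tshift tN n -->
           let K := kshift tN K in
           let c := tshift tN c in let s := tshift tN s in let i := v0 in
           eqK K (s @ (i + 1))
             (addK K (s @ i) (mulK K (c @ (i + 1)) (c @ (i + 1)))))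
      /\ eqK K (K_zero K) (s @ n)))).

Definition order_laws G (K : field_data G) (lt : tm G (t1 ~> t1 ~> tN))
    (a b c : tm G t1) : fm G :=
  let ltK a b := lt @ a @ b == 1 in
  (eqK K a b --> (ltK a c --> ltK b c) /\ (ltK c a --> ltK c b))
  /\ ~ ltK a a
  /\ (ltK a b --> ltK b c --> ltK a c)
  /\ (ltK a b \/ eqK K a b \/ ltK b a)
  /\ (ltK a b --> ltK (addK K a c) (addK K b c))
  /\ (ltK (K_zero K) a --> ltK (K_zero K) b --> ltK (K_zero K) (mulK K a b)).

Definition orderable G (K : field_data G) : fm G :=
  Ex (t1 ~> t1 ~> tN) (AllK3 (kshift (t1 ~> t1 ~> tN) K)
    (order_laws (kshift3 t1 t1 t1 (kshift (t1 ~> t1 ~> tN) K)) v3 v2 v1 v0)).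

Definition ORD : sentence :=
  All t2 (All t1 (All t1 (All (t1 ~> t1 ~> tN)
    (All (t1 ~> t1 ~> t1) (All (t1 ~> t1) (All (t1 ~> t1 ~> t1)
      (let K := FieldData v6 v5 v4 v3 v2 v1 v0 in
       is_field K --> formally_real K --> orderable K))))))).

(* Main.v *)
From Stdlib Require Import List Arith Lia Ring Eqdep_dec Cantor.
From Stdlib Require Import Classical ClassicalEpsilon FunctionalExtensionality PropExtensionality.
Require Import Defs.
Import ListNotations.

Set Implicit Arguments.
Unset Strict Implicit.
Unset Printing Implicit Defensive.

Open Scope ty_scope.

(** The derivation is not written out. A completeness theorem for the calculus
    ([completeness], refined in [normal_completeness]) reduces it to showing that [ORD]
    implies [SEP1] in every structure [M] which satisfies the axioms, in which equality is
    identity, and in which functions are determined by their values. The numbers of [M] may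
    be nonstandard, and only its internal functions are available. Because of the search
    operator of (mu^2) these include the characteristic functions of all arithmetical
    predicates ([Def_all]), so that [M] has induction and least witnesses for such
    predicates ([ind], [least_spec]).

    In [M], let [Y] and [Z] have disjoint ranges. Take indeterminates x_n, and adjoin a square
    root of x_n for each n in the range of [Y] and a square root of - x_n for each n in the
    range of [Z]. In every ordering of such a field x_n is positive in the first case and
    negative in the second, hence the set of all n with 0 < x_n separates the two ranges. The
    difficulty is that the field has to be given without knowledge of the ranges, which need
    not exist as sets. Therefore the code of an element carries functions [f] and [g] as
    witnesses for the values [Y f] and [Z g] that it uses; what these witnesses certify is the
    state of the code, a function with values 0, 1, 2. The
    field is the direct limit, over the states, of copies of a single field L. When a state
    grows, the indeterminate of n is replaced by its square or by the opposite of its square.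
    This substitution is an injective endomorphism of L ([phi_inj], [phi_mul]), and these
    endomorphisms compose as they should ([phi_glue]). An indeterminate for which no witness
    is present behaves in the same way whether or not a witness exists elsewhere, so that
    equality of codes is decided arithmetically in the union of their states ([eqK_iff]).

    For L serves the fraction field of the ring of formal Dirichlet series with integral
    coefficients. Its monomials are the positive integers, the indeterminates are the primes,
    and a substitution of monomials is a completely multiplicative function ([mext_mul]).
    The usual order of the integers is a well-ordering of the monomials compatible with
    multiplication, hence the ring is ordered by the sign of the leading coefficient
    ([rpos_mul]), and in particular it is an integral domain. Given an internal sequence of
    codes, perhaps of nonstandard length, all of them have values in the copy of L for a
    common state ([upper_seq]), where a sum of nonzero squares is positive by induction on
    its length ([formally_real_K]). *)

(** * Substitution *)

Lemma sub_ext G D (f g : sub G D) : (forall s v, f s v = g s v) -> f = g.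
Proof.
  intros H; apply functional_extensionality_dep; intros s.
  apply functional_extensionality; intros v; apply H.
Qed.

Definition var_nil (P : Type) s (v : var [] s) : P :=
  match v in var E _ return match E with [] => P | _ :: _ => unit end with
  | VZ => tt
  | VS _ => tt
  end.

(** Case analysis on a variable of a nonempty context; it reduces by computation on [VZ]
    and [VS]. *)
Definition var_case s G (P : forall r, var (s :: G) r -> Type)
    (z : P s VZ) (n : forall r (v : var G r), P r (VS v)) r (v : var (s :: G) r) : P r v :=
  match v as v' in var E r' return
    match E as E' return var E' r' -> Type with
    | [] => fun _ => unit
    | s' :: G' => fun w => forall P : (forall r, var (s' :: G') r -> Type),
        P s' VZ -> (forall r (v : var G' r), P r (VS v)) -> P r' w
    end v' with
  | VZ => fun _ z _ => z
  | VS w => fun _ _ n => n _ w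
  end P z n.

Lemma sub_cons_ext G D r (f g : sub (r :: G) D) :
  f r VZ = g r VZ -> (forall s v, f s (VS v) = g s (VS v)) -> f = g.
Proof.
  intros H0 H1; apply sub_ext; intros s v; revert s v.
  apply (var_case (P := fun s v => f s v = g s v)); assumption.
Qed.

Lemma tren_tren G D E (f : ren G D) (g : ren D E) s (t : tm G s) :
  tren g (tren f t) = tren (fun _ v => g _ (f _ v)) t.
Proof. induction t; simpl; congruence. Qed.

Lemma tsub_tren G D E (f : ren G D) (g : sub D E) s (t : tm G s) :
  tsub g (tren f t) = tsub (fun _ v => g _ (f _ v)) t.
Proof. induction t; simpl; congruence. Qed.

Lemma tren_tsub G D E (f : sub G D) (g : ren D E) s (t : tm G s) :
  tren g (tsub f t) = tsub (fun _ v => tren g (f _ v)) t.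
Proof. induction t; simpl; congruence. Qed.

Lemma tsub_tsub G D E (f : sub G D) (g : sub D E) s (t : tm G s) :
  tsub g (tsub f t) = tsub (fun _ v => tsub g (f _ v)) t.
Proof. induction t; simpl; congruence. Qed.

Lemma tsub_Var G s (t : tm G s) : tsub (fun _ v => Var v) t = t.
Proof. induction t; simpl; congruence. Qed.

Lemma tsub_rename G D (f : ren G D) s (t : tm G s) :
  tsub (fun _ v => Var (f _ v)) t = tren f t.
Proof. induction t; simpl; congruence. Qed.

Lemma tsub_tshift G D r (f : sub (r :: G) D) s (t : tm G s) :
  tsub f (tshift r t) = tsub (fun _ v => f _ (VS v)) t.
Proof. apply tsub_tren. Qed.

Lemma up_tshift G D r (f : sub G D) s (t : tm G s) :
  tsub (up_sub (r := r) f) (tshift r t) = tshift r (tsub f t).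
Proof. rewrite tsub_tshift. unfold tshift at 1. rewrite tren_tsub. reflexivity. Qed.

Lemma fren_fsub G D E (f : sub G D) (g : ren D E) (A : fm G) :
  fren g (fsub f A) = fsub (fun _ v => tren g (f _ v)) A.
Proof.
  revert D E f g; induction A; intros; simpl; rewrite ?tren_tsub, ?IHA1, ?IHA2;
    try reflexivity; rewrite IHA; f_equal; f_equal; apply sub_cons_ext;
    try reflexivity; intros; simpl; unfold tshift; rewrite !tren_tren; reflexivity.
Qed.

Lemma fsub_fsub G D E (f : sub G D) (g : sub D E) (A : fm G) :
  fsub g (fsub f A) = fsub (fun _ v => tsub g (f _ v)) A.
Proof.
  revert D E f g; induction A; intros; simpl; rewrite ?tsub_tsub, ?IHA1, ?IHA2;
    try reflexivity; rewrite IHA; f_equal; f_equal; apply sub_cons_ext;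
    try reflexivity; intros; simpl; apply up_tshift.
Qed.

Lemma inst_up G D r (f : sub G D) (A : fm (r :: G)) t :
  inst (fsub (up_sub f) A) t = fsub (scons t f) A.
Proof.
  unfold inst; rewrite fsub_fsub; f_equal; apply sub_cons_ext; [reflexivity|].
  intros; simpl; rewrite tsub_tshift; apply tsub_Var.
Qed.

Lemma fsub_Var G (A : fm G) : fsub (fun _ v => Var v) A = A.
Proof.
  induction A; simpl; rewrite ?tsub_Var; try congruence; f_equal;
    rewrite <- IHA at 2; f_equal; apply sub_cons_ext; reflexivity.
Qed.

Lemma fsub_close G D (f : sub G D) A : fsub f (close G A) = close D A.
Proof.
  unfold close; rewrite fsub_fsub; f_equal; apply sub_ext; intros s v.
  exact (var_nil _ v).
Qed.

Lemma fsub_eqt s : forall G D (f : sub G D) (t u : tm G s),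
  fsub f (eqt t u) = eqt (tsub f t) (tsub f u).
Proof.
  induction s as [|r IHr s IHs]; intros; simpl; [reflexivity|].
  rewrite IHs; simpl; rewrite !up_tshift; reflexivity.
Qed.

(** * Countability of the language *)

Inductive tree := Leaf (n : nat) | Node (a b : tree).

Fixpoint tree_of_nat (fuel n : nat) : tree :=
  match fuel with
  | O => Leaf 0
  | S fuel => match of_nat n with
    | (O, b) => Leaf b
    | (S _, b) => Node (tree_of_nat fuel (fst (of_nat b))) (tree_of_nat fuel (snd (of_nat b)))
    end
  end.

Lemma tree_countable t : exists n k, forall j, k <= j -> tree_of_nat j n = t.
Proof.
  induction t as [m|a [n1 [k1 H1]] b [n2 [k2 H2]]].
  - exists (to_nat (0, m)), 1; intros [|j] Hj; [lia|]; cbn [tree_of_nat].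
    now rewrite cancel_of_to.
  - exists (to_nat (1, to_nat (n1, n2))), (S (k1 + k2)); intros [|j] Hj; [lia|].
    cbn [tree_of_nat]; rewrite !cancel_of_to; cbn [fst snd].
    rewrite H1, H2 by lia; reflexivity.
Qed.

Definition ty_eq_dec : forall s t : ty, {s = t} + {s <> t}.
Proof. decide equality. Defined.

Definition cast (F : ty -> Type) s t (x : F s) : option (F t) :=
  match ty_eq_dec s t with
  | left e => Some (eq_rect s F x t e)
  | right _ => None
  end.

Lemma cast_id (F : ty -> Type) s (x : F s) : cast s x = Some x.
Proof.
  unfold cast; destruct (ty_eq_dec s s) as [e|n]; [|congruence].
  rewrite (UIP_dec ty_eq_dec e eq_refl); reflexivity.
Qed.

Fixpoint ty_code (s : ty) : tree :=
  match s with tN => Leaf 0 | Arr a b => Node (ty_code a) (ty_code b) end.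
Fixpoint ty_decode (t : tree) : ty :=
  match t with Leaf _ => tN | Node a b => Arr (ty_decode a) (ty_decode b) end.
Lemma ty_decodeK s : ty_decode (ty_code s) = s.
Proof. induction s; simpl; congruence. Qed.

Fixpoint var_decode (n : nat) G s : option (var G s) :=
  match G with
  | [] => None
  | r :: G => match n with
    | O => cast (F := var (r :: G)) s VZ
    | S n => option_map (fun v => VS v) (var_decode n G s)
    end
  end.

Lemma var_decode_onto G s (v : var G s) : exists n, var_decode n G s = Some v.
Proof.
  induction v as [G s|G s r v [n Hn]].
  - exists 0; apply cast_id.
  - exists (S n); simpl; rewrite Hn; reflexivity.
Qed.

Fixpoint tm_decode (c : tree) G s : option (tm G s) :=
  match c with
  | Leaf 0 => cast (F := tm G) s Zero
  | Leaf 1 => cast (F := tm G) s One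
  | Leaf 2 => cast (F := tm G) s Add
  | Leaf 3 => cast (F := tm G) s Mul
  | Leaf _ => cast (F := tm G) s Rec
  | Node (Leaf 0) (Leaf n) => option_map (fun v => Var v) (var_decode n G s)
  | Node (Leaf _) (Node a b) => cast (F := tm G) s (@Pi G (ty_decode a) (ty_decode b))
  | Node (Node (Leaf _) a) (Node b d) =>
      cast (F := tm G) s (@Sigma G (ty_decode a) (ty_decode b) (ty_decode d))
  | Node (Node (Node _ a) b) d =>
      match tm_decode b G (ty_decode a ~> s), tm_decode d G (ty_decode a) with
      | Some t, Some u => Some (App t u)
      | _, _ => None
      end
  | _ => None
  end.

Lemma tm_decode_onto G s (t : tm G s) : exists c, tm_decode c G s = Some t.
Proof.
  induction t as [s v|s t f [c1 H1] u [c2 H2]| | | | |s t|r s t|].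
  - destruct (var_decode_onto v) as [n Hn]; exists (Node (Leaf 0) (Leaf n)).
    simpl; rewrite Hn; reflexivity.
  - exists (Node (Node (Node (Leaf 0) (ty_code s)) c1) c2); simpl.
    rewrite ty_decodeK, H1, H2; reflexivity.
  - exists (Leaf 0); apply cast_id.
  - exists (Leaf 1); apply cast_id.
  - exists (Leaf 2); apply cast_id.
  - exists (Leaf 3); apply cast_id.
  - exists (Node (Leaf 1) (Node (ty_code s) (ty_code t))); simpl.
    rewrite !ty_decodeK; apply cast_id.
  - exists (Node (Node (Leaf 0) (ty_code r)) (Node (ty_code s) (ty_code t))); simpl.
    rewrite !ty_decodeK; apply cast_id.
  - exists (Leaf 4); apply cast_id.
Qed.

Definition omap2 A B C (f : A -> B -> C) (a : option A) (b : option B) : option C :=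
  match a, b with Some a, Some b => Some (f a b) | _, _ => None end.

Fixpoint fm_decode (c : tree) G : option (fm G) :=
  match c with
  | Leaf _ => Some Bot
  | Node (Leaf 0) (Node a b) => omap2 (@Equ G) (tm_decode a G tN) (tm_decode b G tN)
  | Node (Leaf 1) (Node a b) => omap2 (@Less G) (tm_decode a G tN) (tm_decode b G tN)
  | Node (Leaf 2) (Node a b) => omap2 (@And G) (fm_decode a G) (fm_decode b G)
  | Node (Leaf 3) (Node a b) => omap2 (@Or G) (fm_decode a G) (fm_decode b G)
  | Node (Leaf _) (Node a b) => omap2 (@Imp G) (fm_decode a G) (fm_decode b G)
  | Node (Node (Leaf 0) s) a =>
      option_map (@All G (ty_decode s)) (fm_decode a (ty_decode s :: G))
  | Node (Node _ s) a =>
      option_map (@Ex G (ty_decode s)) (fm_decode a (ty_decode s :: G))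
  | _ => None
  end.

Lemma fm_decode_onto G (A : fm G) : exists c, fm_decode c G = Some A.
Proof.
  induction A as [G t u|G t u|G|G A [a Ha] B [b Hb]|G A [a Ha] B [b Hb]
    |G A [a Ha] B [b Hb]|G s A [a Ha]|G s A [a Ha]].
  1,2: destruct (tm_decode_onto t) as [a Ha], (tm_decode_onto u) as [b Hb].
  - exists (Node (Leaf 0) (Node a b)); simpl; rewrite Ha, Hb; reflexivity.
  - exists (Node (Leaf 1) (Node a b)); simpl; rewrite Ha, Hb; reflexivity.
  - exists (Leaf 0); reflexivity.
  - exists (Node (Leaf 2) (Node a b)); simpl; rewrite Ha, Hb; reflexivity.
  - exists (Node (Leaf 3) (Node a b)); simpl; rewrite Ha, Hb; reflexivity.
  - exists (Node (Leaf 4) (Node a b)); simpl; rewrite Ha, Hb; reflexivity.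
  - exists (Node (Node (Leaf 0) (ty_code s)) a); simpl.
    rewrite ty_decodeK, Ha; reflexivity.
  - exists (Node (Node (Leaf 1) (ty_code s)) a); simpl.
    rewrite ty_decodeK, Ha; reflexivity.
Qed.

Definition fm_enum (n : nat) G : fm G :=
  match fm_decode (tree_of_nat (fst (of_nat n)) (snd (of_nat n))) G with
  | Some A => A
  | None => Bot
  end.

(** All formulas over all contexts share one enumeration by natural numbers, which makes it
    possible to schedule them although the context grows during the construction. *)
Lemma fm_enum_onto G (A : fm G) : exists n, fm_enum n G = A.
Proof.
  destruct (fm_decode_onto A) as [c Hc], (tree_countable c) as [m [k H]].
  exists (to_nat (k, m)); unfold fm_enum; rewrite cancel_of_to; cbn [fst snd].
  rewrite H, Hc by lia; reflexivity.
Qed.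

(** * Structures *)

Record structure := Structure {
  dom : ty -> Type;
  app : forall s t, dom (s ~> t) -> dom s -> dom t;
  zeroM : dom tN;
  oneM : dom tN;
  addM : dom (tN ~> tN ~> tN);
  mulM : dom (tN ~> tN ~> tN);
  piM : forall s t, dom (s ~> t ~> s);
  sigmaM : forall r s t, dom ((r ~> s ~> t) ~> (r ~> s) ~> r ~> t);
  recM : dom ((tN ~> tN ~> tN) ~> tN ~> tN ~> tN);
  eqM : dom tN -> dom tN -> Prop;
  ltM : dom tN -> dom tN -> Prop }.

Definition env (M : structure) (G : ctx) := forall s, var G s -> dom M s.

Definition econs (M : structure) G s (d : dom M s) (e : env M G) : env M (s :: G) :=
  fun r v => var_case (P := fun r _ => dom M r) d e v.

Fixpoint eval (M : structure) G (e : env M G) s (t : tm G s) : dom M s :=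
  match t with
  | Var v => e _ v
  | App t u => app (eval e t) (eval e u)
  | Zero => zeroM M
  | One => oneM M
  | Add => addM M
  | Mul => mulM M
  | Pi => piM M _ _
  | Sigma => sigmaM M _ _ _
  | Rec => recM M
  end.

Fixpoint sat (M : structure) G (e : env M G) (A : fm G) : Prop :=
  match A with
  | Equ t u => eqM (eval e t) (eval e u)
  | Less t u => ltM (eval e t) (eval e u)
  | Bot => False
  | And A B => sat e A /\ sat e B
  | Or A B => sat e A \/ sat e B
  | Imp A B => sat e A -> sat e B
  | All s A => forall d : dom M s, sat (econs d e) A
  | Ex s A => exists d : dom M s, sat (econs d e) A
  end.

(** The axioms whose substitution instances are again axioms; only these have to be
    transferred from the calculus to a structure. *)
Definition stable (T : theory) G (A : fm G) : Prop :=
  forall D (f : sub G D), T D (fsub f A).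

(** * The Henkin construction *)

Section Henkin.
Variable T : theory.
Variable A0 : sentence.
Hypothesis unprovable : ~ proves T A0.

Definition consistent G (H : list (fm G)) := ~ prv T H Bot.

Definition top G : fm G := Imp Bot Bot.

Lemma prv_top G (H : list (fm G)) : prv T H (top G).
Proof. apply P_impI, P_hyp; left; reflexivity. Qed.

Definition decide G (H : list (fm G)) (B : fm G) : fm G :=
  if excluded_middle_informative (consistent (B :: H)) then B else Neg B.

Lemma decide_consistent G (H : list (fm G)) B :
  consistent H -> consistent (decide H B :: H).
Proof.
  unfold decide; destruct excluded_middle_informative as [c|n]; [auto|].
  intros c p; apply n; intros q; apply c.
  exact (P_impE (P_impI q) (P_raa p)).
Qed.

Lemma decide_in G (H : list (fm G)) B : consistent H -> In B H -> decide H B = B.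
Proof.
  unfold decide; destruct excluded_middle_informative as [c|n]; [auto|].
  intros c i; destruct n; intros p; apply c.
  exact (P_impE (P_impI p) (P_hyp T i)).
Qed.

Lemma decide_cases G (H : list (fm G)) B : decide H B = B \/ decide H B = Neg B.
Proof. unfold decide; destruct excluded_middle_informative; auto. Qed.

(** The witness formula for a decided formula. Refuted universal formulas get a witness of
    their own, which spares a derivation of [Ex s (Neg A)] from [Neg (All s A)]. In the
    other cases a variable of type [tN] is added for the sake of uniformity. *)
Definition wit G (B : fm G) : {s & fm (s :: G)} :=
  match B with
  | Ex s A => existT (fun s => fm (s :: G)) s A
  | Imp (All s A) Bot => existT (fun s => fm (s :: G)) s (Neg A)
  | _ => existT (fun s => fm (s :: G)) tN (top _)
  end.

Lemma wit_top G (H : list (fm G)) :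
  consistent H -> consistent (top (tN :: G) :: map (fshift tN) H).
Proof.
  intros c p; apply c.
  refine (P_exE (s := tN) (A := top _) (C := Bot) _ p).
  apply (P_exI (t := Zero)); apply prv_top.
Qed.

Lemma wit_consistent G (H : list (fm G)) B : consistent (B :: H) ->
  consistent (projT2 (wit B) :: map (fshift _) (B :: H)).
Proof.
  intros c; destruct B as [| | | | |B C|s B|s B]; try (apply wit_top; exact c).
  - destruct B; try (apply wit_top; exact c).
    destruct C; try (apply wit_top; exact c).
    intros p; apply c.
    refine (P_impE (P_hyp T (in_eq _ _)) _).
    apply P_allI, P_raa; exact p.
  - intros p; apply c.
    exact (P_exE (C := Bot) (P_hyp T (in_eq _ _)) p).
Qed.

(** The formula that [F] yields over the context without its [n] innermost variables. At
    stage [k] this recovers a formula of stage [k - n] from the context alone. *)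
Fixpoint liftdrop (n : nat) (G : ctx) (F : forall G, fm G) : fm G :=
  match n, G with
  | O, _ => F _
  | S _, [] => F _
  | S n, r :: G => fshift r (liftdrop n G F)
  end.

(** Stage [k] decides the formula number [c] of stage [j], where [k] codes the pair
    [(c, j)]; then [j <= k]. *)
Definition sched (k : nat) (G : ctx) : fm G :=
  liftdrop (k - snd (of_nat k)) G (fm_enum (fst (of_nat k))).

Definition state := {G & list (fm G)}.

Definition step (k : nat) (p : state) : state :=
  let B := decide (projT2 p) (sched k (projT1 p)) in
  existT (fun G => list (fm G)) (projT1 (wit B) :: projT1 p)
    (projT2 (wit B) :: map (fshift _) (B :: projT2 p)).

Fixpoint stage (k : nat) : state :=
  match k with
  | O => existT (fun G => list (fm G)) [] [Neg A0]
  | S k => step k (stage k)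
  end.

Definition stage_ctx k : ctx := projT1 (stage k).
Definition stage_hyps k : list (fm (stage_ctx k)) := projT2 (stage k).
Definition decided k : fm (stage_ctx k) := decide (stage_hyps k) (sched k (stage_ctx k)).
Definition new_ty k : ty := projT1 (wit (decided k)).

Definition shiftS k s (t : tm (stage_ctx k) s) : tm (stage_ctx (S k)) s := tshift (new_ty k) t.
Definition fshiftS k (A : fm (stage_ctx k)) : fm (stage_ctx (S k)) := fshift (new_ty k) A.

Lemma stage_consistent k : consistent (stage_hyps k).
Proof.
  induction k.
  - intros p; apply unprovable, P_raa, p.
  - apply (wit_consistent (B := decided k) (H := stage_hyps k)), decide_consistent, IHk.
Qed.

Lemma stage_shift k A : In A (stage_hyps k) -> In (fshiftS A) (stage_hyps (S k)).
Proof. intros i; right; right; apply in_map, i. Qed.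

Lemma decided_shift k : In (fshiftS (decided k)) (stage_hyps (S k)).
Proof. right; left; reflexivity. Qed.

(** An element of the model is a term for each stage such that the terms are eventually
    obtained from each other by weakening. This represents the direct limit of the term
    models of the stages without any conversion between contexts. *)
Definition coh s (e : forall k, tm (stage_ctx k) s) :=
  exists j, forall k, j <= k -> e (S k) = shiftS (e k).
Definition cohF (B : forall k, fm (stage_ctx k)) :=
  exists j, forall k, j <= k -> B (S k) = fshiftS (B k).
Definition Ev (B : forall k, fm (stage_ctx k)) := exists j, forall k, j <= k -> In (B k) (stage_hyps k).

Lemma persist (B : forall k, fm (stage_ctx k)) j :
  (forall k, j <= k -> B (S k) = fshiftS (B k)) ->
  forall k, j <= k -> In (B k) (stage_hyps k) -> Ev B.
Proof.
  intros c k jk i; exists k; intros m km; induction km as [|m km IH]; [exact i|].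
  rewrite c by lia; apply stage_shift, IH.
Qed.

(** A formula of stage [j] is scheduled, in weakened form, at arbitrarily late stages: take
    [j] large in the pair [(n, j)]. *)
Lemma sched_hits (B : forall k, fm (stage_ctx k)) : cohF B ->
  forall k0, exists k, k0 <= k /\ sched k (stage_ctx k) = B k.
Proof.
  intros [j0 c] k0; set (j := j0 + k0).
  destruct (fm_enum_onto (B j)) as [n Hn].
  exists (to_nat (n, j)).
  pose proof (to_nat_non_decreasing n j) as L; split; [lia|].
  unfold sched; rewrite cancel_of_to; cbn [fst snd].
  set (k := to_nat (n, j)) in *; clearbody k.
  assert (E : k = (k - j) + j) by lia; revert E; generalize (k - j) as m.
  intros m ->; clear L; induction m as [|m IH]; [exact Hn|].
  change (fshiftS (liftdrop m (stage_ctx (m + j)) (fm_enum n)) = B (S (m + j))).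
  rewrite IH, c by lia; reflexivity.
Qed.

Lemma Ev_decided (B : forall k, fm (stage_ctx k)) : cohF B -> Ev B \/ Ev (fun k => Neg (B k)).
Proof.
  intros c; pose proof c as [j cj]; destruct (sched_hits c j) as [k [jk E]].
  pose proof (decided_shift k) as i; unfold decided in i; rewrite E in i.
  destruct (decide_cases (stage_hyps k) (B k)) as [D|D]; rewrite D in i; [left|right].
  - apply (persist (j := j) cj (k := S k)); [lia|]; rewrite cj by lia; exact i.
  - apply (persist (B := fun k => Neg (B k)) (j := j)) with (k := S k); [|lia|].
    + intros m Hm; rewrite cj by lia; reflexivity.
    + rewrite cj by lia; exact i.
Qed.

Lemma Ev_prv (B : forall k, fm (stage_ctx k)) : cohF B ->
  (exists j, forall k, j <= k -> prv T (stage_hyps k) (B k)) -> Ev B.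
Proof.
  intros c [j p]; destruct (Ev_decided c) as [E|[m E]]; [exact E|].
  destruct (@stage_consistent (j + m)).
  exact (P_impE (P_hyp T (E (j + m) ltac:(lia))) (p (j + m) ltac:(lia))).
Qed.

Lemma Ev_contra (B : forall k, fm (stage_ctx k)) : Ev B -> Ev (fun k => Neg (B k)) -> False.
Proof.
  intros [j p] [m E]; apply (@stage_consistent (j + m)).
  exact (P_impE (P_hyp T (E (j + m) ltac:(lia))) (P_hyp T (p (j + m) ltac:(lia)))).
Qed.

Lemma step_Ex G G0 (H : list (fm G)) B s (A : fm (s :: G0)) (f : sub G0 G) :
  B = Ex s (fsub (up_sub f) A) ->
  exists v : tm (projT1 (wit B) :: G) s,
    In (fsub (scons v (fun r x => tshift _ (f r x))) A)
       (projT2 (wit B) :: map (fshift _) (B :: H)).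
Proof. intros ->; exists (Var VZ); left; reflexivity. Qed.

Lemma step_NegAll G G0 (H : list (fm G)) B s (A : fm (s :: G0)) (f : sub G0 G) :
  B = Neg (All s (fsub (up_sub f) A)) ->
  exists v : tm (projT1 (wit B) :: G) s,
    In (Neg (fsub (scons v (fun r x => tshift _ (f r x))) A))
       (projT2 (wit B) :: map (fshift _) (B :: H)).
Proof. intros ->; exists (Var VZ); left; reflexivity. Qed.

Fixpoint dflt G s : tm G s :=
  match s with tN => Zero | Arr a b => App Pi (dflt G b) end.

Fixpoint extend_from m s (v : tm (stage_ctx m) s) (k : nat) : tm (stage_ctx k) s :=
  match Nat.eq_dec m k with
  | left e => eq_rect m (fun k => tm (stage_ctx k) s) v k e
  | right _ => match k with
    | O => dflt _ s
    | S k => shiftS (extend_from v k)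
    end
  end.

Lemma extend_from_id m s (v : tm (stage_ctx m) s) : extend_from v m = v.
Proof.
  destruct m as [|m]; cbn [extend_from].
  - reflexivity.
  - destruct (Nat.eq_dec (S m) (S m)) as [e|n]; [|congruence].
    rewrite (UIP_dec Nat.eq_dec e eq_refl); reflexivity.
Qed.

Lemma extend_from_S m s (v : tm (stage_ctx m) s) k :
  m <= k -> extend_from v (S k) = shiftS (extend_from v k).
Proof.
  intros mk; cbn [extend_from]; destruct (Nat.eq_dec m (S k)); [lia|reflexivity].
Qed.

Definition hdom s := {e : forall k, tm (stage_ctx k) s | coh e}.

Definition constH s (c : forall G, tm G s)
  (Hc : forall k, c (stage_ctx (S k)) = shiftS (c (stage_ctx k))) : hdom s :=
  exist _ (fun k => c (stage_ctx k)) (ex_intro _ 0 (fun k _ => Hc k)).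

Lemma app_coh s t (f : hdom (s ~> t)) (x : hdom s) :
  coh (fun k => App (proj1_sig f k) (proj1_sig x k)).
Proof.
  destruct f as [f [j Hf]], x as [x [m Hx]]; exists (j + m); intros k Hk; simpl.
  rewrite Hf, Hx by lia; reflexivity.
Qed.

Definition henkin : structure := {|
  dom := hdom;
  app := fun s t f x => exist _ _ (app_coh f x);
  zeroM := constH (c := @Zero) (fun _ => eq_refl);
  oneM := constH (c := @One) (fun _ => eq_refl);
  addM := constH (c := @Add) (fun _ => eq_refl);
  mulM := constH (c := @Mul) (fun _ => eq_refl);
  piM := fun s t => constH (c := fun G => @Pi G s t) (fun _ => eq_refl);
  sigmaM := fun r s t => constH (c := fun G => @Sigma G r s t) (fun _ => eq_refl);
  recM := constH (c := @Rec) (fun _ => eq_refl);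
  eqM := fun x y => Ev (fun k => Equ (proj1_sig x k) (proj1_sig y k));
  ltM := fun x y => Ev (fun k => Less (proj1_sig x k) (proj1_sig y k)) |}.

Definition at_ G (e : env henkin G) k : sub G (stage_ctx k) := fun s v => proj1_sig (e s v) k.

Lemma eval_at G (e : env henkin G) s (t : tm G s) k :
  proj1_sig (eval e t) k = tsub (at_ e k) t.
Proof. induction t; simpl; rewrite ?IHt1, ?IHt2; reflexivity. Qed.

Lemma env_coh G (e : env henkin G) :
  exists j, forall k, j <= k -> at_ e (S k) = fun s v => shiftS (at_ e k v).
Proof.
  induction G as [|s G IH].
  - exists 0; intros k _; apply sub_ext; intros s v; exact (var_nil _ v).
  - destruct (IH (fun r v => e r (VS v))) as [j Hj].
    destruct (proj2_sig (e s VZ)) as [m Hm].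
    exists (j + m); intros k Hk; apply sub_cons_ext.
    + apply Hm; lia.
    + intros r v; change (at_ (fun r v => e r (VS v)) (S k) v =
        shiftS (at_ (fun r v => e r (VS v)) k v)); rewrite Hj by lia; reflexivity.
Qed.

Lemma fsub_coh G (e : env henkin G) (A : fm G) : cohF (fun k => fsub (at_ e k) A).
Proof.
  destruct (env_coh e) as [j Hj]; exists j; intros k Hk.
  unfold fshiftS, fshift; rewrite fren_fsub, Hj by lia; reflexivity.
Qed.

Lemma at_econs G s (d : henkin.(dom) s) (e : env henkin G) k :
  at_ (econs d e) k = scons (proj1_sig d k) (at_ e k).
Proof. apply sub_cons_ext; reflexivity. Qed.

Definition famH m s (v : tm (stage_ctx m) s) : hdom s :=
  exist _ (extend_from v) (ex_intro _ m (fun k Hk => extend_from_S v Hk)).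

Lemma sched_step G (e : env henkin G) (F : forall D, sub G D -> fm D) :
  (forall k, F _ (fun s v => shiftS (at_ e k v)) = fshiftS (F _ (at_ e k))) ->
  Ev (fun k => F _ (at_ e k)) ->
  exists k, (forall l, k <= l -> at_ e (S l) = (fun s v => shiftS (at_ e l v)))
    /\ decided k = F _ (at_ e k).
Proof.
  intros N [j Hj]; destruct (env_coh e) as [m Hm].
  destruct (@sched_hits (fun k => F _ (at_ e k))) with (k0 := j + m) as [k [Hk E]].
  - exists m; intros k Hk; rewrite Hm by lia; apply N.
  - exists k; split; [intros l Hl; apply Hm; lia|].
    unfold decided; rewrite E; apply decide_in; [apply stage_consistent|apply Hj; lia].
Qed.

(** A witness variable introduced at stage [k] becomes an element of the model by
    weakening it at the later stages. *)
Lemma Ev_witness G (e : env henkin G) s (A : fm (s :: G)) k (v : tm (stage_ctx (S k)) s) :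
  (forall l, k <= l -> at_ e (S l) = (fun s v => shiftS (at_ e l v))) ->
  In (fsub (scons v (fun r x => shiftS (at_ e k x))) A) (stage_hyps (S k)) ->
  exists d : hdom s, Ev (fun k => fsub (at_ (econs (M := henkin) d e) k) A).
Proof.
  intros E i; exists (famH v).
  set (B := fun k => fsub (at_ (econs (M := henkin) (famH v) e) k) A).
  apply (persist (B := B) (j := S k)) with (k := S k); [|lia|].
  - intros l Hl; unfold B, fshiftS, fshift; rewrite fren_fsub; f_equal.
    rewrite !at_econs, E by lia; apply sub_cons_ext; [|reflexivity].
    cbn [scons proj1_sig famH]; apply extend_from_S, Hl.
  - unfold B; rewrite at_econs, E by lia; cbn [proj1_sig famH].
    rewrite extend_from_id; exact i.
Qed.

Lemma fsub_up_shift G k s (f : sub G (stage_ctx k)) (A : fm (s :: G)) :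
  fsub (up_sub (fun s v => shiftS (f s v))) A
  = fren (up_ren (fun _ v => VS v)) (fsub (up_sub f) A).
Proof.
  rewrite fren_fsub; f_equal; apply sub_cons_ext; [reflexivity|].
  intros r v; cbn; unfold tshift, shiftS, tshift; rewrite !tren_tren; reflexivity.
Qed.

(** The environment is substituted stage by stage, which makes the cases of the
    quantifiers immediate from [P_allE], [P_exI] and the witness variables. *)
Lemma truth G (A : fm G) : forall e : env henkin G,
  sat e A <-> Ev (fun k => fsub (at_ e k) A).
Proof.
  induction A as [G t u|G t u|G|G A IHA B IHB|G A IHA B IHB|G A IHA B IHB
    |G s A IH|G s A IH]; intros e; cbn [sat fsub].
  - cbn; split; intros [j H]; exists j; intros k Hk; specialize (H k Hk);
      rewrite !eval_at in *; exact H.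
  - cbn; split; intros [j H]; exists j; intros k Hk; specialize (H k Hk);
      rewrite !eval_at in *; exact H.
  - split; [tauto|]; intros [j H]; exact (stage_consistent (P_hyp T (H j (le_n j)))).
  - rewrite IHA, IHB; split.
    + intros [[j H] [m K]]; apply (Ev_prv (fsub_coh e (And A B))).
      exists (j + m); intros k Hk; apply P_andI; apply P_hyp; [apply H|apply K]; lia.
    + intros [j H]; split; apply Ev_prv; try apply fsub_coh; exists j; intros k Hk.
      * exact (P_andE1 (P_hyp T (H k Hk))).
      * exact (P_andE2 (P_hyp T (H k Hk))).
  - rewrite IHA, IHB; split.
    + intros [[j H]|[j H]]; apply (Ev_prv (fsub_coh e (Or A B))); exists j; intros k Hk.
      * apply P_orI1, P_hyp, H, Hk.
      * apply P_orI2, P_hyp, H, Hk.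
    + intros [j H]; destruct (Ev_decided (fsub_coh e A)) as [E|[m E]]; [tauto|right].
      apply (Ev_prv (fsub_coh e B)); exists (j + m); intros k Hk.
      refine (P_orE (P_hyp T (H k ltac:(lia))) _ (P_hyp T (in_eq _ _))).
      apply P_raa.
      refine (P_impE (A := fsub (at_ e k) A) (P_hyp T _) (P_hyp T _)).
      * right; right; apply E; lia.
      * right; left; reflexivity.
  - rewrite IHA, IHB; split.
    + intros H; destruct (Ev_decided (fsub_coh e A)) as [E|[m E]].
      * destruct (H E) as [j K]; apply (Ev_prv (fsub_coh e (Imp A B))).
        exists j; intros k Hk; apply P_impI, P_hyp; right; apply K, Hk.
      * apply (Ev_prv (fsub_coh e (Imp A B))); exists m; intros k Hk.
        apply P_impI, P_raa.
        refine (P_impE (A := fsub (at_ e k) A) (P_hyp T _) (P_hyp T _)).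
        -- right; right; apply E, Hk.
        -- right; left; reflexivity.
    + intros [j H] [m K]; apply (Ev_prv (fsub_coh e B)); exists (j + m); intros k Hk.
      exact (P_impE (P_hyp T (H k ltac:(lia))) (P_hyp T (K k ltac:(lia)))).
  - split.
    + intros H; destruct (Ev_decided (fsub_coh e (All s A))) as [E|E]; [exact E|].
      exfalso.
      destruct (sched_step (e := e) (F := fun D f => Neg (All s (fsub (up_sub f) A)))) with (2 := E)
        as [k [C D]].
      { intros k; rewrite fsub_up_shift; reflexivity. }
      destruct (step_NegAll (stage_hyps k) D) as [v i].
      destruct (Ev_witness (e := e) (A := Neg A) (k := k) (v := v) C i) as [d Hd].
      apply (Ev_contra (proj1 (IH _) (H d))); exact Hd.
    + intros [j H] d; apply IH, Ev_prv; [apply fsub_coh|].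
      exists j; intros k Hk; rewrite at_econs, <- inst_up.
      exact (P_allE _ (P_hyp T (H k Hk))).
  - split.
    + intros [d Hd]; apply IH in Hd; destruct Hd as [j H].
      apply (Ev_prv (fsub_coh e (Ex s A))); exists j; intros k Hk.
      apply (P_exI (t := proj1_sig d k)), P_hyp.
      rewrite inst_up, <- at_econs; apply H, Hk.
    + intros E.
      destruct (sched_step (e := e) (F := fun D f => Ex s (fsub (up_sub f) A))) with (2 := E)
        as [k [C D]].
      { intros k; rewrite fsub_up_shift; reflexivity. }
      destruct (step_Ex (stage_hyps k) D) as [v i].
      destruct (Ev_witness (e := e) (k := k) (v := v) C i) as [d Hd].
      exists d; apply IH, Hd.
Qed.

Definition env0 (M : structure) : env M [] := fun s v => var_nil _ v.

Lemma henkin_stable G (A : fm G) (e : env henkin G) : stable T A -> sat e A.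
Proof.
  intros S; apply truth, Ev_prv; [apply fsub_coh|].
  exists 0; intros k _; apply P_ax, S.
Qed.

Lemma henkin_refutes : ~ sat (env0 henkin) A0.
Proof.
  rewrite truth; intros H; apply (Ev_contra H).
  apply (persist (B := fun k => fsub (at_ (env0 henkin) k) (Neg A0)) (j := 0)) with (k := 0).
  - intros k _; unfold fshiftS, fshift; rewrite fren_fsub; f_equal.
    apply sub_ext; intros s v; exact (var_nil _ v).
  - lia.
  - left; change (Neg A0 = fsub (at_ (env0 henkin) 0) (Neg A0)).
    rewrite <- (fsub_Var (Neg A0)) at 1; f_equal.
    apply sub_ext; intros s v; exact (var_nil _ v).
Qed.

End Henkin.

Theorem completeness (T : theory) (A : sentence) :
  (forall M : structure,
     (forall G (B : fm G) (e : env M G), stable T B -> sat e B) -> sat (env0 M) A) ->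
  proves T A.
Proof.
  intros H; apply NNPP; intros n.
  exact (henkin_refutes n (H _ (fun G B e S => henkin_stable n e S))).
Qed.

(** * Quotients *)

Section Quotient.
Variables (A : Type) (R : A -> A -> Prop).
Hypothesis Rrefl : forall x, R x x.
Hypothesis Rsym : forall x y, R x y -> R y x.
Hypothesis Rtrans : forall x y z, R x y -> R y z -> R x z.

Definition quot := {P : A -> Prop | exists a, P = R a}.
Definition cls (a : A) : quot := exist _ (R a) (ex_intro _ a eq_refl).
Definition repr (q : quot) : A :=
  proj1_sig (constructive_indefinite_description _ (proj2_sig q)).

Lemma cls_repr q : cls (repr q) = q.
Proof.
  unfold repr; destruct constructive_indefinite_description as [a Ha]; simpl.
  apply eq_sig_hprop; [intros; apply proof_irrelevance|symmetry; exact Ha].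
Qed.

Lemma cls_eq a b : cls a = cls b <-> R a b.
Proof.
  split.
  - intros E; apply (f_equal (@proj1_sig _ _)) in E; simpl in E.
    rewrite E; apply Rrefl.
  - intros H; apply eq_sig_hprop; [intros; apply proof_irrelevance|]; simpl.
    apply functional_extensionality; intros x; apply propositional_extensionality.
    split; eauto.
Qed.

End Quotient.

(** * Extensional models *)

(** Structures in which the equality of the calculus is identity, at all types. *)
Record normal (M : structure) : Prop := {
  eqM_eq : forall x y : dom M tN, eqM x y <-> x = y;
  dom_ext : forall s t (f g : dom M (s ~> t)), (forall x, app f x = app g x) -> f = g }.

Lemma eval_tren M G D (f : ren G D) (e : env M D) s (t : tm G s) :
  eval e (tren f t) = eval (fun _ v => e _ (f _ v)) t.
Proof. induction t; simpl; congruence. Qed.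

Lemma eval_tshift M G r (d : dom M r) (e : env M G) s (t : tm G s) :
  eval (econs d e) (tshift r t) = eval e t.
Proof. apply eval_tren. Qed.

Lemma env_cons_ext M r G (e e' : env M (r :: G)) :
  e r VZ = e' r VZ -> (forall s v, e s (VS v) = e' s (VS v)) -> e = e'.
Proof.
  intros H0 H1; apply functional_extensionality_dep; intros s.
  apply functional_extensionality; intros v; revert s v.
  apply (var_case (P := fun s v => e s v = e' s v)); assumption.
Qed.

Section Collapse.
Variable T : theory.
Hypothesis T_RCA : forall G (A : fm G), RCA0w A -> T A.
Variable M : structure.
Hypothesis M_sat : forall G (A : fm G) (e : env M G), stable T A -> sat e A.

Fixpoint eqd s : dom M s -> dom M s -> Prop :=
  match s with
  | tN => fun x y => eqM x y
  | Arr a b => fun f g => forall x, eqd (app f x) (app g x)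
  end.

Lemma sat_eqt s : forall G (e : env M G) (t u : tm G s),
  sat e (eqt t u) <-> eqd (eval e t) (eval e u).
Proof.
  induction s as [|r IHr s IHs]; intros; simpl; [tauto|].
  split; intros H d; specialize (H d); rewrite IHs in *; simpl in *;
    rewrite !eval_tshift in *; exact H.
Qed.

Lemma sat_semiring A : semiring_ax A -> sat (env0 M) (close [] A).
Proof.
  intros H; apply M_sat; intros D f; rewrite fsub_close; apply T_RCA.
  apply (ax_semiring D H).
Qed.

Lemma eqM_refl (x : dom M tN) : eqM x x.
Proof. exact (sat_semiring eq_refl_ax x). Qed.

Lemma eqM_sym (x y : dom M tN) : eqM x y -> eqM y x.
Proof. exact (sat_semiring eq_sym_ax x y). Qed.

Lemma eqM_trans (x y z : dom M tN) : eqM x y -> eqM y z -> eqM x z.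
Proof. exact (sat_semiring eq_trans_ax x y z). Qed.

Lemma ltM_congr (x y z w : dom M tN) : eqM x y -> eqM z w -> ltM x z -> ltM y w.
Proof. exact (sat_semiring lt_congr_ax x y z w). Qed.

Lemma eqd_refl s (x : dom M s) : eqd x x.
Proof. induction s; simpl; [apply eqM_refl|auto]. Qed.

Lemma eqd_sym s (x y : dom M s) : eqd x y -> eqd y x.
Proof. induction s; simpl; [apply eqM_sym|auto]. Qed.

Lemma eqd_trans s (x y z : dom M s) : eqd x y -> eqd y z -> eqd x z.
Proof. induction s; simpl; [apply eqM_trans|eauto]. Qed.

(** The axioms of extensionality turn [eqd] into a congruence, and this is what the quotient
    by [eqd] needs. *)
Lemma eqd_app s t (f g : dom M (s ~> t)) (x y : dom M s) :
  eqd f g -> eqd x y -> eqd (app f x) (app g y).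
Proof.
  intros Hf Hx; apply eqd_trans with (app g x); [apply Hf|].
  assert (E : sat (env0 M) (All s (All s (All (s ~> t)
      (Imp (eqt v2 v1) (eqt (App v0 v2) (App v0 v1))))))).
  { apply M_sat; intros D h; simpl; rewrite !fsub_eqt; apply T_RCA, ax_ext. }
  specialize (E x y g); simpl in E; rewrite !sat_eqt in E; exact (E Hx).
Qed.

Notation "[ x ]" := (cls (@eqd _) x).

Definition collapse : structure := {|
  dom := fun s => quot (@eqd s);
  app := fun s t f x => [app (repr f) (repr x)];
  zeroM := [zeroM M];
  oneM := [oneM M];
  addM := [addM M];
  mulM := [mulM M];
  piM := fun s t => [piM M s t];
  sigmaM := fun r s t => [sigmaM M r s t];
  recM := [recM M];
  eqM := eq;
  ltM := fun x y => ltM (repr x) (repr y) |}.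

Lemma eqd_cls s (x y : dom M s) : [x] = [y] <-> eqd x y.
Proof. apply cls_eq; [apply eqd_refl|apply eqd_sym|apply eqd_trans]. Qed.

Lemma eqd_repr s (x : dom M s) : eqd (repr [x]) x.
Proof. apply eqd_cls, cls_repr. Qed.

Lemma app_cls s t (f : dom M (s ~> t)) (x : dom M s) :
  @app collapse s t [f] [x] = [app f x].
Proof. apply eqd_cls, eqd_app; apply eqd_repr. Qed.

Definition cls_env G (e : env M G) : env collapse G := fun s v => [e s v].

Lemma eval_cls G (e : env M G) s (t : tm G s) :
  eval (cls_env e) t = [eval e t].
Proof.
  induction t; try reflexivity; simpl eval.
  rewrite IHt1, IHt2; apply app_cls.
Qed.

Lemma cls_econs G s (d : dom M s) (e : env M G) :
  cls_env (econs d e) = econs (M := collapse) ([d] : dom collapse s) (cls_env e).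
Proof. apply env_cons_ext; reflexivity. Qed.

Lemma sat_cls G (A : fm G) : forall e : env M G, sat (cls_env e) A <-> sat e A.
Proof.
  induction A as [G t u|G t u|G|G A IHA B IHB|G A IHA B IHB|G A IHA B IHB
    |G s A IH|G s A IH]; intros e; simpl.
  - rewrite !eval_cls; apply eqd_cls.
  - rewrite !eval_cls; split; apply ltM_congr; try apply (@eqd_repr tN);
      apply (@eqd_sym tN), (@eqd_repr tN).
  - tauto.
  - rewrite IHA, IHB; tauto.
  - rewrite IHA, IHB; tauto.
  - rewrite IHA, IHB; tauto.
  - split; intros H d.
    + apply IH; rewrite cls_econs; apply H.
    + rewrite <- (cls_repr d), <- cls_econs; apply IH, H.
  - split; intros [d H].
    + exists (repr d); apply IH; rewrite cls_econs, cls_repr; exact H.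
    + exists ([d]); rewrite <- cls_econs; apply IH, H.
Qed.

Lemma collapse_normal : normal collapse.
Proof.
  split; [reflexivity|]; intros s t f g H.
  rewrite <- (cls_repr f), <- (cls_repr g) in *; apply eqd_cls; intros x.
  specialize (H [x]); rewrite !app_cls in H; apply eqd_cls, H.
Qed.

Lemma env_repr G (e : env collapse G) : e = cls_env (fun s v => repr (e s v)).
Proof.
  apply functional_extensionality_dep; intros s.
  apply functional_extensionality; intros v; symmetry; apply cls_repr.
Qed.

End Collapse.

Theorem normal_completeness (T : theory) (A : sentence) :
  (forall G (B : fm G), RCA0w B -> T G B) ->
  (forall M : structure, normal M ->
     (forall G (B : fm G) (e : env M G), stable T B -> sat e B) -> sat (env0 M) A) ->
  proves T A.
Proof.
  intros TR H; apply completeness; intros M HM.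
  specialize (H (collapse M) (collapse_normal TR HM)).
  assert (E : env0 (collapse M) = cls_env (env0 M)).
  { apply functional_extensionality_dep; intros s.
    apply functional_extensionality; intros v; exact (var_nil _ v). }
  rewrite E, (sat_cls TR HM) in H; apply H; intros G B e S.
  rewrite (env_repr e); apply (sat_cls TR HM), HM, S.
Qed.

(** * The axioms read in a model *)

Declare Scope model_scope.
Delimit Scope model_scope with M.
Notation "f '⋅' x" := (app f x) (at level 25, left associativity) : model_scope.
Notation "0" := (zeroM _) : model_scope.
Notation "1" := (oneM _) : model_scope.
(** Constants instead of applications of [addM] and [mulM], so that the ring tactics
    recognize them. *)
Definition addN (M : structure) (x y : dom M tN) : dom M tN := app (app (addM M) x) y.
Definition mulN (M : structure) (x y : dom M tN) : dom M tN := app (app (mulM M) x) y.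
Notation "x + y" := (addN x y) : model_scope.
Notation "x * y" := (mulN x y) : model_scope.
Notation "x < y" := (ltM x y) : model_scope.
Open Scope model_scope.

Class arith_model (M : structure) : Prop := {
  am_ext : forall s t (f g : dom M (s ~> t)), (forall x, f ⋅ x = g ⋅ x) -> f = g;
  am_addA : forall x y z : dom M tN, (x + y) + z = x + (y + z);
  am_addC : forall x y : dom M tN, x + y = y + x;
  am_add0 : forall x : dom M tN, x + 0 = x;
  am_mulA : forall x y z : dom M tN, (x * y) * z = x * (y * z);
  am_mulC : forall x y : dom M tN, x * y = y * x;
  am_mul1 : forall x : dom M tN, x * 1 = x;
  am_mul0 : forall x : dom M tN, x * 0 = 0;
  am_distr : forall x y z : dom M tN, x * (y + z) = x * y + x * z;
  am_lt_irrefl : forall x : dom M tN, ~ x < x;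
  am_lt_trans : forall x y z : dom M tN, x < y -> y < z -> x < z;
  am_lt_total : forall x y : dom M tN, x < y \/ x = y \/ y < x;
  am_lt_add : forall x y z : dom M tN, x < y -> x + z < y + z;
  am_lt_mul : forall x y z : dom M tN, 0 < z -> x < y -> x * z < y * z;
  am_lt01 : zeroM M < 1;
  am_pi : forall s t (x : dom M s) (y : dom M t), piM M s t ⋅ x ⋅ y = x;
  am_sigma : forall r s t (f : dom M (r ~> s ~> t)) (g : dom M (r ~> s)) (x : dom M r),
    sigmaM M r s t ⋅ f ⋅ g ⋅ x = f ⋅ x ⋅ (g ⋅ x);
  am_rec0 : forall (f : dom M (tN ~> tN ~> tN)) (m : dom M tN), recM M ⋅ f ⋅ m ⋅ 0 = m;
  am_recS : forall (f : dom M (tN ~> tN ~> tN)) (m n : dom M tN),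
    recM M ⋅ f ⋅ m ⋅ (n + 1) = f ⋅ n ⋅ (recM M ⋅ f ⋅ m ⋅ n);
  am_ind : forall f g h k : dom M t1, f ⋅ 0 = g ⋅ 0 \/ h ⋅ 0 = k ⋅ 0 ->
    (forall n, f ⋅ n = g ⋅ n \/ h ⋅ n = k ⋅ n ->
       f ⋅ (n + 1) = g ⋅ (n + 1) \/ h ⋅ (n + 1) = k ⋅ (n + 1)) ->
    forall n, f ⋅ n = g ⋅ n \/ h ⋅ n = k ⋅ n;
  am_ind_lt : forall f g : dom M t1, f ⋅ 0 < g ⋅ 0 ->
    (forall n, f ⋅ n < g ⋅ n -> f ⋅ (n + 1) < g ⋅ (n + 1)) -> forall n, f ⋅ n < g ⋅ n;
  am_mu : exists mu : dom M t2, forall f : dom M t1, (exists n, f ⋅ n = 0) ->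
    f ⋅ (mu ⋅ f) = 0 /\ forall i, i < mu ⋅ f -> f ⋅ i <> 0 }.

Section Extract.
Variable T : theory.
Hypothesis T_RCA : forall G (A : fm G), RCA0w A -> T A.
Hypothesis T_mu : forall G, T (close G mu2).
Variable M : structure.
Hypothesis M_normal : normal M.
Hypothesis M_sat : forall G (A : fm G) (e : env M G), stable T A -> sat e A.

Lemma eqd_normal s (x y : dom M s) : eqd x y -> x = y.
Proof.
  induction s as [|r IHr s IHs]; simpl; [apply (eqM_eq M_normal)|].
  intros H; apply (dom_ext M_normal); intros z; apply IHs, H.
Qed.

Lemma stable_sentence (A : sentence) : (forall G, T (close G A)) -> stable T A.
Proof.
  intros H D f; specialize (H D); unfold close in H.
  replace f with (fun s (v : var [] s) => match v in var E _ return
    match E with [] => tm D s | _ :: _ => unit end with VZ => tt | VS _ => tt end);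
    [exact H|].
  apply sub_ext; intros s v; exact (var_nil _ v).
Qed.

Lemma arith_model_of_normal : arith_model M.
Proof.
  assert (E : forall x y : dom M tN, eqM x y <-> x = y) by apply (eqM_eq M_normal).
  pose proof (sat_semiring T_RCA M_sat) as S.
  split.
  - apply (dom_ext M_normal).
  - intros x y z; apply E, (S _ add_assoc_ax x y z).
  - intros x y; apply E, (S _ add_comm_ax x y).
  - intros x; apply E, (S _ add_0_ax x).
  - intros x y z; apply E, (S _ mul_assoc_ax x y z).
  - intros x y; apply E, (S _ mul_comm_ax x y).
  - intros x; apply E, (S _ mul_1_ax x).
  - intros x; apply E, (S _ mul_0_ax x).
  - intros x y z; apply E, (S _ distr_ax x y z).
  - intros x; apply (S _ lt_irrefl_ax x).
  - intros x y z; apply (S _ lt_trans_ax x y z).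
  - intros x y; rewrite <- E.
    pose proof (S _ lt_total_ax x y) as H; cbn in H; exact H.
  - intros x y z; apply (S _ lt_add_ax x y z).
  - intros x y z; apply (S _ lt_mul_ax x y z).
  - apply (S _ lt_0_1_ax).
  - intros s t x y; apply eqd_normal.
    assert (H : sat (env0 M) (All s (All t (eqt (App (App Pi v1) v0) v1)))).
    { apply M_sat; intros D h; simpl; rewrite fsub_eqt; apply T_RCA, ax_Pi. }
    specialize (H x y); simpl in H; rewrite sat_eqt in H; exact H.
  - intros r s t f g x; apply eqd_normal.
    assert (H : sat (env0 M) (All (r ~> s ~> t) (All (r ~> s) (All r
       (eqt (App (App (App Sigma v2) v1) v0) (App (App v2 v0) (App v1 v0))))))).
    { apply M_sat; intros D h; simpl; rewrite fsub_eqt; apply T_RCA, ax_Sigma. }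
    specialize (H f g x); simpl in H; rewrite sat_eqt in H; exact H.
  - intros f m; apply E.
    refine (M_sat (A := All (tN ~> tN ~> tN) (All tN
      (Equ (App (App (App Rec v1) v0) Zero) v0))) (env0 M) _ f m).
    intros D h; exact (T_RCA (ax_Rec0 D)).
  - intros f m n; apply E.
    refine (M_sat (A := All (tN ~> tN ~> tN) (All tN (All tN
      (Equ (App (App (App Rec v2) v1) (App (App Add v0) One))
         (App (App v2 v0) (App (App (App Rec v2) v1) v0)))))) (env0 M) _ f m n).
    intros D h; exact (T_RCA (ax_RecS D)).
  - intros f g h k; rewrite <- !E; intros H0 H1 n; rewrite <- !E.
    (* Four parameters, so that the formula covers all disjunctions of two equations
       between functions of one number. *)
    set (A := Or (Equ (App (@v4 [] t1 t1 t1 t1 tN) v0) (App v3 v0))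
                 (Equ (App v2 v0) (App v1 v0))).
    refine (M_sat (A := Imp (inst A Zero)
      (Imp (All tN (Imp A (fsub (scons (App (App Add v0) One) (fun _ v => Var (VS v))) A)))
           (All tN A))) (econs k (econs h (econs g (econs f (env0 M))))) _ H0 _ n).
    + intros D j.
      pose proof (@ax_ind D
        (Or (Equ (App (tshift tN (j _ (VS (VS (VS VZ))))) v0)
                 (App (tshift tN (j _ (VS (VS VZ)))) v0))
            (Equ (App (tshift tN (j _ (VS VZ))) v0) (App (tshift tN (j _ VZ)) v0)))
        ltac:(cbn; tauto)) as K.
      unfold inst in K; cbn in K |- *; rewrite !tsub_tshift in K; cbn in K.
      rewrite !tsub_Var, !(tsub_rename (fun _ v => VS v)) in K; exact (T_RCA K).
    + intros i Hi; cbn in Hi |- *; rewrite !E in Hi; rewrite !E; exact (H1 i Hi).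
  - intros f g H0 H1 n.
    set (A := Less (App (@v2 [] t1 t1 tN) v0) (App v1 v0)).
    refine (M_sat (A := Imp (inst A Zero)
      (Imp (All tN (Imp A (fsub (scons (App (App Add v0) One) (fun _ v => Var (VS v))) A)))
           (All tN A))) (econs g (econs f (env0 M))) _ H0 H1 n).
    intros D j.
    pose proof (@ax_ind D (Less (App (tshift tN (j _ (VS VZ))) v0)
      (App (tshift tN (j _ VZ)) v0)) I) as K.
    unfold inst in K; cbn in K |- *; rewrite !tsub_tshift in K; cbn in K.
    rewrite !tsub_Var, !(tsub_rename (fun _ v => VS v)) in K; exact (T_RCA K).
  - destruct (M_sat (env0 M) (stable_sentence T_mu)) as [mu Hmu].
    exists mu; intros f [n Hn]; specialize (Hmu f); cbn in Hmu.
    destruct Hmu as [Hmu _]; destruct Hmu as [Hz Hl]; [exists n; apply E, Hn|].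
    split; [apply E, Hz|]; intros i Hi; rewrite <- E; exact (Hl i Hi).
Qed.
End Extract.

(** * Internal definability *)

Fixpoint pts (M : structure) (E : list ty) : Type :=
  match E with [] => unit | a :: E => (dom M a * pts M E)%type end.

Definition hd M a E (p : pts M (a :: E)) : dom M a := fst p.
Definition tl M a E (p : pts M (a :: E)) : pts M E := snd p.

Fixpoint arrs (E : list ty) (s : ty) : ty :=
  match E with [] => s | a :: E => arrs E (a ~> s) end.

Fixpoint apps M (E : list ty) : forall s, dom M (arrs E s) -> pts M E -> dom M s :=
  match E with
  | [] => fun s f _ => f
  | a :: E => fun s f p => apps (s := a ~> s) f (tl p) ⋅ hd p
  end.

(** [F] is definable in the sequence [E] of argument types when an internal functional
    computes it. *)
Definition definable M E s (F : pts M E -> dom M s) : Prop :=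
  exists f, forall p, apps (E := E) f p = F p.

Section Model.
Context {M : structure} {AM : arith_model M}.
Notation D := (dom M).
Notation N := (dom M tN).
Notation Def E F := (@definable M E _ F).
Notation DefOp1 f := (forall E F, Def E F -> Def E (fun p => f (F p))).
Notation DefOp2 f :=
  (forall E F G, Def E F -> Def E G -> Def E (fun p => f (F p) (G p))).
Notation Def1 F := (@definable M [tN] tN (fun p => F (hd p))).
Notation Def2 F := (@definable M [tN; tN] tN (fun p => F (hd (tl p)) (hd p))).

(** Bracket abstraction. Constants and applications are treated together because the step
    for the combinator [Sigma] uses both for the shorter list. *)
Lemma Def_const_app E :
  (forall s (c : D s), Def E (fun _ => c)) /\
  (forall s t (F : pts M E -> D (s ~> t)) (G : pts M E -> D s),
     Def E F -> Def E G -> Def E (fun p => F p ⋅ G p)).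
Proof.
  induction E as [|a E [IHc IHa]]; split.
  - intros s c; exists c; intros p; reflexivity.
  - intros s t F G [f Hf] [g Hg]; exists (f ⋅ g); intros p; simpl in *.
    rewrite <- Hf, <- Hg; reflexivity.
  - intros s c; destruct (IHc _ (piM M s a ⋅ c)) as [f Hf]; exists f; intros p; simpl.
    rewrite Hf; apply am_pi.
  - intros s t F G [f Hf] [g Hg]; simpl in *.
    destruct (IHa _ _ (fun p => sigmaM M a s t ⋅ apps (s := a ~> s ~> t) f p)
      (fun p => apps (s := a ~> s) g p)) as [h Hh].
    + apply IHa; [apply IHc|exists f; reflexivity].
    + exists g; reflexivity.
    + exists h; intros p; simpl; rewrite Hh, am_sigma, Hf, Hg; reflexivity.
Qed.

Lemma Def_const E s (c : D s) : Def E (fun _ => c).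
Proof. apply Def_const_app. Qed.

Lemma Def_app E s t (F : pts M E -> D (s ~> t)) (G : pts M E -> D s) :
  Def E F -> Def E G -> Def E (fun p => F p ⋅ G p).
Proof. apply Def_const_app. Qed.

Lemma Def_hd E a : Def (a :: E) (fun p => hd p).
Proof.
  destruct (Def_const E (sigmaM M a (tN ~> a) a ⋅ piM M a (tN ~> a) ⋅ piM M a tN)) as [f Hf].
  exists f; intros p; simpl; rewrite Hf, am_sigma, am_pi; reflexivity.
Qed.

Lemma Def_tl E a s (F : pts M E -> D s) :
  Def E F -> Def (a :: E) (fun p => F (tl p)).
Proof.
  intros HF; destruct (Def_app (Def_const E (piM M s a)) HF) as [f Hf].
  exists f; intros p; simpl; rewrite Hf; apply am_pi.
Qed.

Lemma Def_v1 E a b : Def (a :: b :: E) (fun p => hd (tl p)).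
Proof. apply Def_tl with (F := fun p => hd p), Def_hd. Qed.
Lemma Def_v2 E a b c : Def (a :: b :: c :: E) (fun p => hd (tl (tl p))).
Proof. apply Def_tl with (F := fun p => hd (tl p)), Def_v1. Qed.
Lemma Def_v3 E a b c d :
  Def (a :: b :: c :: d :: E) (fun p => hd (tl (tl (tl p)))).
Proof. apply Def_tl with (F := fun p => hd (tl (tl p))), Def_v2. Qed.
Lemma Def_v4 E a b c d e :
  Def (a :: b :: c :: d :: e :: E) (fun p => hd (tl (tl (tl (tl p))))).
Proof. apply Def_tl with (F := fun p => hd (tl (tl (tl p)))), Def_v3. Qed.
Lemma Def_v5 E a b c d e f :
  Def (a :: b :: c :: d :: e :: f :: E)
    (fun p => hd (tl (tl (tl (tl (tl p)))))).
Proof. apply Def_tl with (F := fun p => hd (tl (tl (tl (tl p))))), Def_v4. Qed.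
Lemma Def_v6 E a b c d e f g :
  Def (a :: b :: c :: d :: e :: f :: g :: E)
    (fun p => hd (tl (tl (tl (tl (tl (tl p))))))).
Proof. apply Def_tl with (F := fun p => hd (tl (tl (tl (tl (tl p)))))), Def_v5. Qed.

Lemma Def_ext E s (F G : pts M E -> D s) : (forall p, F p = G p) -> Def E G -> Def E F.
Proof. intros H [f Hf]; exists f; intros p; rewrite Hf, H; reflexivity. Qed.

Definition point s : D s := eval (env0 M) (dflt [] s).

(** The internal function that agrees with [F], when there is one. *)
Definition lam a s (F : D a -> D s) : D (a ~> s) :=
  epsilon (inhabits (point (a ~> s))) (fun f => forall x, f ⋅ x = F x).

Lemma beta a s (F : D a -> D s) x :
  Def [a] (fun p => F (hd p)) -> lam F ⋅ x = F x.
Proof.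
  intros [f Hf]; revert x; unfold lam; apply epsilon_spec; exists f.
  intros x; exact (Hf (x, tt)).
Qed.

Lemma lam_of a s (F : D a -> D s) f : (forall x, f ⋅ x = F x) -> lam F = f.
Proof.
  intros H; apply am_ext; intros x; rewrite H.
  revert x; unfold lam; apply epsilon_spec; exists f; exact H.
Qed.

Lemma Def_lam E a s (B : D a -> pts M E -> D s) :
  Def (a :: E) (fun p => B (hd p) (tl p)) -> Def E (fun p => lam (fun x => B x p)).
Proof.
  intros [f Hf]; exists f; intros p; symmetry; apply lam_of; intros x.
  exact (Hf (x, p)).
Qed.

Lemma beta2 a b s (F : D a -> D b -> D s) x y :
  Def [b; a] (fun p => F (hd (tl p)) (hd p)) -> lam (fun x => lam (fun y => F x y)) ⋅ x ⋅ y = F x y.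
Proof.
  intros H; rewrite (beta (F := fun x => lam (fun y => F x y))).
  - apply beta; destruct H as [g Hg]; exists (g ⋅ x); intros p; exact (Hg (hd p, (x, tt))).
  - apply Def_lam with (B := fun y p => F (hd p) y), H.
Qed.

Lemma beta3 a b c s (F : D a -> D b -> D c -> D s) x y z :
  Def [c; b; a] (fun p => F (hd (tl (tl p))) (hd (tl p)) (hd p)) ->
  lam (fun x => lam (fun y => lam (fun z => F x y z))) ⋅ x ⋅ y ⋅ z = F x y z.
Proof.
  intros H; rewrite (beta2 (F := fun x y => lam (fun z => F x y z))).
  - apply beta; destruct H as [g Hg]; exists (g ⋅ x ⋅ y); intros p.
    exact (Hg (hd p, (y, (x, tt)))).
  - apply Def_lam with (B := fun z p => F (hd (tl p)) (hd p) z), H.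
Qed.

(** * Numbers and truth values *)

Lemma Def_add E (F G : pts M E -> N) : Def E F -> Def E G -> Def E (fun p => F p + G p).
Proof. intros; unfold addN; repeat apply Def_app; auto using Def_const. Qed.

Lemma Def_mul E (F G : pts M E -> N) : Def E F -> Def E G -> Def E (fun p => F p * G p).
Proof. intros; unfold mulN; repeat apply Def_app; auto using Def_const. Qed.

Lemma N_semi_ring : semi_ring_theory (R := N) 0 1 (@addN M) (@mulN M) eq.
Proof.
  split; intros.
  - rewrite am_addC; apply am_add0.
  - apply am_addC.
  - symmetry; apply am_addA.
  - rewrite am_mulC; apply am_mul1.
  - rewrite am_mulC; apply am_mul0.
  - apply am_mulC.
  - symmetry; apply am_mulA.
  - rewrite am_mulC, am_distr, !(am_mulC p); reflexivity.
Qed.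
Add Ring N_ring : N_semi_ring.

Definition prim (f : N -> N -> N) (m n : N) : N :=
  recM M ⋅ lam (fun k => lam (fun x => f k x)) ⋅ m ⋅ n.

Lemma prim_0 f m : prim f m 0 = m.
Proof. apply am_rec0. Qed.

Lemma prim_S f m n : Def [tN; tN] (fun p => f (hd (tl p)) (hd p)) ->
  prim f m (n + 1) = f n (prim f m n).
Proof.
  intros H; unfold prim; rewrite am_recS, (beta (F := fun k => lam (fun x => f k x))).
  - apply beta; destruct H as [g Hg]; exists (g ⋅ n); intros p; exact (Hg (hd p, (n, tt))).
  - apply Def_lam with (B := fun x p => f (hd p) x), H.
Qed.

Lemma Def_prim E (f : N -> N -> pts M E -> N) F G :
  Def (tN :: tN :: E) (fun p => f (hd (tl p)) (hd p) (tl (tl p))) ->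
  Def E F -> Def E G ->
  Def E (fun p => prim (fun k x => f k x p) (F p) (G p)).
Proof.
  intros Hf HF HG; unfold prim; repeat apply Def_app; auto using Def_const.
  apply Def_lam with (B := fun k p => lam (fun x => f k x p)).
  apply Def_lam with (B := fun x p => f (hd p) x (tl p)); exact Hf.
Qed.

(* [def] proves definability by recursion on the body of the function. The four hooks
   receive the operations and predicates defined later. *)
Ltac def_logic := fail.
Ltac def_search := fail.
Ltac def_number := fail.
Ltac def_series := fail.
Ltac def_step :=
  cbv beta;
  first
  [ assumption
  | match goal with
    | |- definable (fun p => ?c) => apply Def_const
    | |- definable (@hd _ _ _) => apply Def_hd
    | |- definable (fun p => hd _) =>
      first [ apply Def_hd | apply Def_v1 | apply Def_v2 | apply Def_v3 | apply Def_v4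
            | apply Def_v5 | apply Def_v6 ]
    | |- definable (fun p => app _ _) => apply Def_app
    | |- definable (fun p => _ + _) => apply Def_add
    | |- definable (fun p => _ * _) => apply Def_mul
    | |- definable (fun p => lam _) => apply Def_lam
    | |- definable (fun p => prim _ _ _) => apply Def_prim
    end
  | def_logic | def_search | def_number | def_series ].
Ltac def := repeat def_step.

(** The induction available before equality of numbers is known to have a characteristic
    function; the disjunction is needed for [zero_or_succ] and [dichotomy]. *)
Lemma ind_eq (F G H K : N -> N) :
  Def [tN] (fun p => F (hd p)) -> Def [tN] (fun p => G (hd p)) ->
  Def [tN] (fun p => H (hd p)) -> Def [tN] (fun p => K (hd p)) ->
  F 0 = G 0 \/ H 0 = K 0 ->
  (forall n, F n = G n \/ H n = K n -> F (n + 1) = G (n + 1) \/ H (n + 1) = K (n + 1)) ->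
  forall n, F n = G n \/ H n = K n.
Proof.
  intros DF DG DH DK H0 H1 n.
  pose proof (@am_ind M _ (lam F) (lam G) (lam H) (lam K)) as I.
  rewrite <- (beta n DF), <- (beta n DG), <- (beta n DH), <- (beta n DK).
  apply I; [|intros m]; rewrite !beta by assumption; auto.
Qed.

Lemma ind_eq1 (F G : N -> N) :
  Def [tN] (fun p => F (hd p)) -> Def [tN] (fun p => G (hd p)) ->
  F 0 = G 0 -> (forall n, F n = G n -> F (n + 1) = G (n + 1)) -> forall n, F n = G n.
Proof.
  intros DF DG H0 H1 n.
  destruct (ind_eq DF DG DF DG) with (n := n) as [E|E]; auto.
  intros m [E|E]; auto.
Qed.

Definition pred (n : N) : N := prim (fun k _ => k) 0 n.
Definition monus (n m : N) : N := prim (fun _ x => pred x) n m.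

Lemma Def_pred : DefOp1 pred.
Proof. intros; unfold pred; def. Qed.

Lemma Def_monus : DefOp2 monus.
Proof. intros; unfold monus, pred; def. Qed.

Lemma pred_0 : pred 0 = 0.
Proof. apply prim_0. Qed.

Lemma pred_S n : pred (n + 1) = n.
Proof. unfold pred; rewrite prim_S by def; reflexivity. Qed.

Lemma monus_0 n : monus n 0 = n.
Proof. apply prim_0. Qed.

Lemma monus_S n m : monus n (m + 1) = pred (monus n m).
Proof. apply (prim_S (f := fun _ x => pred x)); unfold pred; def. Qed.

Ltac def_logic ::= first [apply Def_pred | apply Def_monus].

Lemma zero_or_succ (n : N) : n = 0 \/ exists m, n = m + 1.
Proof.
  destruct (@ind_eq (fun n => n) (fun _ => 0) (fun n => n) (fun n => pred n + 1))
    with (n := n) as [E|E]; try solve [def]; eauto.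
  intros m _; right; rewrite pred_S; reflexivity.
Qed.

Lemma monus_SS n m : monus (n + 1) (m + 1) = monus n m.
Proof.
  revert m; apply ind_eq1; try solve [def].
  - rewrite monus_S, !monus_0; apply pred_S.
  - intros m E; rewrite monus_S, E, monus_S; reflexivity.
Qed.

Lemma monus_add k n : monus (k + n) n = k.
Proof.
  revert n; apply (@ind_eq1 (fun n => monus (k + n) n) (fun _ => k)); try solve [def].
  - cbv beta; rewrite monus_0; ring.
  - cbv beta; intros n E; replace (k + (n + 1)) with ((k + n) + 1) by ring.
    rewrite monus_SS; exact E.
Qed.

Lemma monus_le n k : monus n (n + k) = 0.
Proof.
  revert k; apply (@ind_eq1 (fun k => monus n (n + k)) (fun _ => 0)); try solve [def].
  - cbv beta; pose proof (monus_add 0 n) as E; replace (0 + n) with n in E by ring.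
    rewrite am_add0; exact E.
  - cbv beta; intros k E; replace (n + (k + 1)) with ((n + k) + 1) by ring.
    rewrite monus_S, E; apply pred_0.
Qed.

(** Induction on [m] with the two candidates for [k] given by subtraction, which makes
    the statement a disjunction of two equations. *)
Lemma dichotomy (n m : N) : exists k, m = n + k \/ n = m + k.
Proof.
  destruct (@ind_eq (fun m => m) (fun m => n + monus m n) (fun _ => n)
    (fun m => m + monus n m)) with (n := m) as [E|E]; try solve [def]; eauto.
  - right; rewrite monus_0; ring.
  - intros k [E|E]; [left|].
    + revert E; generalize (monus k n); intros j ->.
      replace (n + j + 1) with (j + 1 + n) by ring; rewrite monus_add; ring.
    + destruct (zero_or_succ (monus n k)) as [Z|[j Z]]; rewrite Z in E; [left|right].
      * rewrite am_add0 in E; rewrite E; replace (k + 1) with (1 + k) by ring.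
        rewrite monus_add; ring.
      * rewrite monus_S, Z, pred_S, E; ring.
Qed.

Lemma lt_succ_diag (n : N) : n < n + 1.
Proof.
  replace n with (0 + n) at 1 by ring; replace (n + 1) with (1 + n) by ring.
  apply am_lt_add, am_lt01.
Qed.

Lemma lt_0_succ (n : N) : 0 < n + 1.
Proof.
  pose proof (@am_ind_lt M _ (lam (fun _ => 0)) (lam (fun n => n + 1))) as I.
  assert (B : forall n, lam (fun _ : N => zeroM M) ⋅ n = 0) 
    by (intros; apply (beta (F := fun _ : N => zeroM M)); def).
  assert (C : forall n, lam (fun n : N => n + 1) ⋅ n = n + 1).
  { intros k; apply (beta (F := fun n : N => n + 1)); def. }
  rewrite <- (B n), <- (C n); apply I; clear I.
  - rewrite B, C; apply lt_succ_diag.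
  - intros k L; rewrite B, C in *; exact (am_lt_trans L (lt_succ_diag _)).
Qed.

(** The order of the axioms is reduced to addition, by which its definability and its
    discreteness follow. *)
Lemma lt_exists (n m : N) : n < m <-> exists k, m = n + k + 1.
Proof.
  split.
  - intros L; destruct (dichotomy n m) as [k [E|E]], (zero_or_succ k) as [->|[j ->]].
    + rewrite E in L; replace (n + 0) with n in L by ring; destruct (am_lt_irrefl L).
    + exists j; rewrite E; ring.
    + rewrite E in L; replace (m + 0) with m in L by ring; destruct (am_lt_irrefl L).
    + destruct (@am_lt_irrefl M _ m); refine (am_lt_trans _ L); rewrite E.
      replace m with (0 + m) at 1 by ring; replace (m + (j + 1)) with (j + 1 + m) by ring.
      apply am_lt_add, lt_0_succ.
  - intros [k ->]; replace n with (0 + n) at 1 by ring.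
    replace (n + k + 1) with (k + 1 + n) by ring; apply am_lt_add, lt_0_succ.
Qed.

Definition le (n m : N) : Prop := exists k, m = n + k.

Lemma add_cancel (a b c : N) : a + c = b + c -> a = b.
Proof. intros E; rewrite <- (monus_add a c), E; apply monus_add. Qed.

Lemma add_eq_0 (a b : N) : a + b = 0 -> a = 0.
Proof.
  destruct (zero_or_succ a) as [->|[j ->]]; [reflexivity|]; intros E.
  destruct (@am_lt_irrefl M _ 0); rewrite <- E at 2.
  replace (j + 1 + b) with (j + b + 1) by ring; apply lt_0_succ.
Qed.

Definition ch (P : Prop) : N := if excluded_middle_informative P then 1 else 0.

Lemma one_ne_0 : oneM M <> 0.
Proof. intros E; apply (@am_lt_irrefl M _ 0); rewrite <- E at 2; apply am_lt01. Qed.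

Lemma ch_true P : P -> ch P = 1.
Proof. unfold ch; destruct excluded_middle_informative; tauto. Qed.

Lemma ch_false P : ~ P -> ch P = 0.
Proof. unfold ch; destruct excluded_middle_informative; tauto. Qed.

Lemma ch_1 P : ch P = 1 <-> P.
Proof.
  unfold ch; destruct excluded_middle_informative; split; intros; auto; try tauto.
  destruct one_ne_0; auto.
Qed.

Lemma ch_0 P : ch P = 0 <-> ~ P.
Proof.
  unfold ch; destruct excluded_middle_informative; split; intros; auto; try tauto.
  destruct one_ne_0; auto.
Qed.

Lemma ch_iff P Q : (P <-> Q) -> ch P = ch Q.
Proof.
  intros H; unfold ch; do 2 destruct excluded_middle_informative; tauto.
Qed.

Lemma Def_zero_test E F : Def E F -> Def E (fun p => ch (F p = 0)).
Proof.
  intros HF; apply Def_ext with (G := fun p => prim (fun _ _ => 0) 1 (F p)); [|def].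
  intros p; destruct (zero_or_succ (F p)) as [->|[m ->]].
  - rewrite prim_0; apply ch_true; reflexivity.
  - rewrite prim_S by def; apply ch_false; intros H.
    apply one_ne_0, (@add_eq_0 1 m); rewrite <- H; ring.
Qed.

(** Two numbers are equal if and only if both truncated differences are zero. *)
Lemma Def_eq E (F G : pts M E -> N) : Def E F -> Def E G -> Def E (fun p => ch (F p = G p)).
Proof.
  intros HF HG.
  apply Def_ext with (G := fun p => ch (monus (F p) (G p) + monus (G p) (F p) = 0));
    [|apply (Def_zero_test (F := fun p => monus (F p) (G p) + monus (G p) (F p))); def].
  intros p; apply ch_iff; split.
  - intros ->; replace (G p) with (0 + G p) at 1 3 by ring; rewrite monus_add.
    ring.
  - generalize (F p) as n, (G p) as m; intros n m.
    destruct (dichotomy n m) as [k [->| ->]]; rewrite monus_le.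
    + replace (n + k) with (k + n) by ring; rewrite monus_add; intros e.
      replace k with (0 + k) by ring; rewrite e; ring.
    + replace (m + k) with (k + m) by ring; rewrite monus_add; intros e.
      replace k with (k + 0) by ring; rewrite e; ring.
Qed.

Lemma Def_not E (P : pts M E -> Prop) :
  Def E (fun p => ch (P p)) -> Def E (fun p => ch (~ P p)).
Proof.
  intros H; apply Def_ext with (G := fun p => ch (ch (P p) = 0)).
  - intros p; apply ch_iff; symmetry; apply ch_0.
  - apply Def_zero_test, H.
Qed.

Lemma Def_and E (P Q : pts M E -> Prop) : Def E (fun p => ch (P p)) ->
  Def E (fun p => ch (Q p)) -> Def E (fun p => ch (P p /\ Q p)).
Proof.
  intros H K; apply Def_ext with (G := fun p => ch (P p) * ch (Q p)); [|def].
  intros p; unfold ch; do 3 destruct excluded_middle_informative; try tauto; ring.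
Qed.

Lemma Def_or E (P Q : pts M E -> Prop) : Def E (fun p => ch (P p)) ->
  Def E (fun p => ch (Q p)) -> Def E (fun p => ch (P p \/ Q p)).
Proof.
  intros H K; apply Def_ext with (G := fun p => ch (~ (~ P p /\ ~ Q p))).
  - intros p; apply ch_iff; tauto.
  - apply (Def_not (P := fun p => ~ P p /\ ~ Q p)).
    apply (Def_and (P := fun p => ~ P p)); apply Def_not; assumption.
Qed.

Lemma Def_imp E (P Q : pts M E -> Prop) : Def E (fun p => ch (P p)) ->
  Def E (fun p => ch (Q p)) -> Def E (fun p => ch (P p -> Q p)).
Proof.
  intros H K; apply Def_ext with (G := fun p => ch (~ P p \/ Q p)).
  - intros p; apply ch_iff; tauto.
  - apply (Def_or (P := fun p => ~ P p)); [apply Def_not|]; assumption.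
Qed.

Definition mu : D t2 := proj1_sig (constructive_indefinite_description _ am_mu).

Lemma mu_spec (f : D t1) : (exists n, f ⋅ n = 0) ->
  f ⋅ (mu ⋅ f) = 0 /\ forall i, i < mu ⋅ f -> f ⋅ i <> 0.
Proof. unfold mu; destruct constructive_indefinite_description as [m H]; apply H. Qed.

Lemma Def_ch_snd E (P : N -> pts M E -> Prop) :
  Def (tN :: E) (fun p => ch (P (hd p) (tl p))) ->
  forall p, Def [tN] (fun q => ch (P (hd q) p)).
Proof.
  intros [f Hf] p; exists (apps (E := E) (s := tN ~> tN) f p).
  intros q; exact (Hf (hd q, p)).
Qed.

(** The search operator turns quantification over numbers into a term, so that the
    definable predicates are closed under it. *)
Lemma Def_all E (P : N -> pts M E -> Prop) :
  Def (tN :: E) (fun p => ch (P (hd p) (tl p))) ->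
  Def E (fun p => ch (forall n, P n p)).
Proof.
  intros H.
  apply Def_ext with (G := fun p => (fun f => f ⋅ (mu ⋅ f)) (lam (fun n => ch (P n p)))).
  - intros p; set (f := lam (fun n => ch (P n p))).
    assert (B : forall n, f ⋅ n = ch (P n p)).
    { intros n; apply (beta (F := fun n => ch (P n p))), (Def_ch_snd H). }
    rewrite B; unfold ch at 1; destruct excluded_middle_informative as [A|A].
    + symmetry; apply ch_true, A.
    + apply not_all_ex_not in A; destruct A as [n A].
      destruct (@mu_spec f) as [K _]; [exists n; rewrite B; apply ch_false, A|].
      rewrite B in K; symmetry; exact K.
  - cbv beta; repeat apply Def_app; try apply Def_const; apply Def_lam; assumption.
Qed.

Lemma Def_ex E (P : N -> pts M E -> Prop) :
  Def (tN :: E) (fun p => ch (P (hd p) (tl p))) ->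
  Def E (fun p => ch (exists n, P n p)).
Proof.
  intros H; apply Def_ext with (G := fun p => ch (~ forall n, ~ P n p)).
  - intros p; apply ch_iff; split; [firstorder|]; intros K; apply NNPP; firstorder.
  - apply Def_not, Def_all.
    apply (Def_not (P := fun p => P (hd p) (tl p))); assumption.
Qed.

Lemma Def_lt E F G : Def E F -> Def E G -> Def E (fun p => ch (F p < G p)).
Proof.
  intros HF HG; apply Def_ext with (G := fun p => ch (exists k, G p = F p + k + 1)).
  - intros p; apply ch_iff, lt_exists.
  - apply Def_ex, (Def_eq (F := fun p => G (tl p)) (G := fun p => F (tl p) + hd p + 1));
      repeat apply Def_add; try apply Def_const; try apply Def_hd; apply Def_tl;
      assumption.
Qed.

Lemma Def_le E F G : Def E F -> Def E G -> Def E (fun p => ch (le (F p) (G p))).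
Proof.
  intros HF HG; unfold le.
  apply Def_ex, (Def_eq (F := fun p => G (tl p)) (G := fun p => F (tl p) + hd p));
    repeat apply Def_add; try apply Def_const; try apply Def_hd; apply Def_tl;
    assumption.
Qed.

Lemma Def_eq1 E (F G : pts M E -> D t1) :
  Def E F -> Def E G -> Def E (fun p => ch (F p = G p)).
Proof.
  intros HF HG; apply Def_ext with (G := fun p => ch (forall n, F p ⋅ n = G p ⋅ n)).
  - intros p; apply ch_iff; split; [intros ->; reflexivity|apply am_ext].
  - apply Def_all, (Def_eq (F := fun p => F (tl p) ⋅ hd p) (G := fun p => G (tl p) ⋅ hd p));
      repeat apply Def_app; try apply Def_hd; apply Def_tl; assumption.
Qed.

Ltac def_logic ::= lazymatch goal with
  | |- definable (fun p => pred _) => apply Def_pred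
  | |- definable (fun p => monus _ _) => apply Def_monus
  | |- definable (fun p => ch (_ /\ _)) => apply Def_and
  | |- definable (fun p => ch (_ \/ _)) => apply Def_or
  | |- definable (fun p => ch (~ _)) => apply Def_not
  | |- definable (fun p => ch (_ < _)) => apply Def_lt
  | |- definable (fun p => ch (le _ _)) => apply Def_le
  | |- definable (fun p => ch (@eq (dom _ tN) _ _)) => apply Def_eq
  | |- definable (fun p => ch (@eq _ _ _)) => apply Def_eq1
  | |- definable (fun p => ch (exists n, _)) => apply Def_ex
  | |- definable (fun p => ch (_ -> _)) => first [apply Def_imp | apply Def_all]
  | |- definable (fun p => ch (forall n, _)) => apply Def_all
  end.

(** * Search and definition by cases *)

Lemma Def_comp E a s (F : D a -> D s) (G : pts M E -> D a) :
  Def [a] (fun p => F (hd p)) -> Def E G -> Def E (fun p => F (G p)).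
Proof.
  intros [f Hf] HG; apply Def_ext with (G := fun p => f ⋅ G p); [|def].
  intros p; symmetry; exact (Hf (G p, tt)).
Qed.

Lemma Def_comp2 E a b s (F : D a -> D b -> D s) (G : pts M E -> D a) (H : pts M E -> D b) :
  Def [b; a] (fun p => F (hd (tl p)) (hd p)) -> Def E G -> Def E H ->
  Def E (fun p => F (G p) (H p)).
Proof.
  intros [f Hf] HG HH; apply Def_ext with (G := fun p => f ⋅ G p ⋅ H p); [|def].
  intros p; symmetry; exact (Hf (H p, (G p, tt))).
Qed.

Lemma Def_comp3 E a b c s (F : D a -> D b -> D c -> D s)
    (G : pts M E -> D a) (H : pts M E -> D b) (K : pts M E -> D c) :
  Def [c; b; a] (fun p => F (hd (tl (tl p))) (hd (tl p)) (hd p)) ->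
  Def E G -> Def E H -> Def E K -> Def E (fun p => F (G p) (H p) (K p)).
Proof.
  intros [f Hf] HG HH HK; apply Def_ext with (G := fun p => f ⋅ G p ⋅ H p ⋅ K p); [|def].
  intros p; symmetry; exact (Hf (K p, (H p, (G p, tt)))).
Qed.

Lemma ind (P : N -> Prop) : Def [tN] (fun p => ch (P (hd p))) ->
  P 0 -> (forall n, P n -> P (n + 1)) -> forall n, P n.
Proof.
  intros DP H0 H1 n; apply (ch_1).
  revert n; apply (@ind_eq1 (fun n => ch (P n)) (fun _ => 1)); [exact DP|def| |].
  - apply ch_1, H0.
  - intros n H; apply ch_1, H1, (ch_1), H.
Qed.

Lemma lt_succ_r (m n : N) : m < n + 1 <-> m < n \/ m = n.
Proof.
  rewrite !lt_exists; split.
  - intros [k E]; apply add_cancel in E.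
    destruct (zero_or_succ k) as [->|[j ->]].
    + right; rewrite E; ring.
    + left; exists j; rewrite E; ring.
  - intros [[k ->]| ->].
    + exists (k + 1); ring.
    + exists 0; ring.
Qed.

Lemma not_lt_0 (n : N) : ~ n < 0.
Proof.
  rewrite lt_exists; intros [k E]; apply (one_ne_0).
  apply (@add_eq_0 1 (n + k)); rewrite E; ring.
Qed.

Lemma strong_ind (P : N -> Prop) : Def [tN] (fun p => ch (P (hd p))) ->
  (forall n, (forall m, m < n -> P m) -> P n) -> forall n, P n.
Proof.
  intros DP H n.
  assert (K : forall n m, m < n -> P m).
  { apply (ind (P := fun n => forall m, m < n -> P m)).
    - apply Def_all, Def_imp; [def|].
      apply (Def_comp (F := fun n => ch (P n))); def.
    - intros m L; destruct (not_lt_0 L).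
    - intros k IH m L; apply lt_succ_r in L; destruct L as [L| ->]; auto. }
  apply H, K.
Qed.

Definition least (P : N -> Prop) : N := mu ⋅ lam (fun n => ch (~ P n)).

Lemma least_spec (P : N -> Prop) : Def [tN] (fun p => ch (P (hd p))) ->
  (exists n, P n) -> P (least P) /\ forall m, m < least P -> ~ P m.
Proof.
  intros DP [n Hn]; unfold least.
  assert (B : forall n, lam (fun n => ch (~ P n)) ⋅ n = ch (~ P n)).
  { intros k; apply (beta (F := fun n => ch (~ P n))), Def_not, DP. }
  destruct (mu_spec (f := lam (fun n => ch (~ P n)))) as [H K].
  - exists n; rewrite B; apply ch_0; tauto.
  - split; [apply NNPP; rewrite B in H; apply ch_0, H|].
    intros m L Pm; apply (K m L); rewrite B; apply ch_0; tauto.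
Qed.

Lemma Def_least E (P : N -> pts M E -> Prop) :
  Def (tN :: E) (fun p => ch (P (hd p) (tl p))) ->
  Def E (fun p => least (fun n => P n p)).
Proof.
  intros H; unfold least; apply Def_app; [def|].
  apply Def_lam, (Def_not (P := fun p => P (hd p) (tl p))), H.
Qed.

Definition cond s (P : Prop) (a b : D s) : D s :=
  if excluded_middle_informative P then a else b.

Lemma cond_true s P (a b : D s) : P -> cond P a b = a.
Proof. unfold cond; destruct excluded_middle_informative; tauto. Qed.

Lemma cond_false s P (a b : D s) : ~ P -> cond P a b = b.
Proof. unfold cond; destruct excluded_middle_informative; tauto. Qed.

(** At higher types the case distinction is pushed to the arguments. *)
Lemma Def_cond s : forall E (P : pts M E -> Prop) (F G : pts M E -> D s),
  Def E (fun p => ch (P p)) -> Def E F -> Def E G ->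
  Def E (fun p => cond (P p) (F p) (G p)).
Proof.
  induction s as [|r IHr s IHs]; intros E P F G HP HF HG.
  - apply Def_ext with (G := fun p => ch (P p) * F p + ch (~ P p) * G p).
    + intros p; unfold cond; destruct excluded_middle_informative.
      * rewrite (ch_true (P := P p)), ch_false by tauto; ring.
      * rewrite (ch_false (P := P p)), ch_true by tauto; ring.
    + apply Def_add; apply Def_mul; try assumption; apply Def_not, HP.
  - apply Def_ext with (G := fun p => lam (fun x => cond (P p) (F p ⋅ x) (G p ⋅ x))).
    + intros p; symmetry; apply lam_of; intros x; unfold cond.
      destruct excluded_middle_informative; reflexivity.
    + apply Def_lam, (IHs _ (fun p => P (tl p)) (fun p => F (tl p) ⋅ hd p)
        (fun p => G (tl p) ⋅ hd p)).
      * exact (@Def_tl E r _ (fun p => ch (P p)) HP).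
      * apply Def_app; [apply Def_tl, HF|apply Def_hd].
      * apply Def_app; [apply Def_tl, HG|apply Def_hd].
Qed.

Definition dvd (d n : N) : Prop := exists c, n = d * c.

Lemma Def_dvd E (F G : pts M E -> N) :
  Def E F -> Def E G -> Def E (fun p => ch (dvd (F p) (G p))).
Proof.
  intros HF HG; unfold dvd; apply Def_ex, (Def_eq (F := fun p => G (tl p))
    (G := fun p => F (tl p) * hd p)); [|apply Def_mul; [|apply Def_hd]]; apply Def_tl;
    assumption.
Qed.

Definition prime (p : N) : Prop :=
  p <> 0 /\ p <> 1 /\ forall a b, p = a * b -> a = 1 \/ b = 1.

Lemma Def_prime E (F : pts M E -> N) : Def E F -> Def E (fun p => ch (prime (F p))).
Proof.
  intros HF; apply (Def_comp (F := fun n => ch (prime n))); [|exact HF].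
  unfold prime; def.
Qed.

(* The first two entries are for definable functions that are variables. *)
Ltac def_search ::= match goal with
  | H : @definable _ [_] _ (fun p => ?F (hd p)) |- definable (fun p => ?F _) =>
      apply (Def_comp (F := F)); [exact H|]
  | H : @definable _ [_; _] _ (fun p => ?F (hd (tl p)) (hd p))
      |- definable (fun p => ?F _ _) => apply (Def_comp2 (F := F)); [exact H| |]
  | |- definable (fun p => least _) => apply Def_least
  | |- definable (fun p => cond _ _ _) => apply Def_cond
  | |- definable (fun p => ch (dvd _ _)) => apply Def_dvd
  | |- definable (fun p => ch (prime _)) => apply Def_prime
  end.

(** * Divisibility and primes *)

Lemma add_cancel_l (a b c : N) : c + a = c + b -> a = b.
Proof. rewrite !(am_addC c); apply add_cancel. Qed.

Lemma lt_irrefl (a : N) : ~ a < a.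
Proof. apply am_lt_irrefl. Qed.

Lemma lt_trans (a b c : N) : a < b -> b < c -> a < c.
Proof. apply am_lt_trans. Qed.

Lemma le_refl (a : N) : le a a.
Proof. exists 0; ring. Qed.

Lemma le_iff (a b : N) : le a b <-> a < b \/ a = b.
Proof.
  rewrite <- lt_succ_r, lt_exists; split; intros [k E]; exists k.
  - rewrite E; reflexivity.
  - apply add_cancel in E; exact E.
Qed.

Lemma lt_le (a b : N) : a < b -> le a b.
Proof. intros L; apply le_iff; auto. Qed.

Lemma lt_succ_le (a b : N) : a < b + 1 <-> le a b.
Proof. rewrite le_iff; apply lt_succ_r. Qed.

Lemma lt_le_trans (a b c : N) : a < b -> le b c -> a < c.
Proof. rewrite le_iff; intros L [K|<-]; auto; apply (lt_trans L K). Qed.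

Lemma not_lt (a b : N) : ~ a < b <-> le b a.
Proof.
  rewrite le_iff; split.
  - intros H; destruct (am_lt_total a b) as [L|[E|L]]; auto; tauto.
  - intros [L| ->] K; [exact (lt_irrefl (lt_trans L K))|exact (lt_irrefl K)].
Qed.

Lemma le_antisym (a b : N) : le a b -> le b a -> a = b.
Proof. rewrite le_iff; intros [L|E] K; auto; destruct (proj2 (not_lt _ _) K L). Qed.

Lemma ne_0 (n : N) : n <> 0 <-> exists m, n = m + 1.
Proof.
  split; [destruct (zero_or_succ n); tauto|].
  intros [m ->] E; apply (one_ne_0), (@add_eq_0 1 m); rewrite <- E; ring.
Qed.

Lemma mul_cancel (a b c : N) : c <> 0 -> a * c = b * c -> a = b.
Proof.
  intros Hc E; assert (P : 0 < c) by (apply ne_0 in Hc; destruct Hc as [m ->]; apply lt_0_succ).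
  destruct (am_lt_total a b) as [L|[e|L]]; auto; exfalso;
    apply (am_lt_mul P) in L; rewrite E in L; exact (lt_irrefl L).
Qed.

Lemma mul_eq_0 (a b : N) : a * b = 0 -> a = 0 \/ b = 0.
Proof.
  intros E; destruct (classic (b = 0)); [tauto|left].
  apply mul_cancel with b; [assumption|]; rewrite E; ring.
Qed.

Lemma mul_eq_1 (a b : N) : a * b = 1 -> a = 1.
Proof.
  intros E; destruct (zero_or_succ a) as [->|[m ->]], (zero_or_succ b) as [->|[k ->]].
  1-3: exfalso; apply (one_ne_0); rewrite <- E at 1; ring.
  assert (H : m + (k + m * k) = 0).
  { apply add_cancel with 1; transitivity ((m + 1) * (k + 1)); [|rewrite E]; ring. }
  apply add_eq_0 in H; rewrite H; ring.
Qed.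

Lemma le_mul (a b : N) : b <> 0 -> le a (a * b).
Proof. intros H; apply ne_0 in H; destruct H as [k ->]; exists (a * k); ring. Qed.

Lemma dvd_refl (a : N) : dvd a a.
Proof. exists 1; ring. Qed.

Lemma dvd_trans (a b c : N) : dvd a b -> dvd b c -> dvd a c.
Proof. intros [k ->] [j ->]; exists (k * j); ring. Qed.

Lemma dvd_mul_r (a b : N) : dvd a (a * b).
Proof. exists b; reflexivity. Qed.

Lemma dvd_mul_l (a b : N) : dvd a (b * a).
Proof. exists b; ring. Qed.

Lemma dvd_le (a b : N) : b <> 0 -> dvd a b -> le a b.
Proof.
  intros H [c ->]; apply le_mul; intros ->; apply H; ring.
Qed.

Lemma dvd_1 (a : N) : dvd a 1 -> a = 1.
Proof. intros [c E]; exact (mul_eq_1 (eq_sym E)). Qed.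

Lemma dvd_sub (d a b : N) : dvd d a -> dvd d (a + b) -> dvd d b.
Proof.
  intros [x ->] [y E]; destruct (dichotomy x y) as [k [->| ->]].
  - exists k; apply add_cancel_l with (d * x); rewrite E; ring.
  - exists 0; assert (Z : b + d * k = 0).
    { apply add_cancel_l with (d * y).
      transitivity (d * (y + k) + b); [ring|]; rewrite E; ring. }
    apply add_eq_0 in Z; rewrite Z; ring.
Qed.

Lemma division (b : N) : b <> 0 -> forall a, exists q r, a = q * b + r /\ r < b.
Proof.
  intros Hb; apply (ind (P := fun a => exists q r, a = q * b + r /\ r < b)); [def| |].
  - exists 0, 0; split; [ring|]; apply ne_0 in Hb; destruct Hb as [m ->]; apply lt_0_succ.
  - intros a [q [r [-> L]]].
    destruct (classic (r + 1 = b)) as [E|E].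
    + exists (q + 1), 0; split; [rewrite <- E; ring|].
      apply ne_0 in Hb; destruct Hb as [m ->]; apply lt_0_succ.
    + exists q, (r + 1); split; [ring|].
      apply lt_exists in L; destruct L as [k ->].
      destruct (zero_or_succ k) as [->|[j ->]]; [destruct E; ring|].
      apply lt_exists; exists j; ring.
Qed.

(** The least positive [d] with [p] dividing [d * b] divides every number with that
    property, in particular [p] and [a]. *)
Lemma euclid (p a b : N) : prime p -> dvd p (a * b) -> dvd p a \/ dvd p b.
Proof.
  intros [p0 [p1 pp]] H; apply NNPP; intros n; apply not_or_and in n; destruct n as [na nb].
  set (P := fun x => x <> 0 /\ dvd p (x * b)).
  destruct (least_spec (P := P)) as [[d0 dP] dmin]; [unfold P; def| |].
  { exists p; split; [exact p0|apply dvd_mul_r]. }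
  set (d := least P) in *.
  assert (K : forall x, dvd p (x * b) -> dvd d x).
  { intros x Hx; destruct (division d0 x) as [q [r [E L]]].
    destruct (classic (r = 0)) as [Z|Z].
    - exists q; rewrite E, Z; ring.
    - destruct (dmin r L); split; [exact Z|].
      apply dvd_sub with (q * (d * b)).
      + apply (dvd_trans dP), dvd_mul_l.
      + replace (q * (d * b) + r * b) with (x * b) by (rewrite E; ring); exact Hx. }
  destruct (K p (dvd_mul_r _ _)) as [c E]; destruct (pp _ _ E) as [E1|E1].
  - apply nb; rewrite E1 in dP; replace (1 * b) with b in dP by ring; exact dP.
  - apply na; replace p with d; [apply K, H|]; rewrite E, E1; ring.
Qed.

Definition lpf (n : N) : N := least (fun d => d <> 1 /\ dvd d n).

Lemma Def_lpf : DefOp1 lpf.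
Proof. intros E F H; apply (Def_comp (F := fun n => lpf n)); [unfold lpf; def|exact H]. Qed.

Lemma lpf_spec (n : N) : n <> 1 -> lpf n <> 1 /\ dvd (lpf n) n /\
  forall d, d <> 1 -> dvd d n -> le (lpf n) d.
Proof.
  intros n1; destruct (least_spec (P := fun d => d <> 1 /\ dvd d n)) as [[H K] L]; [def| |].
  - exists n; split; [exact n1|apply dvd_refl].
  - repeat split; auto; intros d d1 Hd; apply not_lt; intros l; apply (L d l); auto.
Qed.

Lemma lpf_prime (n : N) : n <> 0 -> n <> 1 -> prime (lpf n).
Proof.
  intros n0 n1; destruct (lpf_spec n1) as [H [K L]].
  assert (Z : lpf n <> 0).
  { intros E; destruct K as [c K]; apply n0; rewrite K, E; ring. }
  repeat split; auto; intros a b E.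
  destruct (classic (a = 1)) as [|a1]; [tauto|right].
  assert (l : le (lpf n) a).
  { apply L; [exact a1|]; apply dvd_trans with (lpf n); [exists b; exact E|exact K]. }
  assert (a0 : a <> 0) by (intros e; apply Z; rewrite E, e; ring).
  apply mul_cancel with a; [exact a0|]; transitivity (lpf n).
  - rewrite E; ring.
  - apply le_antisym.
    + replace (1 * a) with a by ring; exact l.
    + rewrite E; replace (1 * a) with a by ring; apply le_mul.
      intros e; apply Z; rewrite E, e; ring.
Qed.

Lemma prime_dvd_prime (p q : N) : prime p -> prime q -> dvd p q -> p = q.
Proof.
  intros [_ [p1 _]] [_ [_ H]] [c E]; destruct (H _ _ E) as [e|e]; [tauto|].
  rewrite E, e; ring.
Qed.

Lemma lpf_of_prime (p : N) : prime p -> lpf p = p.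
Proof.
  intros H; pose proof H as [p0 [p1 _]]; apply prime_dvd_prime; auto.
  - apply lpf_prime; auto.
  - apply lpf_spec; auto.
Qed.

(** Some positive number is divisible by all of [1, ..., n], and the least prime factor of
    its successor exceeds [n]. *)
Lemma prime_above (n : N) : exists p, n < p /\ prime p.
Proof.
  assert (H : exists m, m <> 0 /\ forall k, k <> 0 -> k < n + 1 -> dvd k m).
  { revert n; apply (ind (P := fun n => exists m, m <> 0 /\
      forall k, k <> 0 -> k < n + 1 -> dvd k m)); [def| |].
    - exists 1; split; [apply one_ne_0|]; intros k k0 L; apply lt_succ_r in L.
      destruct L as [L|L]; [destruct (not_lt_0 L)|tauto].
    - intros n [m [m0 H]]; exists (m * (n + 1)); split.
      + intros E; apply mul_eq_0 in E; destruct E as [E|E]; [tauto|].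
        revert E; apply ne_0; eauto.
      + intros k k0 L; apply lt_succ_r in L; destruct L as [L| ->].
        * apply dvd_trans with m; [auto|apply dvd_mul_r].
        * apply dvd_mul_l. }
  destruct H as [m [m0 H]]; exists (lpf (m + 1)).
  assert (m1 : m + 1 <> 1).
  { intros E; apply m0, add_cancel with 1; rewrite E; ring. }
  assert (P : prime (lpf (m + 1))) by (apply lpf_prime; [apply ne_0; eauto|exact m1]).
  split; [|exact P]; apply NNPP; intros L; apply not_lt, lt_succ_le in L.
  pose proof P as [p0 [p1 _]]; apply p1, dvd_1, dvd_sub with m.
  - apply H; auto.
  - apply lpf_spec, m1.
Qed.

(** An injection of the numbers into the primes. *)
Definition prm (n : N) : N :=
  prim (fun _ x => least (fun p => x < p /\ prime p)) (least (fun p => prime p)) n.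

Lemma Def_prm : DefOp1 prm.
Proof. intros E F H; unfold prm; def. Qed.

Lemma prm_S (n : N) : prm n < prm (n + 1) /\ prime (prm (n + 1)).
Proof.
  unfold prm at 2 3; rewrite prim_S by def; fold (prm n).
  apply (least_spec (P := fun p => prm n < p /\ prime p)); [def|apply prime_above].
Qed.

Lemma prm_prime (n : N) : prime (prm n).
Proof.
  destruct (zero_or_succ n) as [->|[m ->]]; [|apply prm_S].
  unfold prm; rewrite prim_0; apply (least_spec (P := fun p => prime p)); [def|].
  destruct (prime_above 0) as [p [_ H]]; eauto.
Qed.

Ltac def_number ::= lazymatch goal with
  | |- definable (fun p => lpf _) => apply Def_lpf
  | |- definable (fun p => prm _) => apply Def_prm
  end.

Lemma prm_mono (n k : N) : prm n < prm (n + k + 1).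
Proof.
  revert k; apply (ind (P := fun k => prm n < prm (n + k + 1))); [def| |].
  - replace (n + 0 + 1) with (n + 1) by ring; apply prm_S.
  - intros k L; apply (lt_trans L); replace (n + (k + 1) + 1) with ((n + k + 1) + 1) by ring.
    apply prm_S.
Qed.

Lemma prm_inj (n m : N) : prm n = prm m -> n = m.
Proof.
  intros E; destruct (am_lt_total n m) as [L|[e|L]]; auto; apply lt_exists in L;
    destruct L as [k ->]; pose proof (prm_mono) as K.
  - specialize (K n k); rewrite <- E in K; destruct (lt_irrefl K).
  - specialize (K m k); rewrite E in K; destruct (lt_irrefl K).
Qed.

(** * Completely multiplicative functions *)

Section Multiplicative.

Variables (op : N -> N -> N) (e : N).
Hypothesis Def_op : Def [tN; tN] (fun p => op (hd (tl p)) (hd p)).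
Hypothesis opA : forall x y z, op (op x y) z = op x (op y z).
Hypothesis opC : forall x y, op x y = op y x.
Hypothesis op_e : forall x, op x e = x.

Definition cofactor (n : N) : N := cond (n = 1) 1 (least (fun q => n = lpf n * q)).
(** Recursion has values of type [tN] only, so that course-of-values recursion along
    cofactors is replaced by iteration of [cofactor] followed by a product. *)
Definition strip (n k : N) : N := prim (fun _ x => cofactor x) n k.
Definition factor (c : D t1) (n : N) : N := cond (n = 1) e (c ⋅ lpf n).
Definition partial (c : D t1) (n k : N) : N :=
  prim (fun i x => op x (factor c (strip n i))) e k.
(** Product (for the operation [op]) of the values [c p] over the prime factors [p] of [n];
    the factors are the least prime factors of the successive cofactors of [n], and [n]
    steps suffice to reach the cofactor [1]. *)
Definition mext (c : D t1) (n : N) : N := partial c n n.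

Lemma Def_op' : DefOp2 op.
Proof. intros E F G; apply (Def_comp2 (F := op)), Def_op. Qed.

Lemma Def_cofactor : DefOp1 cofactor.
Proof. intros E F H; apply (Def_comp (F := cofactor)); [unfold cofactor; def|exact H]. Qed.

Lemma Def_strip : DefOp2 strip.
Proof.
  intros E F G HF HG; unfold strip; apply Def_prim; auto; apply Def_cofactor, Def_hd.
Qed.

Lemma Def_factor E (C : pts M E -> D t1) (F : pts M E -> N) :
  Def E C -> Def E F -> Def E (fun p => factor (C p) (F p)).
Proof. intros HC HF; unfold factor; def. Qed.

Lemma Def_partial E (C : pts M E -> D t1) (F G : pts M E -> N) :
  Def E C -> Def E F -> Def E G -> Def E (fun p => partial (C p) (F p) (G p)).
Proof.
  apply (Def_comp3 (F := partial)); unfold partial; apply Def_prim; [|def|def].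
  apply Def_op'; [apply Def_hd|apply Def_factor; [def|apply Def_strip; def]].
Qed.

Lemma Def_mext E (C : pts M E -> D t1) (F : pts M E -> N) :
  Def E C -> Def E F -> Def E (fun p => mext (C p) (F p)).
Proof. intros; apply Def_partial; auto. Qed.

Lemma cofactor_1 : cofactor 1 = 1.
Proof. unfold cofactor; apply cond_true; reflexivity. Qed.

Lemma cofactor_spec (n : N) : n <> 1 -> n = lpf n * cofactor n.
Proof.
  intros n1; unfold cofactor; rewrite cond_false by exact n1.
  apply (least_spec (P := fun q => n = lpf n * q)); [def|].
  apply lpf_spec, n1.
Qed.

Lemma cofactor_ne_0 (n : N) : n <> 0 -> cofactor n <> 0.
Proof.
  intros n0; destruct (classic (n = 1)) as [->|n1]; [rewrite cofactor_1; exact n0|].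
  intros E; apply n0; rewrite (cofactor_spec n1), E; ring.
Qed.

Lemma cofactor_lt (n : N) : n <> 0 -> n <> 1 -> cofactor n < n.
Proof.
  intros n0 n1; pose proof (lpf_prime n0 n1) as [p0 [p1 _]].
  apply ne_0 in p0; destruct p0 as [k Hk]; apply lt_exists.
  destruct (zero_or_succ k) as [->|[j ->]]; [destruct p1; rewrite Hk; ring|].
  pose proof (cofactor_ne_0 n0) as c0; apply ne_0 in c0; destruct c0 as [m Hm].
  exists (j * (m + 1) + m); rewrite (cofactor_spec n1) at 1; rewrite Hk, Hm; ring.
Qed.

Lemma strip_0 n : strip n 0 = n.
Proof. apply prim_0. Qed.

Lemma strip_S n k : strip n (k + 1) = cofactor (strip n k).
Proof. unfold strip; rewrite prim_S; [reflexivity|apply Def_cofactor, Def_hd]. Qed.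

Lemma strip_S' n k : strip n (k + 1) = strip (cofactor n) k.
Proof.
  revert k; apply ind_eq1.
  - apply Def_strip; def.
  - apply Def_strip; def.
  - rewrite strip_S, !strip_0; reflexivity.
  - intros k E; rewrite !(strip_S _ (k + 1)), E, strip_S; reflexivity.
Qed.

Lemma strip_end : forall k n, n <> 0 -> le n (k + 1) -> strip n k = 1.
Proof.
  apply (ind (P := fun k => forall n, n <> 0 -> le n (k + 1) -> strip n k = 1)).
  - def; apply Def_strip; def.
  - intros n n0 L; rewrite strip_0; apply le_antisym.
    + replace (0 + 1) with (oneM M) in L by ring; exact L.
    + apply ne_0 in n0; destruct n0 as [m ->]; exists m; ring.
  - intros k IH n n0 L; rewrite strip_S'; apply IH; [apply cofactor_ne_0, n0|].
    destruct (classic (n = 1)) as [->|n1].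
    + rewrite cofactor_1; exists k; ring.
    + apply lt_succ_le; apply lt_le_trans with n; [apply cofactor_lt; auto|exact L].
Qed.

Lemma partial_0 c n : partial c n 0 = e.
Proof. apply prim_0. Qed.

Lemma partial_S c n k : partial c n (k + 1) = op (partial c n k) (factor c (strip n k)).
Proof.
  apply (prim_S (f := fun i x => op x (factor c (strip n i)))).
  apply Def_op'; [apply Def_hd|]; apply Def_factor; [def|]; apply Def_strip; def.
Qed.

Lemma partial_S' c n k : partial c n (k + 1) = op (factor c n) (partial c (cofactor n) k).
Proof.
  revert k; apply ind_eq1.
  - apply Def_partial; def.
  - apply Def_op'; [def|]; apply Def_partial; def.
  - rewrite partial_S, !partial_0, strip_0, op_e, opC; apply op_e.
  - intros k E; rewrite partial_S, E, strip_S', opA, partial_S; reflexivity.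
Qed.

Lemma partial_stable c n k : n <> 0 -> partial c n (n + k) = partial c n n.
Proof.
  intros n0; revert k; apply (ind_eq1 (F := fun k => partial c n (n + k))).
  - apply Def_partial; def.
  - def.
  - rewrite am_add0; reflexivity.
  - intros k E; replace (n + (k + 1)) with (n + k + 1) by ring.
    rewrite partial_S, E, strip_end; [|exact n0|exists (k + 1); ring].
    unfold factor; rewrite cond_true by reflexivity; apply op_e.
Qed.

Lemma mext_1 c : mext c 1 = e.
Proof.
  unfold mext; replace (oneM M) with (0 + oneM M) at 2 by ring.
  rewrite partial_S, partial_0, strip_0; unfold factor; rewrite cond_true by reflexivity.
  apply op_e.
Qed.

Lemma mext_step c n : n <> 0 -> n <> 1 -> mext c n = op (c ⋅ lpf n) (mext c (cofactor n)).
Proof.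
  intros n0 n1; unfold mext.
  rewrite <- (partial_stable c 1 n0), partial_S'; f_equal.
  - unfold factor; apply cond_false, n1.
  - destruct (lt_le (cofactor_lt n0 n1)) as [k E]; rewrite E at 2.
    apply partial_stable, cofactor_ne_0, n0.
Qed.

Lemma mext_prime_mul c p m : prime p -> p = lpf (p * m) -> m <> 0 ->
  mext c (p * m) = op (c ⋅ p) (mext c m).
Proof.
  intros Hp E m0; pose proof Hp as [p0 [p1 _]].
  assert (n0 : p * m <> 0) by (intros Z; apply mul_eq_0 in Z; tauto).
  assert (n1 : p * m <> 1) by (intros Z; apply mul_eq_1 in Z; tauto).
  rewrite (mext_step c n0 n1), <- E; f_equal; f_equal.
  apply mul_cancel with p; [exact p0|].
  pose proof (cofactor_spec n1) as S; rewrite <- E in S.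
  rewrite am_mulC, <- S; ring.
Qed.

Lemma mext_prime c p : prime p -> mext c p = c ⋅ p.
Proof.
  intros Hp; pose proof (@mext_prime_mul c p 1 Hp) as H.
  replace (p * 1) with p in H by ring; rewrite H, mext_1.
  - apply op_e.
  - symmetry; apply lpf_of_prime, Hp.
  - apply one_ne_0.
Qed.

(** The least prime factor of a product divides one of the factors, by Euclid's lemma,
    and is then the least prime factor of that factor. *)
Lemma mext_mul c a b : a <> 0 -> b <> 0 -> mext c (a * b) = op (mext c a) (mext c b).
Proof.
  assert (K : forall n, forall a b, n = a * b -> a <> 0 -> b <> 0 ->
    mext c n = op (mext c a) (mext c b)).
  2:{ intros; apply K; auto. }
  apply (strong_ind (P := fun n => forall a b, n = a * b -> a <> 0 -> b <> 0 ->
    mext c n = op (mext c a) (mext c b))).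
  { def; apply Def_mext; def. }
  intros n IH.
  assert (S : forall a b, n = a * b -> a <> 0 -> b <> 0 -> n <> 1 -> dvd (lpf n) a ->
    mext c n = op (mext c a) (mext c b)).
  { clear a b; intros a b E a0 b0 n1 [a' Ha].
    assert (n0 : n <> 0) by (rewrite E; intros Z; apply mul_eq_0 in Z; tauto).
    pose proof (lpf_prime n0 n1) as Hp; pose proof Hp as [p0 [p1 _]].
    assert (a'0 : a' <> 0) by (intros Z; apply a0; rewrite Ha, Z; ring).
    assert (Q : cofactor n = a' * b).
    { apply mul_cancel with (lpf n); [exact p0|].
      transitivity n; [rewrite am_mulC; symmetry; apply cofactor_spec, n1|].
      transitivity (lpf n * a' * b); [rewrite <- Ha; exact E|ring]. }
    assert (La : lpf n = lpf (lpf n * a')).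
    { rewrite <- Ha; apply le_antisym.
      - assert (a1 : a <> 1).
        { intros Z; rewrite Z in Ha; apply p1, dvd_1; exists a'; exact Ha. }
        apply lpf_spec; [exact n1|apply lpf_spec, a1|].
        apply dvd_trans with a; [apply lpf_spec, a1|exists b; exact E].
      - apply lpf_spec; [|exact p1|exists a'; exact Ha].
        intros Z; rewrite Z in Ha; apply p1, dvd_1; exists a'; exact Ha. }
    rewrite (mext_step c n0 n1), (IH (cofactor n) (cofactor_lt n0 n1) a' b Q a'0 b0).
    assert (A : mext c a = op (c ⋅ lpf n) (mext c a')).
    { rewrite Ha; apply mext_prime_mul; auto. }
    rewrite A; symmetry; apply opA. }
  intros a' b' E a0 b0; destruct (classic (n = 1)) as [n1|n1].
  - assert (a1 : a' = 1) by (apply (@mul_eq_1 a' b'); rewrite <- E; exact n1).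
    assert (b1 : b' = 1) by (apply (@mul_eq_1 b' a'); rewrite <- n1, E; ring).
    rewrite n1, a1, b1, mext_1; symmetry; apply op_e.
  - assert (n0 : n <> 0) by (rewrite E; intros Z; apply mul_eq_0 in Z; tauto).
    destruct (@euclid (lpf n) a' b') as [H|H]; auto.
    + apply lpf_prime; auto.
    + rewrite <- E; apply lpf_spec, n1.
    + rewrite opC; apply S; auto; rewrite E; ring.
Qed.

End Multiplicative.

(** * Pairing *)

Definition pair (i n : N) : N := (i + n) * (i + n) + i.

Lemma pair_lt (i n j m : N) : i + n < j + m -> pair i n < pair j m.
Proof.
  intros L; apply lt_exists in L; destruct L as [k E]; unfold pair; rewrite E.
  apply lt_exists.
  exists ((i + n) * k + (i + n) * k + i + n + n + k * k + k + k + j); ring.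
Qed.

Lemma pair_inj (i n j m : N) : pair i n = pair j m -> i = j /\ n = m.
Proof.
  intros E; destruct (am_lt_total (i + n) (j + m)) as [L|[e|L]].
  - apply pair_lt in L; rewrite E in L; destruct (lt_irrefl L).
  - unfold pair in E; rewrite e in E; apply add_cancel_l in E; split; [exact E|].
    rewrite E in e; apply add_cancel_l in e; exact e.
  - apply pair_lt in L; rewrite E in L; destruct (lt_irrefl L).
Qed.

Definition fstN (z : N) : N := least (fun i => exists n, z = pair i n).
Definition sndN (z : N) : N := least (fun n => exists i, z = pair i n).

Lemma fstN_pair i n : fstN (pair i n) = i.
Proof.
  destruct (least_spec (P := fun j => exists m, pair i n = pair j m)) as [[m E] _].
  - unfold pair; def.
  - exists i, n; reflexivity.
  - symmetry; apply (pair_inj E).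
Qed.

Lemma sndN_pair i n : sndN (pair i n) = n.
Proof.
  destruct (least_spec (P := fun m => exists j, pair i n = pair j m)) as [[m E] _].
  - unfold pair; def.
  - exists n, i; reflexivity.
  - symmetry; apply (pair_inj E).
Qed.

(** [dec] and [fam] make single functions out of sequences of functions, by pairing the
    arguments. *)
Definition dec : D (t1 ~> tN ~> t1) := lam (fun h => lam (fun i => lam (fun n => h ⋅ pair i n))).
Definition fam : D ((tN ~> t1) ~> t1) := lam (fun H => lam (fun z => H ⋅ fstN z ⋅ sndN z)).

Lemma dec_E h i n : dec ⋅ h ⋅ i ⋅ n = h ⋅ pair i n.
Proof.
  unfold dec; apply (beta3 (F := fun (h : D t1) (i n : N) => h ⋅ pair i n)); unfold pair; def.
Qed.

Lemma dec_fam H i : dec ⋅ (fam ⋅ H) ⋅ i = H ⋅ i.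
Proof.
  apply am_ext; intros n; rewrite dec_E; unfold fam.
  rewrite (beta2 (F := fun (H : D (tN ~> t1)) z => H ⋅ fstN z ⋅ sndN z)).
  - rewrite fstN_pair, sndN_pair; reflexivity.
  - unfold fstN, sndN, pair; def.
Qed.

(** * Substitution of monomials *)

Definition two : N := 1 + 1.

(** The monomial substitution for the state [d]: the variable of index [p] is squared when
    [d p <> 0], and its sign is changed when moreover [d p = two]; [Om] counts the changes
    of sign. *)
Definition pis (d : D t1) (n : N) : N :=
  mext (@mulN M) 1 (lam (fun p => cond (d ⋅ p = 0) p (p * p))) n.
Definition Om (d : D t1) (n : N) : N :=
  mext (@addN M) 0 (lam (fun p => ch (d ⋅ p = two))) n.

Lemma Def_mulN : Def [tN; tN] (fun p => hd (tl p) * hd p).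
Proof. def. Qed.
Lemma Def_addN : Def [tN; tN] (fun p => hd (tl p) + hd p).
Proof. def. Qed.

Lemma Def_pis : DefOp2 pis.
Proof.
  intros E F G HF HG; apply (Def_comp2 (F := pis)); auto; unfold pis.
  apply Def_mext; [apply Def_mulN|def|def].
Qed.

Lemma Def_Om : DefOp2 Om.
Proof.
  intros E F G HF HG; apply (Def_comp2 (F := Om)); auto; unfold Om, two.
  apply Def_mext; [apply Def_addN|def|def].
Qed.

Ltac def_number ::= lazymatch goal with
  | |- definable (fun p => lpf _) => apply Def_lpf
  | |- definable (fun p => prm _) => apply Def_prm
  | |- definable (fun p => pis _ _) => apply Def_pis
  | |- definable (fun p => Om _ _) => apply Def_Om
  end.

Lemma pis_1 d : pis d 1 = 1.
Proof. apply mext_1; try apply Def_mulN; intros; ring. Qed.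

Lemma Om_1 d : Om d 1 = 0.
Proof. apply mext_1; try apply Def_addN; intros; ring. Qed.

Lemma pis_prime d p : prime p -> pis d p = cond (d ⋅ p = 0) p (p * p).
Proof.
  intros H; unfold pis; rewrite mext_prime; try apply Def_mulN; try (intros; ring); auto.
  apply (beta (F := fun p => cond (d ⋅ p = 0) p (p * p))); def.
Qed.

Lemma Om_prime d p : prime p -> Om d p = ch (d ⋅ p = two).
Proof.
  intros H; unfold Om; rewrite mext_prime; try apply Def_addN; try (intros; ring); auto.
  apply (beta (F := fun p => ch (d ⋅ p = two))); unfold two; def.
Qed.

Lemma pis_mul d a b : a <> 0 -> b <> 0 -> pis d (a * b) = pis d a * pis d b.
Proof. intros; apply mext_mul; auto using Def_mulN; intros; ring. Qed.

Lemma Om_mul d a b : a <> 0 -> b <> 0 -> Om d (a * b) = Om d a + Om d b.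
Proof. intros; apply mext_mul; auto using Def_addN; intros; ring. Qed.

Lemma prime_ind (P : N -> Prop) : Def [tN] (fun p => ch (P (hd p))) ->
  P 1 -> (forall p m, prime p -> m <> 0 -> P m -> P (p * m)) -> forall n, n <> 0 -> P n.
Proof.
  intros DP H1 Hp; apply (strong_ind (P := fun n => n <> 0 -> P n)).
  - def.
  - intros n IH n0; destruct (classic (n = 1)) as [->|n1]; [exact H1|].
    rewrite (cofactor_spec n1); apply Hp; [apply lpf_prime; auto|apply cofactor_ne_0, n0|].
    apply IH; [apply cofactor_lt; auto|apply cofactor_ne_0, n0].
Qed.

Lemma prime_ne_0 (p : N) : prime p -> p <> 0.
Proof. intros [H _]; exact H. Qed.

Lemma mul_ne_0 (a b : N) : a <> 0 -> b <> 0 -> a * b <> 0.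
Proof. intros H K E; apply mul_eq_0 in E; tauto. Qed.

Lemma dvd_pis d n : n <> 0 -> dvd n (pis d n).
Proof.
  revert n; apply (prime_ind (P := fun n => dvd n (pis d n))); [def| |].
  - rewrite pis_1; apply dvd_refl.
  - intros p m Hp m0 [k E]; rewrite (pis_mul d (prime_ne_0 Hp) m0), pis_prime, E by exact Hp.
    unfold cond; destruct excluded_middle_informative.
    + exists k; ring.
    + exists (p * k); ring.
Qed.

Lemma pis_ne_0 d n : n <> 0 -> pis d n <> 0.
Proof.
  revert n; apply (prime_ind (P := fun n => pis d n <> 0)); [def| |].
  - rewrite pis_1; apply one_ne_0.
  - intros p m Hp m0 IH; rewrite (pis_mul d (prime_ne_0 Hp) m0), pis_prime by exact Hp.
    pose proof (prime_ne_0 Hp); apply mul_ne_0; [|exact IH].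
    unfold cond; destruct excluded_middle_informative; auto using mul_ne_0.
Qed.

Lemma pis_le d n : n <> 0 -> le n (pis d n).
Proof. intros H; apply dvd_le; [apply pis_ne_0, H|apply dvd_pis, H]. Qed.

(** The substitution introduces no new prime factors; this is why it is injective. *)
Lemma prime_dvd_pis d q n : prime q -> n <> 0 -> dvd q (pis d n) -> dvd q n.
Proof.
  intros Hq n0; revert n n0; apply (prime_ind (P := fun n => dvd q (pis d n) -> dvd q n)).
  - def.
  - rewrite pis_1; auto.
  - intros p m Hp m0 IH; rewrite (pis_mul d (prime_ne_0 Hp) m0), pis_prime by exact Hp.
    intros H; apply (euclid Hq) in H.
    assert (K : dvd q p \/ dvd q m).
    { destruct H as [H|H]; [left|tauto]; revert H.
      unfold cond; destruct excluded_middle_informative; auto.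
      intros H; apply (euclid Hq) in H; tauto. }
    destruct K as [K|K]; apply (dvd_trans K); [apply dvd_mul_r|apply dvd_mul_l].
Qed.

Lemma pis_inj d m n : m <> 0 -> n <> 0 -> pis d m = pis d n -> m = n.
Proof.
  intros m0; revert m m0 n; apply (prime_ind (P := fun m => forall n, n <> 0 ->
    pis d m = pis d n -> m = n)).
  - def.
  - intros n n0 E; symmetry; apply dvd_1.
    rewrite <- (pis_1 d), E; apply dvd_pis, n0.
  - intros p m Hp m0 IH n n0 E; pose proof (prime_ne_0 Hp) as p0.
    assert (H : dvd p n).
    { apply (prime_dvd_pis (d := d) Hp n0); rewrite <- E.
      apply dvd_trans with (p * m); [apply dvd_mul_r|apply dvd_pis, mul_ne_0; auto]. }
    destruct H as [n' ->].
    assert (n'0 : n' <> 0) by (intros Z; apply n0; rewrite Z; ring).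
    f_equal; apply IH; [exact n'0|]; rewrite !pis_mul in E by auto.
    apply mul_cancel with (pis d p); [apply pis_ne_0, p0|].
    rewrite !(am_mulC _ (pis d p)); exact E.
Qed.

(** The substitution for [d] leaves the primes with [d p = 0] to the substitution for
    [d1], which must not touch the others; [d2] is the union. *)
Definition glue (d d1 d2 : D t1) : Prop := forall p, prime p ->
  (d ⋅ p = 0 /\ d2 ⋅ p = d1 ⋅ p) \/ (d ⋅ p <> 0 /\ d1 ⋅ p = 0 /\ d2 ⋅ p = d ⋅ p).

Lemma two_ne_0 : (two : N) <> 0.
Proof. apply ne_0; exists 1; reflexivity. Qed.

Lemma pis_glue d d1 d2 n : glue d d1 d2 -> n <> 0 -> pis d1 (pis d n) = pis d2 n.
Proof.
  intros G; revert n; apply (prime_ind (P := fun n => pis d1 (pis d n) = pis d2 n)).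
  - def.
  - rewrite !pis_1; reflexivity.
  - intros p m Hp m0 IH; pose proof (prime_ne_0 Hp) as p0.
    rewrite (pis_mul d p0 m0), (pis_mul d2 p0 m0), pis_mul, IH by (apply pis_ne_0; auto).
    f_equal; rewrite (pis_prime d Hp), (pis_prime d2 Hp).
    destruct (G p Hp) as [[E1 E2]|[E1 [E2 E3]]].
    + rewrite (cond_true _ _ E1), (pis_prime d1 Hp), E2; reflexivity.
    + rewrite (cond_false _ _ E1), pis_mul, (pis_prime d1 Hp), (cond_true _ _ E2), E3,
        (cond_false _ _ E1) by assumption; reflexivity.
Qed.

Lemma Om_glue d d1 d2 n : glue d d1 d2 -> n <> 0 ->
  Om d2 n = Om d n + Om d1 (pis d n).
Proof.
  intros G; revert n; apply (prime_ind (P := fun n => Om d2 n = Om d n + Om d1 (pis d n))).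
  - def.
  - rewrite pis_1, !Om_1; ring.
  - intros p m Hp m0 IH; pose proof (prime_ne_0 Hp) as p0.
    rewrite (pis_mul d p0 m0), !Om_mul, IH by (auto; apply pis_ne_0; auto).
    enough (Om d2 p = Om d p + Om d1 (pis d p)) as -> by ring.
    rewrite (pis_prime d Hp), (Om_prime d Hp), (Om_prime d2 Hp).
    destruct (G p Hp) as [[E1 E2]|[E1 [E2 E3]]].
    + rewrite (cond_true _ _ E1), (Om_prime d1 Hp), E2, E1.
      rewrite (ch_false (P := 0 = two)); [ring|]; intros Z; apply two_ne_0; auto.
    + rewrite (cond_false _ _ E1), Om_mul, (Om_prime d1 Hp), E2, E3 by assumption.
      rewrite (ch_false (P := 0 = two)); [ring|]; intros Z; apply two_ne_0; auto.
Qed.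

Definition even (n : N) : Prop := exists k, n = k + k.

Lemma even_S n : even (n + 1) <-> ~ even n.
Proof.
  split.
  - intros [k E] [j ->]; destruct (am_lt_total k j) as [L|[->|L]].
    + apply lt_exists in L; destruct L as [i ->].
      apply (@one_ne_0), (@add_eq_0 1 (i + i + 1 + 1)).
      apply add_cancel_l with (k + k); rewrite am_add0; etransitivity; [|exact E]; ring.
    + apply (@one_ne_0), add_cancel_l with (j + j); rewrite E; ring.
    + apply lt_exists in L; destruct L as [i ->].
      apply (@one_ne_0), (@add_eq_0 1 (i + i)).
      apply add_cancel_l with (j + j + 1); rewrite am_add0; symmetry.
      etransitivity; [exact E|ring].
  - revert n; apply (ind (P := fun n => ~ even n -> even (n + 1))); [unfold even; def| |].
    + intros H; destruct H; exists 0; ring.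
    + intros n IH H; destruct (classic (even n)) as [[k ->]|K].
      * exists (k + 1); ring.
      * destruct (H (IH K)).
Qed.

Lemma even_add n m : even (n + m) <-> (even n <-> even m).
Proof.
  revert m; apply (ind (P := fun m => even (n + m) <-> (even n <-> even m))).
  - unfold even, iff; def.
  - rewrite am_add0; assert (even 0) by (exists 0; ring); tauto.
  - intros m IH; replace (n + (m + 1)) with (n + m + 1) by ring; rewrite !even_S; tauto.
Qed.

(** * Finite sums *)

Definition sum (F : N -> N) (n : N) : N := prim (fun k x => x + F k) 0 n.

Lemma Def_sum E (B : N -> pts M E -> N) (G : pts M E -> N) :
  Def (tN :: E) (fun q => B (hd q) (tl q)) -> Def E G ->
  Def E (fun p => sum (fun k => B k p) (G p)).
Proof.
  intros HB HG; unfold sum; apply Def_prim; [|def|exact HG].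
  apply Def_add; [def|].
  apply Def_tl with (F := fun q : pts M (tN :: E) => B (hd q) (tl q)), HB.
Qed.

Ltac def_series ::= apply Def_sum.

Lemma sum_0 (F : N -> N) : sum F 0 = 0.
Proof. apply prim_0. Qed.

Lemma sum_S (F : N -> N) n : Def1 F -> sum F (n + 1) = sum F n + F n.
Proof. intros H; apply (prim_S (f := fun k x => x + F k)); def. Qed.

Lemma sum_ext (F G : N -> N) : Def1 F -> Def1 G ->
  forall n, (forall k, k < n -> F k = G k) -> sum F n = sum G n.
Proof.
  intros HF HG; apply (ind (P := fun n => (forall k, k < n -> F k = G k) -> sum F n = sum G n)).
  - def.
  - intros _; rewrite !sum_0; reflexivity.
  - intros n IH H; rewrite !sum_S by assumption; rewrite IH, H; [reflexivity| |].
    + apply lt_succ_diag.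
    + intros k L; apply H, (lt_trans L), lt_succ_diag.
Qed.

Tactic Notation "sum_terms" simple_intropattern(k) simple_intropattern(L) :=
  apply sum_ext; [def|def|]; intros k L.

Lemma sum_add (F G : N -> N) n : Def1 F -> Def1 G ->
  sum (fun k => F k + G k) n = sum F n + sum G n.
Proof.
  intros HF HG; revert n; apply ind_eq1; [def|def| |].
  - rewrite !sum_0; ring.
  - intros n E; rewrite !sum_S, E by def; ring.
Qed.

Lemma sum_scale (c : N) (F : N -> N) n : Def1 F -> sum (fun k => c * F k) n = c * sum F n.
Proof.
  intros HF; revert n; apply ind_eq1; [def|def| |].
  - rewrite !sum_0; ring.
  - intros n E; rewrite !sum_S, E by def; ring.
Qed.

Lemma sum_zero (F : N -> N) n : Def1 F -> (forall k, k < n -> F k = 0) -> sum F n = 0.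
Proof.
  intros HF H; transitivity (sum (fun _ : N => 0) n); [apply sum_ext; auto; def|].
  clear H; revert n; apply ind_eq1; [def|def|apply sum_0|].
  intros n E; rewrite sum_S, E by def; ring.
Qed.

Lemma sum_widen (F : N -> N) n m : Def1 F -> le n m -> (forall k, le n k -> F k = 0) ->
  sum F m = sum F n.
Proof.
  intros HF [k ->] H; revert k; apply (ind_eq1 (F := fun k => sum F (n + k))); [def|def| |].
  - rewrite am_add0; reflexivity.
  - intros k E; replace (n + (k + 1)) with (n + k + 1) by ring.
    rewrite sum_S, E, H by (auto; exists k; reflexivity); ring.
Qed.

Lemma sum_single (F : N -> N) n j : Def1 F -> j < n ->
  (forall k, k < n -> k <> j -> F k = 0) -> sum F n = F j.
Proof.
  intros HF L H; apply lt_exists in L; destruct L as [i ->].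
  rewrite (sum_ext (G := fun k => ch (k = j) * F j)); [|def|def|].
  - rewrite (sum_widen (n := j + 1)); [|def|exists i; ring|].
    + rewrite sum_S by def; rewrite (ch_true (P := j = j)) by reflexivity.
      rewrite sum_zero; [ring|def|].
      intros k L; rewrite ch_false; [ring|]; intros ->; destruct (lt_irrefl L).
    + intros k L; rewrite ch_false; [ring|]; intros ->.
      apply not_lt in L; apply L, lt_succ_diag.
  - intros k L; destruct (classic (k = j)) as [->|n].
    + rewrite ch_true by reflexivity; ring.
    + rewrite ch_false, H by auto; ring.
Qed.

Lemma sum_exchange (F : N -> N -> N) n m : Def2 F ->
  sum (fun a => sum (fun b => F a b) m) n = sum (fun b => sum (fun a => F a b) n) m.
Proof.
  intros HF; revert n; apply ind_eq1; [def|def| |].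
  - rewrite sum_0; symmetry; apply sum_zero; [def|]; intros; apply sum_0.
  - intros n E; rewrite sum_S, E, <- sum_add by def.
    sum_terms k _; rewrite sum_S by def; reflexivity.
Qed.

(** A sum over the fibres of [w] is a sum over its domain. The index [u] stands for the
    value [u + 1] of [w], as in the series below; the hypothesis on [G] says that the
    values of [w] outside the range of summation do not matter. *)
Lemma sum_change (G a w : N -> N) (n B : N) : Def1 G -> Def1 a -> Def1 w ->
  (forall x, x < n -> w x <> 0) -> (forall z, B < z -> G z = 0) ->
  sum (fun u => G (u + 1) * sum (fun x => ch (w x = u + 1) * a x) n) B
  = sum (fun x => a x * G (w x)) n.
Proof.
  intros HG Ha Hw w0 GB.
  transitivity (sum (fun u => sum (fun x => G (u + 1) * (ch (w x = u + 1) * a x)) n) B).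
  { sum_terms u _; symmetry.
    apply (sum_scale _ (F := fun x => ch (w x = u + 1) * a x)); def. }
  rewrite sum_exchange by def.
  sum_terms x Lx.
  pose proof (w0 x Lx) as W; apply ne_0 in W; destruct W as [j E].
  destruct (classic (j < B)) as [L|L].
  - rewrite (sum_single (j := j)); [|def|exact L|].
    + rewrite ch_true, E by exact E; ring.
    + intros k _ nk; rewrite ch_false; [ring|]; rewrite E; intros e.
      apply add_cancel in e; auto.
  - rewrite GB by (rewrite E; apply lt_succ_le, not_lt, L).
    rewrite sum_zero; [ring|def|]; intros k Lk; rewrite ch_false; [ring|].
    rewrite E; intros e; apply add_cancel in e; rewrite e in L; tauto.
Qed.

Lemma sum_change2 (G f g : N -> N) (n m B : N) : Def1 G -> Def1 f -> Def1 g ->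
  (forall z, B < z -> G z = 0) ->
  sum (fun u => G (u + 1) *
    sum (fun x => sum (fun y => ch ((x + 1) * (y + 1) = u + 1) * (f x * g y)) m) n) B
  = sum (fun x => sum (fun y => f x * g y * G ((x + 1) * (y + 1))) m) n.
Proof.
  intros HG Hf Hg GB.
  transitivity (sum (fun u => sum (fun x => G (u + 1) *
    sum (fun y => ch ((x + 1) * (y + 1) = u + 1) * (f x * g y)) m) n) B).
  { sum_terms u _; symmetry.
    apply (sum_scale _ (F := fun x =>
      sum (fun y => ch ((x + 1) * (y + 1) = u + 1) * (f x * g y)) m)); def. }
  rewrite sum_exchange by def.
  sum_terms x _.
  apply (sum_change (a := fun y => f x * g y) (w := fun y => (x + 1) * (y + 1)));
    [def|def|def| |exact GB].
  intros y _; apply mul_ne_0; apply ne_0; eauto.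
Qed.

(** * Dirichlet series with natural coefficients *)

Definition szero : D t1 := lam (fun _ => 0).
Definition mono (i : N) : D t1 := lam (fun n => ch (n = i)).
Definition sadd (f g : D t1) : D t1 := lam (fun n => f ⋅ n + g ⋅ n).
(** Dirichlet convolution; the index [n] stands for the monomial [n + 1], so that all
    natural numbers are indices and the products have larger indices than their factors. *)
Definition conv (f g : D t1) : D t1 := lam (fun k =>
  sum (fun x => sum (fun y => ch ((x + 1) * (y + 1) = k + 1) * (f ⋅ x * g ⋅ y)) (k + 1)) (k + 1)).
(** The image of a series under the substitution of its monomials. *)
Definition push (d f : D t1) : D t1 := lam (fun k =>
  sum (fun x => ch (pis d (x + 1) = k + 1) * f ⋅ x) (k + 1)).

Lemma Def_mono : DefOp1 mono.
Proof. intros E F H; apply (Def_comp (F := mono)); [unfold mono; def|exact H]. Qed.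

Lemma Def_sadd : DefOp2 sadd.
Proof. intros E F G HF HG; apply (Def_comp2 (F := sadd)); auto; unfold sadd; def. Qed.

Lemma Def_conv : DefOp2 conv.
Proof. intros E F G HF HG; apply (Def_comp2 (F := conv)); auto; unfold conv; def. Qed.

Lemma Def_push : DefOp2 push.
Proof. intros E F G HF HG; apply (Def_comp2 (F := push)); auto; unfold push; def. Qed.

Lemma szero_E n : szero ⋅ n = 0.
Proof. unfold szero; rewrite beta by def; reflexivity. Qed.

Lemma mono_E i n : mono i ⋅ n = ch (n = i).
Proof. unfold mono; rewrite beta by def; reflexivity. Qed.

Lemma sadd_E f g n : sadd f g ⋅ n = f ⋅ n + g ⋅ n.
Proof. unfold sadd; rewrite beta by def; reflexivity. Qed.

Lemma conv_E f g k : conv f g ⋅ k =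
  sum (fun x => sum (fun y => ch ((x + 1) * (y + 1) = k + 1) * (f ⋅ x * g ⋅ y)) (k + 1)) (k + 1).
Proof. unfold conv; rewrite beta by def; reflexivity. Qed.

Lemma push_E d f k : push d f ⋅ k = sum (fun x => ch (pis d (x + 1) = k + 1) * f ⋅ x) (k + 1).
Proof. unfold push; rewrite beta by def; reflexivity. Qed.

Lemma succ_ne_0 (x : N) : x + 1 <> 0.
Proof. apply ne_0; eauto. Qed.

Lemma product_index (x y k : N) : (x + 1) * (y + 1) = k + 1 -> x < k + 1 /\ y < k + 1.
Proof.
  intros E; rewrite !lt_succ_le.
  replace k with (x * y + x + y); [split|].
  - exists (x * y + y); ring.
  - exists (x * y + x); ring.
  - apply add_cancel with 1; rewrite <- E; ring.
Qed.

Lemma conv_box f g k n m : le (k + 1) n -> le (k + 1) m -> conv f g ⋅ k =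
  sum (fun x => sum (fun y => ch ((x + 1) * (y + 1) = k + 1) * (f ⋅ x * g ⋅ y)) m) n.
Proof.
  intros Ln Lm; rewrite conv_E; symmetry; rewrite (sum_widen (n := k + 1)); [|def|exact Ln|].
  - sum_terms x _.
    apply (sum_widen (F := fun y => ch ((x + 1) * (y + 1) = k + 1) * (f ⋅ x * g ⋅ y)));
      [def|exact Lm|].
    intros y L; rewrite ch_false; [ring|]; intros E; apply product_index in E.
    apply not_lt in L; tauto.
  - intros x L; apply sum_zero; [def|]; intros y _; rewrite ch_false; [ring|].
    intros E; apply product_index in E; apply not_lt in L; tauto.
Qed.

Lemma push_box d f k n : le (k + 1) n ->
  push d f ⋅ k = sum (fun x => ch (pis d (x + 1) = k + 1) * f ⋅ x) n.
Proof.
  intros L; rewrite push_E; symmetry; apply sum_widen; [def|exact L|].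
  intros x Lx; rewrite ch_false; [ring|]; intros E.
  pose proof (pis_le d (@succ_ne_0 x)) as K; rewrite E in K.
  apply not_lt in Lx; apply Lx, lt_succ_le.
  destruct K as [j K]; exists j; apply add_cancel with 1; rewrite K; ring.
Qed.

Lemma sadd_C f g : sadd f g = sadd g f.
Proof. apply am_ext; intros n; rewrite !sadd_E; ring. Qed.

Lemma sadd_A f g h : sadd f (sadd g h) = sadd (sadd f g) h.
Proof. apply am_ext; intros n; rewrite !sadd_E; ring. Qed.

Lemma sadd_0 f : sadd szero f = f.
Proof. apply am_ext; intros n; rewrite sadd_E, szero_E; ring. Qed.

Lemma sadd_cancel f g h : sadd f h = sadd g h -> f = g.
Proof.
  intros E; apply am_ext; intros n; apply add_cancel with (h ⋅ n).
  rewrite <- !sadd_E, E; reflexivity.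
Qed.

Lemma conv_C f g : conv f g = conv g f.
Proof.
  apply am_ext; intros k; rewrite !conv_E.
  rewrite sum_exchange by def.
  sum_terms x _; sum_terms y _.
  rewrite (am_mulC (y + 1)); ring.
Qed.

Lemma conv_D f g h : conv (sadd f g) h = sadd (conv f h) (conv g h).
Proof.
  apply am_ext; intros k; rewrite sadd_E, !conv_E, <- sum_add by def.
  sum_terms x _; rewrite <- sum_add by def.
  sum_terms y _; rewrite sadd_E; ring.
Qed.

Lemma conv_0 f : conv szero f = szero.
Proof.
  apply am_ext; intros k; rewrite conv_E, szero_E; apply sum_zero; [def|]; intros x _.
  apply sum_zero; [def|]; intros y _; rewrite szero_E; ring.
Qed.

Lemma conv_1 f : conv (mono 0) f = f.
Proof.
  apply am_ext; intros k; rewrite conv_E, (sum_single (j := 0)); [|def|apply lt_0_succ|].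
  - rewrite (sum_single (j := k)); [|def|apply lt_succ_diag|].
    + rewrite mono_E, !ch_true by (auto; ring); ring.
    + intros y _ H; rewrite ch_false; [ring|]; intros E; apply H, add_cancel with 1.
      rewrite <- E; ring.
  - intros x _ H; apply sum_zero; [def|]; intros y _.
    rewrite mono_E, (ch_false (P := x = 0)) by exact H; ring.
Qed.

(** The right-hand side is symmetric in [f], [g], [h] up to the order of summation, which
    gives associativity. *)
Lemma conv_triple f g h k : conv (conv f g) h ⋅ k =
  sum (fun z => sum (fun x => sum (fun y => f ⋅ x * g ⋅ y *
    (ch ((x + 1) * (y + 1) * (z + 1) = k + 1) * h ⋅ z)) (k + 1)) (k + 1)) (k + 1).
Proof.
  rewrite conv_C, conv_E; sum_terms z _.
  rewrite <- (sum_change2 (G := fun u => ch (u * (z + 1) = k + 1) * h ⋅ z) (f := fun x => f ⋅ x)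
    (g := fun y => g ⋅ y) (k + 1) (k + 1) (B := k + 1)); [|def|def|def|].
  - sum_terms u L.
    rewrite <- conv_box by (destruct (lt_le L) as [j E]; apply lt_exists in L;
      destruct L as [i ->]; exists i; ring).
    rewrite (am_mulC (z + 1)); ring.
  - intros u L; rewrite ch_false; [ring|]; intros E.
    apply (lt_irrefl (a := k + 1)); apply lt_le_trans with u; [exact L|].
    rewrite <- E; apply le_mul, succ_ne_0.
Qed.

Lemma conv_A f g h : conv f (conv g h) = conv (conv f g) h.
Proof.
  rewrite conv_C; apply am_ext; intros k; rewrite !conv_triple.
  rewrite sum_exchange by def.
  rewrite (sum_ext (G := fun x => sum (fun y => sum (fun z => g ⋅ x * h ⋅ y *
    (ch ((x + 1) * (y + 1) * (z + 1) = k + 1) * f ⋅ z)) (k + 1)) (k + 1))); [|def|def|].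
  2:{ intros x _; apply (sum_exchange (F := fun z y => g ⋅ x * h ⋅ y *
    (ch ((x + 1) * (y + 1) * (z + 1) = k + 1) * f ⋅ z))); def. }
  rewrite sum_exchange by def.
  sum_terms z _.
  rewrite sum_exchange by def.
  sum_terms x _; sum_terms y _.
  replace ((y + 1) * (z + 1) * (x + 1)) with ((x + 1) * (y + 1) * (z + 1)) by ring; ring.
Qed.

Lemma series_semi_ring : semi_ring_theory szero (mono 0) sadd conv eq.
Proof.
  split; intros.
  - apply sadd_0.
  - apply sadd_C.
  - apply sadd_A.
  - apply conv_1.
  - apply conv_0.
  - apply conv_C.
  - apply conv_A.
  - apply conv_D.
Qed.
Add Ring S_ring : series_semi_ring.

(** Both sides sum [f x * g y] over the pairs of monomials whose product has the image
    [k + 1], by multiplicativity of [pis]. *)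
Lemma push_conv d f g : push d (conv f g) = conv (push d f) (push d g).
Proof.
  apply am_ext; intros k; rewrite push_E, conv_E.
  transitivity (sum (fun x => sum (fun y => f ⋅ x * g ⋅ y *
    ch (pis d ((x + 1) * (y + 1)) = k + 1)) (k + 1)) (k + 1)).
  - rewrite <- (sum_change2 (G := fun u => ch (pis d u = k + 1)) (f := fun x => f ⋅ x)
      (g := fun y => g ⋅ y) (k + 1) (k + 1) (B := k + 1)); [|def|def|def|].
    + sum_terms u L; f_equal; apply conv_box;
        apply lt_exists in L; destruct L as [i ->]; exists i; ring.
    + intros u L; apply ch_false; intros E; apply (lt_irrefl (a := k + 1)).
      apply lt_le_trans with u; [exact L|]; rewrite <- E; apply pis_le.
      intros ->; exact (not_lt_0 L).
  - symmetry.
    transitivity (sum (fun u =>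
      sum (fun v => ch ((u + 1) * (v + 1) = k + 1) * push d g ⋅ v) (k + 1) *
      sum (fun x => ch (pis d (x + 1) = u + 1) * f ⋅ x) (k + 1)) (k + 1)).
    { sum_terms u L.
      rewrite <- push_box by (apply lt_exists in L; destruct L as [i ->]; exists i; ring).
      rewrite (am_mulC _ (push d f ⋅ u)), <- sum_scale by def.
      sum_terms v _; ring. }
    rewrite (sum_change (G := fun z => sum (fun v => ch (z * (v + 1) = k + 1) * push d g ⋅ v)
      (k + 1)) (a := fun x => f ⋅ x) (w := fun x => pis d (x + 1)));
      [|def|def|def|intros x _; apply pis_ne_0, succ_ne_0|].
    2:{ intros z L; apply sum_zero; [def|]; intros v _; rewrite ch_false; [ring|].
        intros E; apply (lt_irrefl (a := k + 1)), lt_le_trans with z; [exact L|].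
        rewrite <- E; apply le_mul, succ_ne_0. }
    sum_terms x _.
    rewrite <- sum_scale by def.
    transitivity (sum (fun v => f ⋅ x * ch (pis d (x + 1) * (v + 1) = k + 1) *
      sum (fun y => ch (pis d (y + 1) = v + 1) * g ⋅ y) (k + 1)) (k + 1)).
    { sum_terms v L.
      rewrite <- push_box by (apply lt_exists in L; destruct L as [i ->]; exists i; ring).
      ring. }
    rewrite (sum_change (G := fun z => f ⋅ x * ch (pis d (x + 1) * z = k + 1))
      (a := fun y => g ⋅ y) (w := fun y => pis d (y + 1)));
      [|def|def|def|intros y _; apply pis_ne_0, succ_ne_0|].
    2:{ intros z L; rewrite ch_false; [ring|].
        intros E; apply (lt_irrefl (a := k + 1)), lt_le_trans with z; [exact L|].
        rewrite <- E, am_mulC; apply le_mul, pis_ne_0, succ_ne_0. }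
    sum_terms y _.
    rewrite (pis_mul d) by apply succ_ne_0; ring.
Qed.

Lemma push_sadd d f g : push d (sadd f g) = sadd (push d f) (push d g).
Proof.
  apply am_ext; intros k; rewrite sadd_E, !push_E, <- sum_add by def.
  sum_terms x _; rewrite sadd_E; ring.
Qed.

Lemma push_at d f n k : pis d (n + 1) = k + 1 -> push d f ⋅ k = f ⋅ n.
Proof.
  intros E; assert (L : n < k + 1).
  { apply lt_succ_le; pose proof (pis_le d (@succ_ne_0 n)) as K; rewrite E in K.
    destruct K as [j K]; exists j; apply add_cancel with 1; rewrite K; ring. }
  rewrite push_E, (sum_single (j := n)); [|def|exact L|].
  - rewrite ch_true by exact E; ring.
  - intros x _ H; rewrite ch_false; [ring|]; intros e; apply H, add_cancel with 1.
    apply (pis_inj (d := d)); try apply succ_ne_0; rewrite E; exact e.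
Qed.

Lemma push_out d f k : (forall n, pis d (n + 1) <> k + 1) -> push d f ⋅ k = 0.
Proof.
  intros H; rewrite push_E; apply sum_zero; [def|]; intros x _.
  rewrite ch_false by apply H; ring.
Qed.

Lemma pis_index d n : exists k, pis d (n + 1) = k + 1.
Proof. apply ne_0, pis_ne_0, succ_ne_0. Qed.

Lemma push_inj d f g : push d f = push d g -> f = g.
Proof.
  intros E; apply am_ext; intros n; destruct (pis_index d n) as [k Hk].
  rewrite <- (push_at f Hk), E; apply push_at, Hk.
Qed.

Lemma push_glue d d1 d2 f : glue d d1 d2 -> push d1 (push d f) = push d2 f.
Proof.
  intros G; apply am_ext; intros k.
  assert (K : forall n, pis d2 (n + 1) = pis d1 (pis d (n + 1))).
  { intros n; symmetry; apply (pis_glue G), succ_ne_0. }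
  destruct (classic (exists n, pis d2 (n + 1) = k + 1)) as [[n Hn]|H].
  - rewrite (push_at f Hn); rewrite K in Hn.
    destruct (pis_index d n) as [m Hm]; rewrite Hm in Hn.
    rewrite (push_at _ Hn); apply push_at, Hm.
  - rewrite (push_out f (d := d2)) by (intros n E; eauto).
    destruct (classic (exists m, pis d1 (m + 1) = k + 1)) as [[m Hm]|H'].
    + rewrite (push_at _ Hm); apply push_out; intros n E; apply H; exists n.
      rewrite K, E; exact Hm.
    + apply push_out; intros m E; eauto.
Qed.

Lemma push_mono d i k : pis d (i + 1) = k + 1 -> push d (mono i) = mono k.
Proof.
  intros E; apply am_ext; intros j; rewrite mono_E.
  destruct (classic (exists n, pis d (n + 1) = j + 1)) as [[n Hn]|H].
  - rewrite (push_at _ Hn), mono_E; apply ch_iff; split; intros e.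
    + rewrite e in Hn; apply add_cancel with 1; rewrite <- E; auto.
    + rewrite e, <- E in Hn; apply add_cancel with 1.
      apply (pis_inj (d := d)); try apply succ_ne_0; exact Hn.
  - rewrite push_out by (intros n e; eauto); symmetry; apply ch_false.
    intros e; rewrite e in H; eauto.
Qed.

Lemma conv_mono i j k : (i + 1) * (j + 1) = k + 1 -> conv (mono i) (mono j) = mono k.
Proof.
  intros E; pose proof (product_index E) as [Li Lj].
  apply am_ext; intros n; rewrite mono_E.
  destruct (classic (n = k)) as [->|H].
  - rewrite conv_E, (sum_single (j := i)); [|def|exact Li|].
    + rewrite (sum_single (j := j)); [|def|exact Lj|].
      * rewrite !mono_E, !ch_true by auto; ring.
      * intros y _ Hy; rewrite (mono_E j y), (ch_false Hy); ring.
    + intros x _ Hx; apply sum_zero; [def|]; intros y _.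
      rewrite (mono_E i x), (ch_false Hx); ring.
  - rewrite (ch_false H), conv_E; apply sum_zero; [def|]; intros x _.
    apply sum_zero; [def|]; intros y _; rewrite !mono_E.
    destruct (classic (x = i)) as [->|Hx]; [|rewrite (ch_false Hx); ring].
    destruct (classic (y = j)) as [->|Hy]; [|rewrite (ch_false Hy); ring].
    rewrite (ch_false (P := _ = n + 1)); [ring|].
    intros e; apply H, add_cancel with 1; rewrite <- E, <- e; reflexivity.
Qed.

Ltac def_series ::= lazymatch goal with
  | |- definable (fun p => sum _ _) => apply Def_sum
  | |- definable (fun p => mono _) => apply Def_mono
  | |- definable (fun p => sadd _ _) => apply Def_sadd
  | |- definable (fun p => conv _ _) => apply Def_conv
  | |- definable (fun p => push _ _) => apply Def_push
  end.

(** * The ordered ring of series *)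

(** The change of sign in the substitution: [tw d f g] and [tw d g f] are the positive and the
    negative part when [f] and [g] are these parts of a given series. *)
Definition tw (d f g : D t1) : D t1 :=
  lam (fun m => cond (even (Om d (m + 1))) (f ⋅ m) (g ⋅ m)).

Lemma Def_tw E (F G H : pts M E -> D t1) :
  Def E F -> Def E G -> Def E H -> Def E (fun p => tw (F p) (G p) (H p)).
Proof.
  intros HF HG HH; apply (Def_comp3 (F := tw)); auto; unfold tw, even; def.
Qed.

Lemma tw_E (d f g : D t1) (m : N) : tw d f g ⋅ m = cond (even (Om d (m + 1))) (f ⋅ m) (g ⋅ m).
Proof.
  apply (beta (F := fun m => cond (even (Om d (m + 1))) (f ⋅ m) (g ⋅ m))).
  unfold even; def.
Qed.

Lemma conv2_E (a b c e : D t1) (m : N) : sadd (conv a c) (conv b e) ⋅ m =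
  sum (fun x => sum (fun y => ch ((x + 1) * (y + 1) = m + 1) *
    (a ⋅ x * c ⋅ y + b ⋅ x * e ⋅ y)) (m + 1)) (m + 1).
Proof.
  rewrite sadd_E, !conv_E, <- sum_add by def; sum_terms x _.
  rewrite <- sum_add by def; sum_terms y _; ring.
Qed.

(** Twisting by the parity of [Om] is multiplicative because [Om] is additive. *)
Lemma tw_conv (d a b c e : D t1) : tw d (sadd (conv a c) (conv b e)) (sadd (conv a e) (conv b c))
  = sadd (conv (tw d a b) (tw d c e)) (conv (tw d b a) (tw d e c)).
Proof.
  apply am_ext; intros m; rewrite tw_E, !conv2_E.
  assert (K : forall x y : N, (x + 1) * (y + 1) = m + 1 ->
    (even (Om d (m + 1)) <-> (even (Om d (x + 1)) <-> even (Om d (y + 1))))).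
  { intros x y <-; rewrite (Om_mul d) by apply succ_ne_0; apply even_add. }
  unfold cond at 1; destruct excluded_middle_informative as [H|H];
    (apply sum_ext; [def|unfold tw, even; def|]; intros x _;
     apply sum_ext; [def|unfold tw, even; def|]; intros y _;
     destruct (classic ((x + 1) * (y + 1) = m + 1)) as [E|E];
     [specialize (K x y E)|rewrite (ch_false E); ring];
     rewrite !tw_E; unfold cond; do 2 destruct excluded_middle_informative;
     try tauto; ring).
Qed.

Definition pairs := (D t1 * D t1)%type.
Definition padd (p q : pairs) : pairs := (sadd (fst p) (fst q), sadd (snd p) (snd q)).
Definition popp (p : pairs) : pairs := (snd p, fst p).
Definition pmul (p q : pairs) : pairs :=
  (sadd (conv (fst p) (fst q)) (conv (snd p) (snd q)),
   sadd (conv (fst p) (snd q)) (conv (snd p) (fst q))).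
Definition pphi (d : D t1) (p : pairs) : pairs :=
  (push d (tw d (fst p) (snd p)), push d (tw d (snd p) (fst p))).
Definition req (p q : pairs) : Prop := sadd (fst p) (snd q) = sadd (fst q) (snd p).
(** The leading coefficient, the one of least index, is positive. *)
Definition ppos (p : pairs) : Prop :=
  exists m, (forall k, k < m -> fst p ⋅ k = snd p ⋅ k) /\ snd p ⋅ m < fst p ⋅ m.

Lemma req_refl p : req p p.
Proof. reflexivity. Qed.

Lemma req_sym p q : req p q -> req q p.
Proof. unfold req; auto. Qed.

Lemma req_trans p q r : req p q -> req q r -> req p r.
Proof.
  unfold req; intros H K; apply sadd_cancel with (snd q).
  transitivity (sadd (sadd (fst p) (snd q)) (snd r)); [ring|].
  rewrite H; transitivity (sadd (sadd (fst q) (snd r)) (snd p)); [ring|].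
  rewrite K; ring.
Qed.

(** The quotient by [req] consists of the Dirichlet series with integral coefficients. *)
Definition series := quot req.
Definition ser (p : pairs) : series := cls req p.
Definition rep (x : series) : pairs := repr x.

Lemma ser_eq p q : ser p = ser q <-> req p q.
Proof. apply cls_eq; [apply req_refl|apply req_sym|apply req_trans]. Qed.

Lemma ser_rep x : ser (rep x) = x.
Proof. apply cls_repr. Qed.

Lemma rep_ser p : req (rep (ser p)) p.
Proof. apply ser_eq, ser_rep. Qed.

Definition r0 : series := ser (szero, szero).
Definition r1 : series := ser (mono 0, szero).
Definition radd (x y : series) : series := ser (padd (rep x) (rep y)).
Definition rmul (x y : series) : series := ser (pmul (rep x) (rep y)).
Definition ropp (x : series) : series := ser (popp (rep x)).
Definition rsub (x y : series) : series := radd x (ropp y).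
Definition phi (d : D t1) (x : series) : series := ser (pphi d (rep x)).
Definition rpos (x : series) : Prop := ppos (rep x).

Lemma req_point p q : req p q <-> forall n, fst p ⋅ n + snd q ⋅ n = fst q ⋅ n + snd p ⋅ n.
Proof.
  unfold req; split.
  - intros H n; rewrite <- !sadd_E, H; reflexivity.
  - intros H; apply am_ext; intros n; rewrite !sadd_E; apply H.
Qed.

Lemma radd_ser p q : radd (ser p) (ser q) = ser (padd p q).
Proof.
  apply ser_eq; pose proof (rep_ser p) as H; pose proof (rep_ser q) as K.
  unfold req, padd in *; cbn [fst snd] in *.
  transitivity (sadd (sadd (fst (rep (ser p))) (snd p)) (sadd (fst (rep (ser q))) (snd q)));
    [ring|]; rewrite H, K; ring.
Qed.

Lemma ropp_ser p : ropp (ser p) = ser (popp p).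
Proof.
  apply ser_eq; pose proof (rep_ser p) as H; unfold req, popp in *; cbn [fst snd].
  rewrite sadd_C, <- H; apply sadd_C.
Qed.

Lemma pmul_req p p' q : req p p' -> req (pmul p q) (pmul p' q).
Proof.
  unfold req, pmul; cbn [fst snd]; intros H.
  transitivity (sadd (conv (sadd (fst p) (snd p')) (fst q))
    (conv (sadd (fst p') (snd p)) (snd q))); [ring|].
  transitivity (sadd (conv (sadd (fst p') (snd p)) (fst q))
    (conv (sadd (fst p) (snd p')) (snd q))); [rewrite H; reflexivity|ring].
Qed.

Lemma pmul_C p q : pmul p q = pmul q p.
Proof. unfold pmul; f_equal; ring. Qed.

Lemma rmul_ser p q : rmul (ser p) (ser q) = ser (pmul p q).
Proof.
  apply ser_eq; apply req_trans with (pmul p (rep (ser q))).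
  - apply pmul_req, rep_ser.
  - rewrite !(pmul_C p); apply pmul_req, rep_ser.
Qed.

Lemma series_ring : ring_theory r0 r1 radd rmul rsub ropp eq.
Proof.
  split; intros; unfold rsub, r0, r1;
    repeat match goal with
      x : series |- _ => rewrite <- (ser_rep x); generalize (rep x); clear x; intros x end;
    rewrite ?ropp_ser, ?rmul_ser, ?radd_ser, ?rmul_ser, ?radd_ser; apply ser_eq;
    unfold req, padd, pmul, popp; cbn [fst snd]; ring.
Qed.
Add Ring R_ring : series_ring.

Lemma ppos_req p q : req p q -> ppos p -> ppos q.
Proof.
  rewrite req_point; intros H [m [E L]]; exists m; split.
  - intros k Lk; specialize (H k); rewrite (E k Lk) in H.
    symmetry; apply add_cancel_l with (snd p ⋅ k); rewrite H; ring.
  - apply lt_exists in L; destruct L as [j L]; apply lt_exists; exists j.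
    specialize (H m); apply add_cancel with (snd p ⋅ m); rewrite <- H, L; ring.
Qed.

Lemma rpos_ser p : rpos (ser p) <-> ppos p.
Proof. split; apply ppos_req; [|apply req_sym]; apply rep_ser. Qed.

Lemma series_ind (P : series -> Prop) : (forall p, P (ser p)) -> forall x, P x.
Proof. intros H x; rewrite <- ser_rep; apply H. Qed.

Lemma series_ind2 (P : series -> series -> Prop) :
  (forall p q, P (ser p) (ser q)) -> forall x y, P x y.
Proof. intros H x y; rewrite <- (ser_rep x), <- (ser_rep y); apply H. Qed.

Lemma rpos_0 : ~ rpos r0.
Proof.
  unfold r0; rewrite rpos_ser; intros [m [_ L]]; cbn in L; exact (lt_irrefl L).
Qed.

Lemma rpos_total x : x = r0 \/ rpos x \/ rpos (ropp x).
Proof.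
  revert x; apply series_ind; intros [f g]; rewrite ropp_ser, !rpos_ser; unfold r0.
  rewrite ser_eq, req_point; cbn [fst snd].
  destruct (classic (exists n, f ⋅ n <> g ⋅ n)) as [H|H].
  - right; destruct (least_spec (P := fun n => f ⋅ n <> g ⋅ n)) as [K L]; [def|exact H|].
    set (m := least _) in *.
    assert (E : forall k, k < m -> f ⋅ k = g ⋅ k) by (intros k Hk; apply NNPP, (L k Hk)).
    destruct (am_lt_total (f ⋅ m) (g ⋅ m)) as [l|[e|l]]; [right|tauto|left]; exists m;
      split; auto; intros k Hk; symmetry; apply E, Hk.
  - left; intros n; rewrite !szero_E.
    replace (f ⋅ n) with (g ⋅ n); [ring|]; apply NNPP; intros e; apply H; eauto.
Qed.

Lemma rpos_add x y : rpos x -> rpos y -> rpos (radd x y).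
Proof.
  revert x y; refine (series_ind2 _); intros p q.
  rewrite radd_ser, !rpos_ser; intros [m [E L]] [n [E' L']].
  assert (K : forall k, snd (padd p q) ⋅ k < fst (padd p q) ⋅ k <->
    snd p ⋅ k + snd q ⋅ k < fst p ⋅ k + fst q ⋅ k) by (intros; cbn; rewrite !sadd_E; tauto).
  assert (K' : forall k, fst p ⋅ k = snd p ⋅ k -> fst q ⋅ k = snd q ⋅ k ->
    fst (padd p q) ⋅ k = snd (padd p q) ⋅ k).
  { intros k e e'; cbn; rewrite !sadd_E, e, e'; reflexivity. }
  apply lt_exists in L; apply lt_exists in L'; destruct L as [i L], L' as [j L'].
  destruct (am_lt_total m n) as [l|[->|l]].
  - exists m; split.
    + intros k Hk; apply K'; [apply E, Hk|apply E', (lt_trans Hk l)].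
    + apply K; rewrite (E' m l), L; apply lt_exists; exists i; ring.
  - exists n; split; [intros k Hk; apply K'; auto|].
    apply K; rewrite L, L'; apply lt_exists; exists (i + j + 1); ring.
  - exists n; split.
    + intros k Hk; apply K'; [apply E, (lt_trans Hk l)|apply E', Hk].
    + apply K; rewrite (E n l), L'; apply lt_exists; exists j; ring.
Qed.

(** The leading monomial of a product is the product of the leading monomials, since
    multiplication of indices is strictly increasing in both arguments. *)
Lemma rpos_mul x y : rpos x -> rpos y -> rpos (rmul x y).
Proof.
  revert x y; refine (series_ind2 _); intros [a b] [c e].
  rewrite rmul_ser, !rpos_ser; unfold ppos, pmul; cbn [fst snd].
  intros [m [E L]] [n [E' L']]; apply lt_exists in L; apply lt_exists in L'.
  destruct L as [i L], L' as [j L'].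
  assert (HK : exists k, (m + 1) * (n + 1) = k + 1).
  { apply ne_0, mul_ne_0; apply succ_ne_0. }
  destruct HK as [k HK].
  (* Below the leading index [k] of the product, a pair of indices contributes to both parts
     alike, and at [k] only the pair of leading indices makes a difference. *)
  assert (lead : forall l x y : N, (x + 1) * (y + 1) = l + 1 -> le l k ->
    (a ⋅ x = b ⋅ x \/ c ⋅ y = e ⋅ y) \/ (x = m /\ y = n /\ l = k)).
  { intros l x y Exy Ll.
    destruct (classic (x < m)) as [|xm]; [left; left; auto|].
    destruct (classic (y < n)) as [|yn]; [left; right; auto|right].
    apply not_lt in xm; apply not_lt in yn; destruct xm as [s ->], yn as [t ->].
    destruct Ll as [u Ll].
    assert (Z : s * (n + 1) + t * (m + 1) + s * t + u = 0).
    { apply add_cancel_l with (k + 1); rewrite <- HK at 1.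
      transitivity ((m + s + 1) * (n + t + 1) + u); [ring|]; rewrite Exy, Ll; ring. }
    apply add_eq_0, add_eq_0 in Z; pose proof Z as Z'.
    apply add_eq_0, mul_eq_0 in Z; rewrite am_addC in Z'; apply add_eq_0, mul_eq_0 in Z'.
    destruct Z as [->|Z]; [|destruct (succ_ne_0 Z)].
    destruct Z' as [->|Z']; [|destruct (succ_ne_0 Z')].
    split; [ring|split; [ring|]]; apply add_cancel with 1; rewrite <- HK, <- Exy; ring. }
  exists k; split.
  - intros l Ll; rewrite !conv2_E; sum_terms x _.
    sum_terms y _.
    destruct (classic ((x + 1) * (y + 1) = l + 1)) as [Exy|Exy];
      [|rewrite (ch_false Exy); ring].
    destruct (lead l x y Exy (lt_le Ll)) as [[H|H]|[_ [_ ->]]].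
    + rewrite H; ring.
    + rewrite H; ring.
    + destruct (lt_irrefl Ll).
  - apply lt_exists; exists (i * j + i + j); rewrite !conv2_E.
    pose proof (product_index HK) as [Lm Ln].
    transitivity (sum (fun x => sum (fun y => ch ((x + 1) * (y + 1) = k + 1) *
        (a ⋅ x * e ⋅ y + b ⋅ x * c ⋅ y)) (k + 1)) (k + 1)
      + sum (fun x => ch (x = m) * sum (fun y => ch (y = n) * ((i + 1) * (j + 1))) (k + 1)) (k + 1)).
    + rewrite <- sum_add by def; sum_terms x _.
      rewrite <- sum_scale, <- sum_add by def; sum_terms y _.
      destruct (classic ((x + 1) * (y + 1) = k + 1)) as [Exy|Exy].
      * rewrite (ch_true Exy); destruct (lead k x y Exy (le_refl k)) as [H|[-> [-> _]]].
        -- destruct (classic (x = m)) as [->|xm];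
             [|rewrite (ch_false xm); destruct H as [H|H]; rewrite H; ring].
           destruct (classic (y = n)) as [->|yn];
             [|rewrite (ch_false yn); destruct H as [H|H]; rewrite H; ring].
           exfalso; destruct H as [H|H]; [rewrite H in L|rewrite H in L'].
           ++ apply (succ_ne_0 (x := i)), add_cancel_l with (b ⋅ m); rewrite L at 2; ring.
           ++ apply (succ_ne_0 (x := j)), add_cancel_l with (e ⋅ n); rewrite L' at 2; ring.
        -- rewrite !ch_true by reflexivity; rewrite L, L'; ring.
      * rewrite (ch_false Exy).
        destruct (classic (x = m)) as [->|xm]; [|rewrite (ch_false xm); ring].
        destruct (classic (y = n)) as [->|yn]; [|rewrite (ch_false yn); ring].
        tauto.
    + rewrite (am_addA (sum _ _)); f_equal.
      rewrite (sum_single (j := m)); [|def|exact Lm|].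
      * rewrite (sum_single (j := n)); [|def|exact Ln|].
        -- rewrite !ch_true by reflexivity; ring.
        -- intros y _ H; rewrite (ch_false H); ring.
      * intros x _ H; rewrite (ch_false H); ring.
Qed.

Lemma rpos_square x : x <> r0 -> rpos (rmul x x).
Proof.
  intros H; destruct (rpos_total x) as [E|[E|E]]; [tauto|apply rpos_mul; auto|].
  replace (rmul x x) with (rmul (ropp x) (ropp x)) by ring; apply rpos_mul; auto.
Qed.

Lemma rmul_eq_0 x y : rmul x y = r0 -> x <> r0 -> y = r0.
Proof.
  intros E x0; apply NNPP; intros y0; apply rpos_0.
  replace r0 with (rmul (rmul x x) (rmul y y)).
  - apply rpos_mul; apply rpos_square; assumption.
  - transitivity (rmul (rmul x y) (rmul x y)); [ring|]; rewrite E; ring.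
Qed.

Lemma rmul_cancel x y z : z <> r0 -> rmul z x = rmul z y -> x = y.
Proof.
  intros z0 E; assert (H : rsub x y = r0).
  { apply rmul_eq_0 with z; [|exact z0].
    transitivity (rsub (rmul z x) (rmul z y)); [ring|]; rewrite E; ring. }
  transitivity (radd (rsub x y) y); [ring|]; rewrite H; ring.
Qed.

Lemma rmul_ne_0 x y : x <> r0 -> y <> r0 -> rmul x y <> r0.
Proof. intros H K E; exact (K (rmul_eq_0 E H)). Qed.

Lemma r1_ne_0 : r1 <> r0.
Proof.
  unfold r1, r0; rewrite ser_eq, req_point; intros H; specialize (H 0); cbn [fst snd] in H.
  rewrite mono_E, szero_E, ch_true in H by reflexivity; apply (one_ne_0).
  rewrite <- (am_add0 1), H; ring.
Qed.

Lemma pphi_req d p q : req (pphi d p) (pphi d q) <-> req p q.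
Proof.
  unfold req, pphi; cbn [fst snd]; rewrite <- !push_sadd; split.
  - intros H; apply push_inj in H; apply am_ext; intros n.
    apply (f_equal (fun f => f ⋅ n)) in H; rewrite !sadd_E, !tw_E in *; unfold cond in H.
    destruct excluded_middle_informative; [exact H|].
    rewrite am_addC, <- H; apply am_addC.
  - intros H; f_equal; apply am_ext; intros n.
    apply (f_equal (fun f => f ⋅ n)) in H; rewrite !sadd_E, !tw_E in *; unfold cond.
    destruct excluded_middle_informative; [exact H|].
    rewrite am_addC, <- H; apply am_addC.
Qed.

Lemma phi_ser d p : phi d (ser p) = ser (pphi d p).
Proof. apply ser_eq, pphi_req, rep_ser. Qed.

Lemma phi_inj d x y : phi d x = phi d y -> x = y.
Proof.
  revert x y; refine (series_ind2 _); intros p q; rewrite !phi_ser, !ser_eq; apply pphi_req.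
Qed.

Lemma phi_mul d x y : phi d (rmul x y) = rmul (phi d x) (phi d y).
Proof.
  revert x y; refine (series_ind2 _); intros [a b] [c e].
  rewrite !rmul_ser, !phi_ser, rmul_ser; f_equal.
  unfold pphi, pmul; cbn [fst snd]; rewrite !tw_conv, !push_sadd, !push_conv; reflexivity.
Qed.

Lemma tw_sadd (d a b c e : D t1) : tw d (sadd a c) (sadd b e) = sadd (tw d a b) (tw d c e).
Proof.
  apply am_ext; intros m; rewrite sadd_E, !tw_E; unfold cond.
  destruct excluded_middle_informative; apply sadd_E.
Qed.

Lemma phi_add d x y : phi d (radd x y) = radd (phi d x) (phi d y).
Proof.
  revert x y; refine (series_ind2 _); intros [a b] [c e].
  rewrite !radd_ser, !phi_ser, radd_ser; f_equal.
  unfold pphi, padd; cbn [fst snd]; rewrite !tw_sadd, !push_sadd; reflexivity.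
Qed.

Lemma phi_opp d x : phi d (ropp x) = ropp (phi d x).
Proof.
  revert x; apply series_ind; intros p; rewrite ropp_ser, !phi_ser, ropp_ser; reflexivity.
Qed.

Lemma phi_0 d : phi d r0 = r0.
Proof.
  transitivity (radd (phi d (radd r0 r0)) (ropp (phi d r0))).
  - rewrite phi_add; ring.
  - replace (radd r0 r0) with r0 by ring; ring.
Qed.

Lemma phi_ne_0 d x : x <> r0 -> phi d x <> r0.
Proof. intros H E; apply H, (phi_inj (d := d)); rewrite E, phi_0; reflexivity. Qed.

Lemma phi_1 d : phi d r1 = r1.
Proof.
  apply rmul_cancel with (phi d r1); [apply phi_ne_0, r1_ne_0|].
  rewrite <- phi_mul; replace (rmul r1 r1) with r1 by ring; ring.
Qed.

Lemma phi_glue d d1 d2 x : glue d d1 d2 -> phi d1 (phi d x) = phi d2 x.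
Proof.
  intros G; revert x; apply series_ind; intros [a b]; rewrite !phi_ser; f_equal.
  assert (K : forall f g, push d1 (tw d1 (push d (tw d f g)) (push d (tw d g f)))
    = push d2 (tw d2 f g)); [|unfold pphi; cbn [fst snd]; rewrite !K; reflexivity].
  intros f g; rewrite <- (push_glue _ G); f_equal; apply am_ext; intros m; rewrite tw_E.
  destruct (classic (exists n, pis d (n + 1) = m + 1)) as [[n Hn]|H].
  - rewrite !(push_at _ Hn), !tw_E, (Om_glue G (@succ_ne_0 n)), Hn.
    unfold cond; pose proof (even_add (Om d (n + 1)) (Om d1 (m + 1))).
    do 3 destruct excluded_middle_informative; tauto.
  - rewrite !push_out by (intros n e; eauto).
    unfold cond; destruct excluded_middle_informative; reflexivity.
Qed.

Lemma phi_id d x : (forall p, prime p -> d ⋅ p = 0) -> phi d x = x.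
Proof.
  intros H; apply (phi_inj (d := d)), phi_glue; intros p Hp; left.
  rewrite (H p Hp); auto.
Qed.

Definition gen (i : N) : series := ser (mono i, szero).

Lemma gen_ne_0 i : gen i <> r0.
Proof.
  unfold gen, r0; rewrite ser_eq, req_point; intros H; specialize (H i); cbn [fst snd] in H.
  rewrite mono_E, szero_E, ch_true in H by reflexivity; apply (one_ne_0).
  rewrite <- (am_add0 1), H; ring.
Qed.

Lemma rmul_gen i j k : (i + 1) * (j + 1) = k + 1 -> rmul (gen i) (gen j) = gen k.
Proof.
  intros E; unfold gen; rewrite rmul_ser; apply ser_eq; unfold req, pmul; cbn [fst snd].
  rewrite (conv_mono E); ring.
Qed.

(** What makes the generators squares up to sign after the state has grown. *)
Lemma phi_gen d i : prime (i + 1) -> d ⋅ (i + 1) <> 0 ->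
  phi d (gen i) = (if excluded_middle_informative (d ⋅ (i + 1) = two)
    then ropp (rmul (gen i) (gen i)) else rmul (gen i) (gen i)).
Proof.
  intros Hp H.
  destruct (proj1 (ne_0 ((i + 1) * (i + 1)))) as [k Hk].
  { apply mul_ne_0; apply succ_ne_0. }
  rewrite (rmul_gen Hk).
  assert (P : push d (mono i) = mono k).
  { apply push_mono; rewrite (pis_prime d Hp), cond_false by exact H; exact Hk. }
  assert (Z : push d szero = szero).
  { apply sadd_cancel with (push d szero); rewrite <- push_sadd, !sadd_0; reflexivity. }
  assert (Om_i : forall f, (forall n, n <> i -> f ⋅ n = szero ⋅ n) ->
     tw d f szero = (if excluded_middle_informative (d ⋅ (i + 1) = two) then szero else f) /\
     tw d szero f = (if excluded_middle_informative (d ⋅ (i + 1) = two) then f else szero)).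
  { intros f Hf.
    assert (O : even (Om d (i + 1)) <-> d ⋅ (i + 1) <> two).
    { rewrite (Om_prime d Hp); destruct (classic (d ⋅ (i + 1) = two)) as [e|e].
      - rewrite (ch_true e).
        assert (H1 : ~ even (oneM M)); [|tauto].
        replace (oneM M) with (0 + oneM M) by ring; rewrite even_S; intros H0.
        apply H0; exists 0; ring.
      - rewrite (ch_false e); assert (even (zeroM M)) by (exists 0; ring); tauto. }
    destruct excluded_middle_informative as [e|e]; split; apply am_ext; intros n;
      rewrite tw_E; (destruct (classic (n = i)) as [->|ni];
        [|unfold cond; destruct excluded_middle_informative; rewrite ?(Hf n ni); reflexivity]).
    - apply cond_false; tauto.
    - apply cond_false; tauto.
    - apply cond_true; tauto.
    - apply cond_true; tauto. }
  destruct (Om_i (mono i)) as [T1 T2].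
  { intros n H'; rewrite mono_E, szero_E; apply ch_false, H'. }
  unfold gen; rewrite phi_ser; unfold pphi; cbn [fst snd]; rewrite T1, T2.
  destruct excluded_middle_informative; rewrite ?ropp_ser, P, Z; reflexivity.
Qed.

(** * Codes of fractions *)

Definition dcons (f g : D t1) : D t1 := fam ⋅ lam (fun i => cond (i = 0) f g).
Definition car (h : D t1) : D t1 := dec ⋅ h ⋅ 0.
Definition cdr (h : D t1) : D t1 := dec ⋅ h ⋅ 1.

Lemma Def_dcons : DefOp2 dcons.
Proof. intros; apply (Def_comp2 (F := dcons)); auto; unfold dcons; def. Qed.

Lemma Def_car : DefOp1 car.
Proof. intros; unfold car; def. Qed.

Lemma Def_cdr : DefOp1 cdr.
Proof. intros; unfold cdr; def. Qed.

Lemma car_dcons f g : car (dcons f g) = f.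
Proof.
  unfold car, dcons; rewrite dec_fam, (beta (F := fun i => cond (i = 0) f g)) by def.
  apply cond_true; reflexivity.
Qed.

Lemma cdr_dcons f g : cdr (dcons f g) = g.
Proof.
  unfold cdr, dcons; rewrite dec_fam, (beta (F := fun i => cond (i = 0) f g)) by def.
  apply cond_false, one_ne_0.
Qed.

(** A code consists of a numerator, a denominator, a claimed state and a family of
    witnesses for that state. *)
Definition num (h : D t1) : pairs := (car h, car (cdr h)).
Definition den (h : D t1) : pairs := (car (cdr (cdr h)), car (cdr (cdr (cdr h)))).
Definition sg (h : D t1) : D t1 := car (cdr (cdr (cdr (cdr h)))).
Definition wt (h : D t1) : D t1 := cdr (cdr (cdr (cdr (cdr h)))).
Definition mk (n d : pairs) (s w : D t1) : D t1 :=
  dcons (fst n) (dcons (snd n) (dcons (fst d) (dcons (snd d) (dcons s w)))).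

Lemma num_mk n d s w : num (mk n d s w) = n.
Proof. unfold num, mk; rewrite cdr_dcons, !car_dcons; destruct n; reflexivity. Qed.

Lemma den_mk n d s w : den (mk n d s w) = d.
Proof. unfold den, mk; rewrite !cdr_dcons, !car_dcons; destruct d; reflexivity. Qed.

Lemma sg_mk n d s w : sg (mk n d s w) = s.
Proof. unfold sg, mk; rewrite !cdr_dcons, !car_dcons; reflexivity. Qed.

Lemma wt_mk n d s w : wt (mk n d s w) = w.
Proof. unfold wt, mk; rewrite !cdr_dcons; reflexivity. Qed.

Definition Defp E (F : pts M E -> pairs) : Prop :=
  Def E (fun p => fst (F p)) /\ Def E (fun p => snd (F p)).

Lemma Def_mk E (n d : pts M E -> pairs) (s w : pts M E -> D t1) :
  Defp n -> Defp d -> Def E s -> Def E w -> Def E (fun p => mk (n p) (d p) (s p) (w p)).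
Proof. intros [H1 H2] [H3 H4] H5 H6; unfold mk; repeat apply Def_dcons; assumption. Qed.

Lemma Defp_num E (F : pts M E -> D t1) : Def E F -> Defp (fun p => num (F p)).
Proof. split; cbn; [apply Def_car|apply Def_car, Def_cdr]; assumption. Qed.

Lemma Defp_den E (F : pts M E -> D t1) : Def E F -> Defp (fun p => den (F p)).
Proof. split; cbn; apply Def_car; repeat apply Def_cdr; assumption. Qed.

Lemma Def_sg : DefOp1 sg.
Proof. intros; apply Def_car; repeat apply Def_cdr; assumption. Qed.

Lemma Def_wt : DefOp1 wt.
Proof. intros; unfold wt; repeat apply Def_cdr; assumption. Qed.

Lemma Defp_padd E (F G : pts M E -> pairs) : Defp F -> Defp G -> Defp (fun p => padd (F p) (G p)).
Proof. intros [H1 H2] [H3 H4]; split; cbn; apply Def_sadd; assumption. Qed.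

Lemma Defp_pmul E (F G : pts M E -> pairs) : Defp F -> Defp G -> Defp (fun p => pmul (F p) (G p)).
Proof.
  intros [H1 H2] [H3 H4]; split; cbn; apply Def_sadd; apply Def_conv; assumption.
Qed.

Lemma Defp_popp E (F : pts M E -> pairs) : Defp F -> Defp (fun p => popp (F p)).
Proof. intros [H1 H2]; split; assumption. Qed.

Lemma Defp_pphi E (d : pts M E -> D t1) (F : pts M E -> pairs) :
  Def E d -> Defp F -> Defp (fun p => pphi (d p) (F p)).
Proof.
  intros Hd [H1 H2]; split; cbn; (apply Def_push; [exact Hd|]); apply Def_tw; assumption.
Qed.

Lemma Defp_const E (c : pairs) : Defp (E := E) (fun _ => c).
Proof. split; apply Def_const. Qed.

Lemma Def_req E (F G : pts M E -> pairs) : Defp F -> Defp G ->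
  Def E (fun p => ch (req (F p) (G p))).
Proof.
  intros [H1 H2] [H3 H4]; unfold req; apply Def_eq1; apply Def_sadd; assumption.
Qed.

Lemma Def_ppos E (F : pts M E -> pairs) : Defp F -> Def E (fun p => ch (ppos (F p))).
Proof.
  intros [H1 H2].
  apply (Def_comp2 (F := fun f g => ch (ppos (f, g)))) with (G := fun p => fst (F p))
    (H := fun p => snd (F p)); auto.
  unfold ppos; cbn [fst snd]; def.
Qed.

(** * States *)

(** [join] prefers the first state; on the states that occur, two nonzero values agree
    ([cert_compat]). *)
Definition join (s s' : D t1) : D t1 := lam (fun q => cond (s ⋅ q = 0) (s' ⋅ q) (s ⋅ q)).
Definition diff (s s' : D t1) : D t1 := lam (fun q => cond (s ⋅ q = 0) (s' ⋅ q) 0).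
Definition below (s s' : D t1) : Prop := forall q, s ⋅ q <> 0 -> s' ⋅ q = s ⋅ q.
(** The transition from the copy of the field for the state [s] to that for [s']. *)
Definition tr (s s' : D t1) (x : series) : series := phi (diff s s') x.

Lemma Def_join : DefOp2 join.
Proof. intros; apply (Def_comp2 (F := join)); auto; unfold join; def. Qed.

Lemma Def_diff : DefOp2 diff.
Proof. intros; apply (Def_comp2 (F := diff)); auto; unfold diff; def. Qed.

Lemma join_E s s' q : join s s' ⋅ q = cond (s ⋅ q = 0) (s' ⋅ q) (s ⋅ q).
Proof. unfold join; rewrite beta by def; reflexivity. Qed.

Lemma diff_E s s' q : diff s s' ⋅ q = cond (s ⋅ q = 0) (s' ⋅ q) 0.
Proof. unfold diff; rewrite beta by def; reflexivity. Qed.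

Lemma below_refl s : below s s.
Proof. intros q _; reflexivity. Qed.

Lemma below_trans s s' s'' : below s s' -> below s' s'' -> below s s''.
Proof. intros H K q E; rewrite <- (H q E); apply K; rewrite (H q E); exact E. Qed.

Lemma below_join_l s s' : below s (join s s').
Proof. intros q E; rewrite join_E; apply cond_false, E. Qed.

Lemma join_below s s' T : below s T -> below s' T -> below (join s s') T.
Proof.
  intros H K q; rewrite join_E; unfold cond; destruct excluded_middle_informative; auto.
Qed.

Lemma tr_trans s s' s'' x : below s s' -> below s' s'' -> tr s' s'' (tr s s' x) = tr s s'' x.
Proof.
  intros H K; unfold tr; apply phi_glue; intros p _; rewrite !diff_E.
  destruct (classic (s ⋅ p = 0)) as [E|E].
  - rewrite !(cond_true _ _ E); destruct (classic (s' ⋅ p = 0)) as [E'|E'].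
    + rewrite (cond_true _ _ E'); auto.
    + rewrite (cond_false _ _ E'), (K p E'); auto.
  - rewrite !(cond_false _ _ E), cond_false by (rewrite (H p E); exact E); auto.
Qed.

Lemma tr_refl s x : tr s s x = x.
Proof.
  unfold tr; apply phi_id; intros p _; rewrite diff_E; unfold cond.
  destruct excluded_middle_informative; auto.
Qed.

(** * The field *)

Section Field.
Variables Y Z : D t2.
Hypothesis disjoint : forall f g, Y ⋅ f <> Z ⋅ g.

(** A claimed state [s] counts only where the family [w] proves it: the value [1] at a prime
    [prm (Y f)], and the value [two] at a prime [prm (Z g)]. *)
Definition cert (s w : D t1) : D t1 := lam (fun q =>
  cond (s ⋅ q = 1 /\ prm (Y ⋅ (dec ⋅ w ⋅ q)) = q) 1
    (cond (s ⋅ q = two /\ prm (Z ⋅ (dec ⋅ w ⋅ q)) = q) two 0)).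
Definition st (h : D t1) : D t1 := cert (sg h) (wt h).
Definition jw (h h' : D t1) : D t1 :=
  fam ⋅ lam (fun q => cond (st h ⋅ q = 0) (dec ⋅ wt h' ⋅ q) (dec ⋅ wt h ⋅ q)).

Lemma Def_cert : DefOp2 cert.
Proof. intros; apply (Def_comp2 (F := cert)); auto; unfold cert, two; def. Qed.

Lemma Def_st : DefOp1 st.
Proof. intros; apply Def_cert; [apply Def_sg|apply Def_wt]; assumption. Qed.

Lemma Def_jw : DefOp2 jw.
Proof.
  intros; apply (Def_comp2 (F := jw)); auto; unfold jw; def.
  all: first [apply Def_st | apply Def_wt]; def.
Qed.

Lemma cert_E s w q : cert s w ⋅ q =
  cond (s ⋅ q = 1 /\ prm (Y ⋅ (dec ⋅ w ⋅ q)) = q) 1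
    (cond (s ⋅ q = two /\ prm (Z ⋅ (dec ⋅ w ⋅ q)) = q) two 0).
Proof. unfold cert; rewrite beta by (unfold two; def); reflexivity. Qed.

Lemma two_ne_1 : (two : N) <> 1.
Proof.
  unfold two; intros E; apply (one_ne_0), add_cancel with 1.
  rewrite E; rewrite (am_addC 0), am_add0; reflexivity.
Qed.

Lemma cert_cases s w q : cert s w ⋅ q = 0 \/
  (cert s w ⋅ q = 1 /\ prm (Y ⋅ (dec ⋅ w ⋅ q)) = q) \/
  (cert s w ⋅ q = two /\ prm (Z ⋅ (dec ⋅ w ⋅ q)) = q).
Proof.
  rewrite cert_E; unfold cond; repeat destruct excluded_middle_informative; tauto.
Qed.

(** Nonzero values agree because the ranges are disjoint and [prm] is injective. *)
Lemma cert_compat s w s' w' q : cert s w ⋅ q <> 0 -> cert s' w' ⋅ q <> 0 ->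
  cert s w ⋅ q = cert s' w' ⋅ q.
Proof.
  intros H H'.
  destruct (cert_cases s w q) as [E|[[E P]|[E P]]]; [tauto| |];
    destruct (cert_cases s' w' q) as [E'|[[E' P']|[E' P']]]; try tauto;
    rewrite E, E'; try reflexivity; exfalso; rewrite <- P' in P at 2;
    apply prm_inj in P; [|symmetry in P]; exact (disjoint P).
Qed.

Lemma below_join_r h h' : below (st h') (join (st h) (st h')).
Proof.
  intros q E; rewrite join_E; unfold cond; destruct excluded_middle_informative as [e|e]; auto.
  apply cert_compat; assumption.
Qed.

Lemma cert_self s w :
  (forall q, s ⋅ q = 0 \/ (s ⋅ q = 1 /\ prm (Y ⋅ (dec ⋅ w ⋅ q)) = q) \/
     (s ⋅ q = two /\ prm (Z ⋅ (dec ⋅ w ⋅ q)) = q)) -> cert s w = s.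
Proof.
  intros H; apply am_ext; intros q; rewrite cert_E.
  destruct (H q) as [E|[[E P]|[E P]]]; rewrite E.
  - rewrite !cond_false; [reflexivity| |]; intros [e _].
    + apply two_ne_0; auto.
    + apply one_ne_0; auto.
  - apply cond_true; auto.
  - rewrite cond_false, cond_true; auto; intros [e _]; exact (two_ne_1 e).
Qed.

Lemma cert_join h h' : cert (join (st h) (st h')) (jw h h') = join (st h) (st h').
Proof.
  apply cert_self; intros q; unfold jw; rewrite dec_fam, join_E.
  rewrite (beta (F := fun q => cond (st h ⋅ q = 0) (dec ⋅ wt h' ⋅ q) (dec ⋅ wt h ⋅ q))).
  2:{ def; first [apply Def_st | apply Def_wt]; def. }
  destruct (classic (st h ⋅ q = 0)) as [E|E].
  - rewrite !(cond_true _ _ E); apply cert_cases.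
  - rewrite !(cond_false _ _ E); apply cert_cases.
Qed.

(** Numerator and denominator of [h] in the copy of the field for the state [T]: [pnum] and
    [pden] as pairs of internal functions, [vn] and [vd] as elements of the ring. *)
Definition pnum (T h : D t1) : pairs := pphi (diff (st h) T) (num h).
Definition pden (T h : D t1) : pairs := pphi (diff (st h) T) (den h).
Definition vn (T h : D t1) : series := tr (st h) T (ser (num h)).
Definition vd (T h : D t1) : series := tr (st h) T (ser (den h)).

Lemma ser_pnum T h : ser (pnum T h) = vn T h.
Proof. unfold vn, vd, tr, pnum, pden; rewrite phi_ser; reflexivity. Qed.

Lemma ser_pden T h : ser (pden T h) = vd T h.
Proof. unfold vn, vd, tr, pnum, pden; rewrite phi_ser; reflexivity. Qed.

Definition inK (h : D t1) : Prop := ~ req (den h) (szero, szero).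
Definition eqC (h h' : D t1) : Prop :=
  let T := join (st h) (st h') in
  req (pmul (pnum T h) (pden T h')) (pmul (pnum T h') (pden T h)).
Definition zeroK : D t1 := mk (szero, szero) (mono 0, szero) szero szero.
Definition oneK : D t1 := mk (mono 0, szero) (mono 0, szero) szero szero.
Definition oppC (h : D t1) : D t1 := mk (popp (num h)) (den h) (sg h) (wt h).
Definition invK (h : D t1) : D t1 := mk (den h) (num h) (sg h) (wt h).
Definition addC (h h' : D t1) : D t1 :=
  let T := join (st h) (st h') in
  mk (padd (pmul (pnum T h) (pden T h')) (pmul (pnum T h') (pden T h)))
    (pmul (pden T h) (pden T h')) T (jw h h').
Definition mulC (h h' : D t1) : D t1 :=
  let T := join (st h) (st h') in
  mk (pmul (pnum T h) (pnum T h')) (pmul (pden T h) (pden T h')) T (jw h h').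

Lemma Defp_pnum E (T F : pts M E -> D t1) :
  Def E T -> Def E F -> Defp (fun p => pnum (T p) (F p)).
Proof. intros; apply Defp_pphi; [apply Def_diff; auto using Def_st|auto using Defp_num]. Qed.

Lemma Defp_pden E (T F : pts M E -> D t1) :
  Def E T -> Def E F -> Defp (fun p => pden (T p) (F p)).
Proof. intros; apply Defp_pphi; [apply Def_diff; auto using Def_st|auto using Defp_den]. Qed.

Lemma Def_inK E (F : pts M E -> D t1) : Def E F -> Def E (fun p => ch (inK (F p))).
Proof. intros; apply Def_not, Def_req; auto using Defp_den, Defp_const. Qed.

Lemma Def_eqK E (F G : pts M E -> D t1) :
  Def E F -> Def E G -> Def E (fun p => ch (eqC (F p) (G p))).
Proof.
  intros; apply Def_req; auto 6 using Defp_pmul, Defp_pnum, Defp_pden, Def_join, Def_st.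
Qed.

Lemma Def_oppK : DefOp1 oppC.
Proof. intros; apply Def_mk; auto using Defp_popp, Defp_num, Defp_den, Def_sg, Def_wt. Qed.

Lemma Def_addK : DefOp2 addC.
Proof.
  intros; apply Def_mk;
    auto 7 using Defp_padd, Defp_pmul, Defp_pnum, Defp_pden, Def_join, Def_st, Def_jw.
Qed.

Lemma Def_mulK : DefOp2 mulC.
Proof.
  intros; apply Def_mk;
    auto 7 using Defp_pmul, Defp_pnum, Defp_pden, Def_join, Def_st, Def_jw.
Qed.

Lemma st_mk n d s w : st (mk n d s w) = cert s w.
Proof. unfold st; rewrite sg_mk, wt_mk; reflexivity. Qed.

Lemma st_add h h' : st (addC h h') = join (st h) (st h').
Proof. unfold addC; cbv zeta; rewrite st_mk; apply cert_join. Qed.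

Lemma st_mul h h' : st (mulC h h') = join (st h) (st h').
Proof. unfold mulC; cbv zeta; rewrite st_mk; apply cert_join. Qed.

Lemma st_opp h : st (oppC h) = st h.
Proof. apply st_mk. Qed.

Lemma st_inv h : st (invK h) = st h.
Proof. apply st_mk. Qed.

Lemma cert_0 w : cert szero w = szero.
Proof. apply cert_self; intros q; left; apply szero_E. Qed.

Lemma below_0 T : below szero T.
Proof. intros q H; destruct H; apply szero_E. Qed.

Lemma st_zero : st zeroK = szero.
Proof. unfold zeroK; rewrite st_mk; apply cert_0. Qed.

Lemma st_one : st oneK = szero.
Proof. unfold oneK; rewrite st_mk; apply cert_0. Qed.

Lemma below_zero T : below (st zeroK) T.
Proof. rewrite st_zero; apply below_0. Qed.

Lemma below_one T : below (st oneK) T.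
Proof. rewrite st_one; apply below_0. Qed.

Lemma below_opp T h : below (st h) T -> below (st (oppC h)) T.
Proof. rewrite st_opp; auto. Qed.

Lemma below_inv T h : below (st h) T -> below (st (invK h)) T.
Proof. rewrite st_inv; auto. Qed.

Lemma below_add T h h' : below (st h) T -> below (st h') T -> below (st (addC h h')) T.
Proof. rewrite st_add; apply join_below. Qed.

Lemma below_mul T h h' : below (st h) T -> below (st h') T -> below (st (mulC h h')) T.
Proof. rewrite st_mul; apply join_below. Qed.

Lemma tr_add s s' x y : tr s s' (radd x y) = radd (tr s s' x) (tr s s' y).
Proof. unfold tr; apply phi_add. Qed.

Lemma tr_mul s s' x y : tr s s' (rmul x y) = rmul (tr s s' x) (tr s s' y).
Proof. unfold tr; apply phi_mul. Qed.

Section Values.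
Variables (T h h' : D t1).
Hypothesis (B : below (st h) T) (B' : below (st h') T).
Let J := join (st h) (st h').

Lemma tr_vn_l : tr J T (vn J h) = vn T h.
Proof. unfold vn, vd; apply tr_trans; [apply below_join_l|apply join_below; assumption]. Qed.
Lemma tr_vd_l : tr J T (vd J h) = vd T h.
Proof. unfold vn, vd; apply tr_trans; [apply below_join_l|apply join_below; assumption]. Qed.
Lemma tr_vn_r : tr J T (vn J h') = vn T h'.
Proof. unfold vn, vd; apply tr_trans; [apply below_join_r|apply join_below; assumption]. Qed.
Lemma tr_vd_r : tr J T (vd J h') = vd T h'.
Proof. unfold vn, vd; apply tr_trans; [apply below_join_r|apply join_below; assumption]. Qed.

Lemma vn_add : vn T (addC h h')
  = radd (rmul (vn T h) (vd T h')) (rmul (vn T h') (vd T h)).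
Proof.
  unfold vn at 1; rewrite st_add; unfold addC; cbv zeta; rewrite num_mk.
  rewrite <- radd_ser, <- !rmul_ser, !ser_pnum, !ser_pden, tr_add, !tr_mul.
  fold J; rewrite tr_vn_l, tr_vd_l, tr_vn_r, tr_vd_r; reflexivity.
Qed.

Lemma vd_add : vd T (addC h h') = rmul (vd T h) (vd T h').
Proof.
  unfold vd at 1; rewrite st_add; unfold addC; cbv zeta; rewrite den_mk.
  rewrite <- rmul_ser, !ser_pden, tr_mul; fold J; rewrite tr_vd_l, tr_vd_r; reflexivity.
Qed.

Lemma vn_mul : vn T (mulC h h') = rmul (vn T h) (vn T h').
Proof.
  unfold vn at 1; rewrite st_mul; unfold mulC; cbv zeta; rewrite num_mk.
  rewrite <- rmul_ser, !ser_pnum, tr_mul; fold J; rewrite tr_vn_l, tr_vn_r; reflexivity.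
Qed.

Lemma vd_mul : vd T (mulC h h') = rmul (vd T h) (vd T h').
Proof.
  unfold vd at 1; rewrite st_mul; unfold mulC; cbv zeta; rewrite den_mk.
  rewrite <- rmul_ser, !ser_pden, tr_mul; fold J; rewrite tr_vd_l, tr_vd_r; reflexivity.
Qed.

(** Equality can be tested in any common extension of the two states, because the
    transition maps are injective. *)
Lemma eqK_iff : eqC h h' <-> rmul (vn T h) (vd T h') = rmul (vn T h') (vd T h).
Proof.
  unfold eqC; cbv zeta; rewrite <- ser_eq, <- !rmul_ser, !ser_pnum, !ser_pden; fold J.
  rewrite <- tr_vn_l, <- tr_vd_l, <- tr_vn_r, <- tr_vd_r, <- !tr_mul; split.
  - intros ->; reflexivity.
  - unfold tr; apply phi_inj.
Qed.
End Values.

Lemma vn_opp T h : vn T (oppC h) = ropp (vn T h).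
Proof.
  unfold vn, tr; rewrite st_opp; unfold oppC; rewrite num_mk, <- ropp_ser; apply phi_opp.
Qed.

Lemma vd_opp T h : vd T (oppC h) = vd T h.
Proof. unfold vd; rewrite st_opp; unfold oppC; rewrite den_mk; reflexivity. Qed.

Lemma vn_inv T h : vn T (invK h) = vd T h.
Proof. unfold vn, vd; rewrite st_inv; unfold invK; rewrite num_mk; reflexivity. Qed.

Lemma vd_inv T h : vd T (invK h) = vn T h.
Proof. unfold vn, vd; rewrite st_inv; unfold invK; rewrite den_mk; reflexivity. Qed.

Lemma vn_zero T : vn T zeroK = r0.
Proof. unfold vn, tr, zeroK at 2; rewrite num_mk; apply phi_0. Qed.

Lemma vd_zero T : vd T zeroK = r1.
Proof. unfold vd, tr, zeroK at 2; rewrite den_mk; apply phi_1. Qed.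

Lemma vn_one T : vn T oneK = r1.
Proof. unfold vn, tr, oneK at 2; rewrite num_mk; apply phi_1. Qed.

Lemma vd_one T : vd T oneK = r1.
Proof. unfold vd, tr, oneK at 2; rewrite den_mk; apply phi_1. Qed.

Lemma inK_iff T h : inK h <-> vd T h <> r0.
Proof.
  unfold inK; rewrite <- ser_eq; unfold vd, tr; split; intros H.
  - apply phi_ne_0, H.
  - intros E; apply H; rewrite E; apply phi_0.
Qed.

Lemma inK_vd T h : inK h -> vd T h <> r0.
Proof. apply inK_iff. Qed.

Lemma vn_mk T n d s w : vn T (mk n d s w) = tr (cert s w) T (ser n).
Proof. unfold vn; rewrite st_mk, num_mk; reflexivity. Qed.

Lemma vd_mk T n d s w : vd T (mk n d s w) = tr (cert s w) T (ser d).
Proof. unfold vd; rewrite st_mk, den_mk; reflexivity. Qed.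

Lemma tr_one s s' : tr s s' (ser (mono 0, szero)) = r1.
Proof. unfold tr; apply phi_1. Qed.

(* Conversion would otherwise unfold codes and series. *)
Local Opaque addC mulC oppC invK zeroK oneK vn vd eqC inK radd rmul ropp rsub r0 r1.

Lemma inK_add h h' : inK h -> inK h' -> inK (addC h h').
Proof.
  set (T := join (st h) (st h')); rewrite !(inK_iff T), vd_add.
  - apply rmul_ne_0.
  - apply below_join_l.
  - apply below_join_r.
Qed.

Lemma inK_mul h h' : inK h -> inK h' -> inK (mulC h h').
Proof.
  set (T := join (st h) (st h')); rewrite !(inK_iff T), vd_mul.
  - apply rmul_ne_0.
  - apply below_join_l.
  - apply below_join_r.
Qed.

Lemma inK_opp h : inK h -> inK (oppC h).
Proof. rewrite !(inK_iff szero), vd_opp; auto. Qed.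

Lemma inK_zero : inK zeroK.
Proof. rewrite (inK_iff szero), vd_zero; apply r1_ne_0. Qed.

Lemma inK_one : inK oneK.
Proof. rewrite (inK_iff szero), vd_one; apply r1_ne_0. Qed.

Lemma eqK_zero_iff T h : below (st h) T -> (eqC h zeroK <-> vn T h = r0).
Proof.
  intros B; rewrite (eqK_iff B (below_zero T)), vn_zero, vd_zero; split; intros E.
  - transitivity (rmul (vn T h) r1); [ring|]; rewrite E; ring.
  - rewrite E; ring.
Qed.

Lemma upper2 a b : exists T, below (st a) T /\ below (st b) T.
Proof.
  exists (join (st a) (st b)); split; [apply below_join_l|apply below_join_r].
Qed.

Lemma upper3 a b c : exists T, below (st a) T /\ below (st b) T /\ below (st c) T.
Proof.
  exists (st (addC (addC a b) c)); rewrite !st_add; repeat split.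
  - eapply below_trans; apply below_join_l.
  - apply below_trans with (join (st a) (st b)); [apply below_join_r|apply below_join_l].
  - rewrite <- st_add; apply below_join_r.
Qed.

(** The fraction [n / d] is the value of the code [h] in the state [T]. *)
Definition value (T h : D t1) (n d : series) : Prop :=
  below (st h) T /\ vn T h = n /\ vd T h = d.

Lemma value_self T h : below (st h) T -> value T h (vn T h) (vd T h).
Proof. split; [assumption|split; reflexivity]. Qed.

Lemma value_add T a b n d n' d' : value T a n d -> value T b n' d' ->
  value T (addC a b) (radd (rmul n d') (rmul n' d)) (rmul d d').
Proof.
  intros [B [<- <-]] [B' [<- <-]]; split; [|split];
    [apply below_add|apply vn_add|apply vd_add]; assumption.
Qed.

Lemma value_mul T a b n d n' d' : value T a n d -> value T b n' d' ->
  value T (mulC a b) (rmul n n') (rmul d d').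
Proof.
  intros [B [<- <-]] [B' [<- <-]]; split; [|split];
    [apply below_mul|apply vn_mul|apply vd_mul]; assumption.
Qed.

Lemma value_opp T a n d : value T a n d -> value T (oppC a) (ropp n) d.
Proof.
  intros [B [<- <-]]; split; [|split]; [apply below_opp, B|apply vn_opp|apply vd_opp].
Qed.

Lemma value_inv T a n d : value T a n d -> value T (invK a) d n.
Proof.
  intros [B [<- <-]]; split; [|split]; [apply below_inv, B|apply vn_inv|apply vd_inv].
Qed.

Lemma value_zero T : value T zeroK r0 r1.
Proof. split; [|split]; [apply below_zero|apply vn_zero|apply vd_zero]. Qed.

Lemma value_one T : value T oneK r1 r1.
Proof. split; [|split]; [apply below_one|apply vn_one|apply vd_one]. Qed.

Lemma eqK_value T a b n d n' d' : value T a n d -> value T b n' d' ->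
  (eqC a b <-> rmul n d' = rmul n' d).
Proof. intros [B [<- <-]] [B' [<- <-]]; apply eqK_iff; assumption. Qed.

Ltac values := repeat lazymatch goal with
  | |- value _ (addC _ _) _ _ => eapply value_add
  | |- value _ (mulC _ _) _ _ => eapply value_mul
  | |- value _ (oppC _) _ _ => eapply value_opp
  | |- value _ (invK _) _ _ => eapply value_inv
  | |- value _ zeroK _ _ => apply value_zero
  | |- value _ oneK _ _ => apply value_one
  | |- value _ _ _ _ => eassumption
  end.
Ltac law T := refine (proj2 (eqK_value (T := T) _ _) _); [values|values|].

Lemma field_laws_K a b c : inK a -> inK b -> inK c ->
  inK (addC a b) /\ inK (oppC a) /\ inK (mulC a b)
  /\ eqC a a
  /\ (eqC a b -> eqC b a)
  /\ (eqC a b -> eqC b c -> eqC a c)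
  /\ (eqC a b -> eqC (addC a c) (addC b c))
  /\ (eqC a b -> eqC (oppC a) (oppC b))
  /\ (eqC a b -> eqC (mulC a c) (mulC b c))
  /\ eqC (addC (addC a b) c) (addC a (addC b c))
  /\ eqC (addC a b) (addC b a)
  /\ eqC (addC a zeroK) a
  /\ eqC (addC a (oppC a)) zeroK
  /\ eqC (mulC (mulC a b) c) (mulC a (mulC b c))
  /\ eqC (mulC a b) (mulC b a)
  /\ eqC (mulC a oneK) a
  /\ eqC (mulC a (addC b c)) (addC (mulC a b) (mulC a c)).
Proof.
  intros Ha Hb Hc; destruct (upper3 a b c) as [T [Ba [Bb Bc]]].
  pose proof (@inK_vd T b Hb) as b0.
  pose proof (value_self Ba) as Va; pose proof (value_self Bb) as Vb.
  pose proof (value_self Bc) as Vc.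
  revert Va Vb Vc b0; generalize (vn T a) (vd T a) (vn T b) (vd T b) (vn T c) (vd T c).
  intros x x' y y' z z' Va Vb Vc y0.
  repeat match goal with |- _ /\ _ => split end.
  - apply inK_add; assumption.
  - apply inK_opp; assumption.
  - apply inK_mul; assumption.
  - law T; ring.
  - rewrite (eqK_value Va Vb), (eqK_value Vb Va); auto.
  - rewrite (eqK_value Va Vb), (eqK_value Vb Vc), (eqK_value Va Vc); intros E E'.
    apply rmul_cancel with y'; [exact y0|].
    transitivity (rmul (rmul x y') z'); [ring|]; rewrite E.
    transitivity (rmul (rmul y z') x'); [ring|]; rewrite E'; ring.
  - rewrite (eqK_value Va Vb); intros E; law T.
    transitivity (radd (rmul (rmul x y') (rmul z' z')) (rmul (rmul z z') (rmul x' y')));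
      [ring|]; rewrite E; ring.
  - rewrite (eqK_value Va Vb); intros E; law T.
    transitivity (ropp (rmul x y')); [ring|]; rewrite E; ring.
  - rewrite (eqK_value Va Vb); intros E; law T.
    transitivity (rmul (rmul x y') (rmul z z')); [ring|]; rewrite E; ring.
  - law T; ring.
  - law T; ring.
  - law T; ring.
  - law T; ring.
  - law T; ring.
  - law T; ring.
  - law T; ring.
  - law T; ring.
Qed.

Lemma zeroK_ne_oneK : ~ eqC zeroK oneK.
Proof.
  rewrite (eqK_value (value_zero szero) (value_one szero)); intros E.
  apply r1_ne_0; transitivity (rmul r1 r1); [ring|]; rewrite <- E; ring.
Qed.

Lemma inverse_K a : inK a -> ~ eqC a zeroK -> inK (invK a) /\ eqC (mulC a (invK a)) oneK.
Proof.
  intros Ha H; pose proof (@below_refl (st a)) as B; split.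
  - rewrite (eqK_zero_iff B) in H; rewrite (inK_iff (st a)), vd_inv; exact H.
  - apply value_self in B; law (st a); ring.
Qed.

(** * Formal reality *)

Definition posK (T h : D t1) : Prop := ppos (pmul (pnum T h) (pden T h)).

Lemma posK_iff T h : posK T h <-> rpos (rmul (vn T h) (vd T h)).
Proof. rewrite <- ser_pnum, <- ser_pden, rmul_ser, rpos_ser; reflexivity. Qed.

Lemma rpos_cancel (x y : series) : rpos (rmul x y) -> rpos y -> rpos x.
Proof.
  intros H Hy; destruct (rpos_total x) as [E|[E|E]]; auto; exfalso; apply rpos_0.
  - rewrite E in H; replace (rmul r0 y) with (r0) in H by ring; exact H.
  - pose proof (rpos_add (rpos_mul E Hy) H) as K.
    replace (radd _ _) with (r0) in K by ring; exact K.
Qed.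

(** Squares of denominators are positive, so that the sign of a fraction may be read off
    the product of numerator and denominator. *)
Lemma posK_eq T a b : inK a -> inK b -> below (st a) T -> below (st b) T ->
  eqC a b -> posK T a -> posK T b.
Proof.
  intros Ha Hb Ba Bb; rewrite (eqK_iff Ba Bb), !posK_iff; intros E H.
  refine (rpos_cancel (y := rmul (vd T a) (vd T a)) _ (rpos_square (@inK_vd T a Ha))).
  assert (Q : rmul (rmul (vn T b) (vd T b)) (rmul (vd T a) (vd T a))
    = rmul (rmul (vn T a) (vd T a)) (rmul (vd T b) (vd T b))).
  - symmetry; transitivity (rmul (rmul (vn T a) (vd T b)) (rmul (vd T a) (vd T b))); [ring|].
    rewrite E; ring.
  - rewrite Q; exact (rpos_mul H (rpos_square (@inK_vd T b Hb))).
Qed.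

Lemma posK_add T a b : inK a -> inK b -> below (st a) T -> below (st b) T ->
  posK T a -> posK T b -> posK T (addC a b).
Proof.
  intros Ha Hb Ba Bb; rewrite !posK_iff, (vn_add Ba Bb), (vd_add Ba Bb); intros H K.
  replace (rmul _ _) with (radd
    (rmul (rmul (vn T a) (vd T a)) (rmul (vd T b) (vd T b)))
    (rmul (rmul (vn T b) (vd T b)) (rmul (vd T a) (vd T a)))) by ring.
  exact (rpos_add (rpos_mul H (rpos_square (@inK_vd T b Hb)))
    (rpos_mul K (rpos_square (@inK_vd T a Ha)))).
Qed.

Lemma posK_square T a : inK a -> below (st a) T -> ~ eqC a zeroK -> posK T (mulC a a).
Proof.
  intros Ha Ba; rewrite (eqK_zero_iff Ba), posK_iff, (vn_mul Ba Ba), (vd_mul Ba Ba); intros H.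
  exact (rpos_mul (rpos_square H) (rpos_square (@inK_vd T a Ha))).
Qed.

Lemma posK_zero T : ~ posK T zeroK.
Proof.
  rewrite posK_iff, vn_zero, vd_zero; replace (rmul r0 r1) with (r0) by ring; apply rpos_0.
Qed.

Lemma Def_posK E (T F : pts M E -> D t1) :
  Def E T -> Def E F -> Def E (fun p => ch (posK (T p) (F p))).
Proof.
  intros HT HF; unfold posK, pnum, pden; apply Def_ppos, Defp_pmul; apply Defp_pphi;
    auto using Defp_num, Defp_den; apply Def_diff; auto using Def_st.
Qed.

(** At each prime, the common extension takes the value and the witness from the first code
    of the sequence whose state is not zero there. *)
Lemma upper_seq (c : D (tN ~> t1)) : exists s w, forall i, below (st (c ⋅ i)) (cert s w).
Proof.
  set (w := fun q => dec ⋅ wt (c ⋅ least (fun i => st (c ⋅ i) ⋅ q <> 0)) ⋅ q).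
  set (s := fun q => st (c ⋅ least (fun i => st (c ⋅ i) ⋅ q <> 0)) ⋅ q).
  assert (DL : forall E (q : pts M E -> N), Def E q ->
    Def E (fun p => c ⋅ least (fun i => st (c ⋅ i) ⋅ q p <> 0))).
  { intros E q Hq; apply Def_app; [def|]; apply (Def_comp (F := fun q =>
      least (fun i => st (c ⋅ i) ⋅ q <> 0))); [def; apply Def_st; def|exact Hq]. }
  assert (Ds : Def [tN] (fun p => s (hd p))).
  { unfold s; apply Def_app; [|def]; apply Def_st, DL; def. }
  assert (Dw : Def [tN] (fun p => w (hd p))).
  { unfold w; apply Def_app; [|def]; apply Def_app; [def|]; apply Def_wt, DL; def. }
  exists (lam s), (fam ⋅ lam w); intros i q H.
  assert (L : st (c ⋅ least (fun i => st (c ⋅ i) ⋅ q <> 0)) ⋅ q <> 0).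
  { apply (least_spec (P := fun i => st (c ⋅ i) ⋅ q <> 0)); [|eauto].
    def; apply Def_st; def. }
  rewrite cert_self.
  - rewrite beta by exact Ds; apply cert_compat; assumption.
  - intros r; rewrite dec_fam, !beta by assumption; apply cert_cases.
Qed.

(** By induction on [i], the partial sum [s i] is positive in a state common to all the
    codes. The codes [s i] have states of their own, because they equal the sums only in the
    sense of the field. *)
Lemma formally_real_K (n : N) (c s : D (tN ~> t1)) :
  (forall i, i < n + 1 -> inK (c ⋅ i) /\ ~ eqC (c ⋅ i) zeroK /\ inK (s ⋅ i)) ->
  eqC (s ⋅ 0) (mulC (c ⋅ 0) (c ⋅ 0)) ->
  (forall i, i < n ->
     eqC (s ⋅ (i + 1)) (addC (s ⋅ i) (mulC (c ⋅ (i + 1)) (c ⋅ (i + 1))))) ->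
  ~ eqC zeroK (s ⋅ n).
Proof.
  intros HK H0 HS Hn.
  (* The state of a sum of codes is the union of their states. *)
  destruct (upper_seq (lam (fun i => addC (c ⋅ i) (s ⋅ i)))) as [s' [w Hw]].
  set (T := cert s' w) in *.
  assert (B : forall i, below (st (addC (c ⋅ i) (s ⋅ i))) T).
  { intros i; specialize (Hw i).
    rewrite (beta (F := fun i => addC (c ⋅ i) (s ⋅ i))) in Hw by (apply Def_addK; def).
    exact Hw. }
  assert (Bc : forall i, below (st (c ⋅ i)) T).
  { intros i; eapply below_trans; [|apply B]; rewrite st_add; apply below_join_l. }
  assert (Bs : forall i, below (st (s ⋅ i)) T).
  { intros i; eapply below_trans; [|apply B]; rewrite st_add; apply below_join_r. }
  assert (P : forall i, i < n + 1 -> posK T (s ⋅ i)).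
  { apply (ind (P := fun i => i < n + 1 -> posK T (s ⋅ i))).
    - def; apply Def_posK; def.
    - intros L; destruct (HK _ L) as [Kc [Nc Ks]].
      destruct (upper2 (s ⋅ 0) (mulC (c ⋅ 0) (c ⋅ 0))) as [U [U1 U2]].
      refine (posK_eq (inK_mul Kc Kc) Ks (below_mul (Bc _) (Bc _)) (Bs _) _
        (posK_square Kc (Bc _) Nc)).
      rewrite (eqK_iff U2 U1); rewrite (eqK_iff U1 U2) in H0; symmetry; exact H0.
    - intros i IH L; destruct (HK _ L) as [Kc [Nc Ks]].
      assert (Li : i < n) by (apply lt_exists in L; destruct L as [k L]; apply lt_exists;
        exists k; apply add_cancel with 1; rewrite L; ring).
      assert (Li' : i < n + 1) by (apply (lt_trans Li), lt_succ_diag).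
      destruct (HK _ Li') as [_ [_ Ki]]; specialize (HS i Li).
      set (x := mulC (c ⋅ (i + 1)) (c ⋅ (i + 1))) in *.
      assert (Kx : inK x) by exact (inK_mul Kc Kc).
      assert (Bx : below (st x) T) by exact (below_mul (Bc _) (Bc _)).
      destruct (upper2 (s ⋅ (i + 1)) (addC (s ⋅ i) x)) as [U [U1 U2]].
      refine (posK_eq (inK_add Ki Kx) Ks (below_add (Bs _) Bx) (Bs _) _
        (posK_add Ki Kx (Bs _) Bx (IH Li') (posK_square Kc (Bc _) Nc))).
      rewrite (eqK_iff U2 U1); rewrite (eqK_iff U1 U2) in HS; symmetry; exact HS. }
  specialize (P n (lt_succ_diag n)); destruct (HK n (lt_succ_diag n)) as [_ [_ Ks]].
  apply (@posK_zero T); refine (posK_eq Ks inK_zero (Bs _) (below_zero T) _ P).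
  rewrite (eqK_iff (Bs n) (below_zero T)); rewrite (eqK_iff (below_zero T) (Bs n)) in Hn.
  symmetry; exact Hn.
Qed.

(** * Separation *)

Definition idx (n : N) : N := pred (prm n).
Definition flag (n v : N) : D t1 := lam (fun q => cond (q = prm n) v 0).
(** The code of the generator of index [n], and, given a witness [f] for [n], the code of a
    square root of this generator ([v = 1]) or of its opposite ([v = two]). *)
Definition genK (n : N) : D t1 := mk (mono (idx n), szero) (mono 0, szero) szero szero.
Definition rootK (n v : N) (f : D t1) : D t1 :=
  mk (mono (idx n), szero) (mono 0, szero) (flag n v) (fam ⋅ lam (fun _ => f)).

Lemma idx_S n : idx n + 1 = prm n.
Proof.
  unfold idx; pose proof (prime_ne_0 (prm_prime n)) as H; apply ne_0 in H.
  destruct H as [m ->]; rewrite pred_S; reflexivity.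
Qed.

Lemma flag_E n v q : flag n v ⋅ q = cond (q = prm n) v 0.
Proof. unfold flag; rewrite beta by def; reflexivity. Qed.

Lemma cert_flag n v f : (v = 1 /\ Y ⋅ f = n) \/ (v = two /\ Z ⋅ f = n) ->
  cert (flag n v) (fam ⋅ lam (fun _ => f)) = flag n v.
Proof.
  intros H; apply cert_self; intros q.
  rewrite flag_E, dec_fam, (beta (F := fun _ : N => f)) by def.
  destruct (classic (q = prm n)) as [->|e].
  - rewrite cond_true by reflexivity; destruct H as [[-> <-]|[-> <-]]; auto.
  - rewrite cond_false by exact e; auto.
Qed.

Lemma inK_one_den n s w : inK (mk n (mono 0, szero) s w).
Proof. rewrite (inK_iff szero), vd_mk, tr_one; apply r1_ne_0. Qed.

Lemma inK_genK n : inK (genK n).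
Proof. apply inK_one_den. Qed.

Lemma inK_rootK n v f : inK (rootK n v f).
Proof. apply inK_one_den. Qed.

Section Root.
Variables (n v : N) (f : D t1).
Hypothesis Hv : (v = 1 /\ Y ⋅ f = n) \/ (v = two /\ Z ⋅ f = n).

Lemma below_root : below (st (rootK n v f)) (flag n v).
Proof. unfold rootK; rewrite st_mk, (cert_flag Hv); apply below_refl. Qed.

Lemma value_root : value (flag n v) (rootK n v f) (gen (idx n)) r1.
Proof.
  split; [apply below_root|]; unfold rootK; rewrite vn_mk, vd_mk, (cert_flag Hv).
  split; [apply tr_refl|apply tr_one].
Qed.

Lemma value_genK : value (flag n v) (genK n)
  (if excluded_middle_informative (v = two)
   then ropp (rmul (gen (idx n)) (gen (idx n))) else rmul (gen (idx n)) (gen (idx n))) r1.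
Proof.
  unfold genK; split; [rewrite st_mk, cert_0; apply below_0|].
  rewrite vn_mk, vd_mk, cert_0; split; [|apply tr_one].
  assert (E : diff szero (flag n v) ⋅ (idx n + 1) = v).
  { rewrite diff_E, szero_E, flag_E, idx_S, !cond_true; reflexivity. }
  change (phi (diff szero (flag n v)) (gen (idx n)) =
    if excluded_middle_informative (v = two)
    then ropp (rmul (gen (idx n)) (gen (idx n))) else rmul (gen (idx n)) (gen (idx n))).
  rewrite phi_gen, E; [reflexivity|rewrite idx_S; apply prm_prime|rewrite E].
  destruct Hv as [[-> _]|[-> _]]; [apply one_ne_0|apply two_ne_0].
Qed.

Lemma root_ne_0 : ~ eqC (rootK n v f) zeroK.
Proof.
  rewrite (eqK_zero_iff below_root); destruct value_root as [_ [-> _]]; apply gen_ne_0.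
Qed.
End Root.

Lemma square_root n f : Y ⋅ f = n -> eqC (mulC (rootK n 1 f) (rootK n 1 f)) (genK n).
Proof.
  intros H; assert (Hv : (oneM M = 1 /\ Y ⋅ f = n) \/ (oneM M = two /\ Z ⋅ f = n)) by auto.
  pose proof (value_root Hv) as V; pose proof (value_genK Hv) as W; law (flag n 1).
  destruct excluded_middle_informative as [e|e]; [destruct (two_ne_1 (eq_sym e))|ring].
Qed.

Lemma opp_square_root n f : Z ⋅ f = n ->
  eqC (oppC (mulC (rootK n two f) (rootK n two f))) (genK n).
Proof.
  intros H; assert (Hv : (two = oneM M /\ Y ⋅ f = n) \/ ((two : N) = two /\ Z ⋅ f = n)) by auto.
  pose proof (value_root Hv) as V; pose proof (value_genK Hv) as W; law (flag n two).
  destruct excluded_middle_informative as [e|e]; [ring|tauto].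
Qed.

Definition setF : D t2 := lam (fun h => ch (inK h)).
Definition eqF : D (t1 ~> t1 ~> tN) := lam (fun h => lam (fun h' => ch (eqC h h'))).
Definition addF : D (t1 ~> t1 ~> t1) := lam (fun h => lam (fun h' => addC h h')).
Definition mulF : D (t1 ~> t1 ~> t1) := lam (fun h => lam (fun h' => mulC h h')).
Definition oppF : D (t1 ~> t1) := lam (fun h => oppC h).

Lemma setF_E h : setF ⋅ h = 1 <-> inK h.
Proof.
  unfold setF; rewrite (beta (F := fun h => ch (inK h))) by (apply Def_inK; def); apply ch_1.
Qed.

Lemma eqF_E h h' : eqF ⋅ h ⋅ h' = 1 <-> eqC h h'.
Proof.
  unfold eqF; rewrite (beta2 (F := fun h h' => ch (eqC h h'))) by (apply Def_eqK; def).
  apply ch_1.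
Qed.

Lemma addF_E h h' : addF ⋅ h ⋅ h' = addC h h'.
Proof. apply (beta2 (F := fun h h' => addC h h')), Def_addK; def. Qed.

Lemma mulF_E h h' : mulF ⋅ h ⋅ h' = mulC h h'.
Proof. apply (beta2 (F := fun h h' => mulC h h')), Def_mulK; def. Qed.

Lemma oppF_E h : oppF ⋅ h = oppC h.
Proof. apply (beta (F := fun h => oppC h)), Def_oppK; def. Qed.

Hypothesis eqM_eq : forall x y : N, eqM x y <-> x = y.

Definition envK : env M [t1 ~> t1 ~> t1; t1 ~> t1; t1 ~> t1 ~> t1; t1 ~> t1 ~> tN; t1; t1; t2] :=
  econs mulF (econs oppF (econs addF (econs eqF (econs oneK (econs zeroK (econs setF (env0 M))))))).
Definition dataK : field_data [t1 ~> t1 ~> t1; t1 ~> t1; t1 ~> t1 ~> t1; t1 ~> t1 ~> tN; t1; t1; t2] :=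
  FieldData v6 v5 v4 v3 v2 v1 v0.

Lemma set_iff h : eqM (setF ⋅ h) 1 <-> inK h.
Proof. rewrite eqM_eq; apply setF_E. Qed.

Lemma eq_iff h h' : eqM (eqF ⋅ h ⋅ h') 1 <-> eqC h h'.
Proof. rewrite eqM_eq; apply eqF_E. Qed.

Lemma is_field_K : sat envK (is_field dataK).
Proof.
  cbn; split; [apply set_iff, inK_zero|split; [apply set_iff, inK_one|]].
  split; [|split].
  - intros a Ha b Hb c Hc; apply set_iff in Ha; apply set_iff in Hb; apply set_iff in Hc.
    rewrite !addF_E, !oppF_E, !mulF_E, !eq_iff, !set_iff.
    exact (field_laws_K Ha Hb Hc).
  - rewrite eq_iff; exact zeroK_ne_oneK.
  - intros a Ha H; rewrite eq_iff in H; apply set_iff in Ha.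
    destruct (inverse_K Ha H) as [Hi E]; exists (invK a).
    rewrite mulF_E, eq_iff, set_iff; auto.
Qed.

Lemma formally_real_field_K : sat envK (formally_real dataK).
Proof.
  cbn; intros [n [c [s [HK [H0 [HS Hn]]]]]].
  apply eq_iff in Hn; revert Hn; apply (formally_real_K (c := c)).
  - intros i L; specialize (HK i L); rewrite !set_iff, eq_iff in HK; exact HK.
  - rewrite mulF_E, eq_iff in H0; exact H0.
  - intros i L; specialize (HS i L); rewrite addF_E, mulF_E, eq_iff in HS; exact HS.
Qed.

(** In an ordering, [0 < genK (Y g)] because this element is a nonzero square, and
    [genK (Z g) < 0] because its opposite is one. *)
Theorem separation : sat (env0 M) ORD ->
  exists X : D t1, forall g : D t1, X ⋅ (Y ⋅ g) = 1 /\ X ⋅ (Z ⋅ g) <> 1.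
Proof.
  intros H; destruct (H setF zeroK oneK eqF addF oppF mulF is_field_K formally_real_field_K)
    as [lt Hlt]; clear H.
  set (L := fun a b => lt ⋅ a ⋅ b = 1).
  assert (O : forall a b c, inK a -> inK b -> inK c ->
    (eqC a b -> (L a c -> L b c) /\ (L c a -> L c b)) /\
    ~ L a a /\ (L a b -> L b c -> L a c) /\ (L a b \/ eqC a b \/ L b a) /\
    (L a b -> L (addC a c) (addC b c)) /\
    (L zeroK a -> L zeroK b -> L zeroK (mulC a b))).
  { intros a b c Ha Hb Hc; apply set_iff in Ha; apply set_iff in Hb; apply set_iff in Hc.
    specialize (Hlt a Ha b Hb c Hc); cbn in Hlt.
    rewrite !addF_E, !mulF_E, !eqM_eq, eqF_E in Hlt; exact Hlt. }
  assert (square_pos : forall a, inK a -> ~ eqC a zeroK -> L zeroK (mulC a a)).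
  { intros a Ha Na; pose proof (inK_opp Ha) as Ho; pose proof inK_zero as Kz.
    destruct (O zeroK a zeroK Kz Ha Kz) as [_ [_ [_ [Tri _]]]].
    destruct Tri as [P|[E|P]].
    - exact (proj2 (proj2 (proj2 (proj2 (proj2 (O a a a Ha Ha Ha))))) P P).
    - destruct (field_laws_K Kz Ha Kz) as [_ [_ [_ [_ [Sym _]]]]]; destruct (Na (Sym E)).
    - destruct (O a zeroK (oppC a) Ha Kz Ho) as [_ [_ [_ [_ [Add _]]]]]; specialize (Add P).
      pose proof (@below_refl (st a)) as B; pose proof (value_self B) as V.
      assert (E1 : eqC (addC a (oppC a)) zeroK) by (law (st a); ring).
      assert (E2 : eqC (addC zeroK (oppC a)) (oppC a)) by (law (st a); ring).
      assert (E3 : eqC (mulC (oppC a) (oppC a)) (mulC a a)) by (law (st a); ring).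
      pose proof (inK_add Ha Ho) as K1; pose proof (inK_add Kz Ho) as K2.
      pose proof (proj1 (proj1 (O _ _ _ K1 Kz K2) E1) Add) as P1.
      pose proof (proj2 (proj1 (O _ _ _ K2 Ho Kz) E2) P1) as P2.
      refine (proj2 (proj1 (O _ _ _ (inK_mul Ho Ho) (inK_mul Ha Ha) Kz) E3) _).
      exact (proj2 (proj2 (proj2 (proj2 (proj2 (O _ _ _ Ho Ho Ho))))) P2 P2). }
  pose proof inK_zero as Kz.
  assert (root_pos : forall n v f, (v = 1 /\ Y ⋅ f = n) \/ (v = two /\ Z ⋅ f = n) ->
    L zeroK (mulC (rootK n v f) (rootK n v f))).
  { intros n v f Hv; apply square_pos; [apply inK_rootK|apply (root_ne_0 Hv)]. }
  assert (B : forall n, lam (fun n => lt ⋅ zeroK ⋅ genK n) ⋅ n = lt ⋅ zeroK ⋅ genK n).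
  { intros n; apply (beta (F := fun n => lt ⋅ zeroK ⋅ genK n)).
    apply Def_app; [def|]; apply Def_mk; [|apply Defp_const|def|def].
    split; cbn [fst snd]; unfold idx; def. }
  exists (lam (fun n => lt ⋅ zeroK ⋅ genK n)); intros g; rewrite !B; split.
  - pose proof (@inK_rootK (Y ⋅ g) 1 g) as Kr.
    refine (proj2 (proj1 (O _ _ _ (inK_mul Kr Kr) (@inK_genK _) Kz)
      (square_root eq_refl)) _).
    apply root_pos; auto.
  - intros P; set (n := Z ⋅ g) in *.
    pose proof (@inK_rootK n two g) as Kr; pose proof (@inK_genK n) as Kx.
    set (r := rootK n two g) in *; pose proof (inK_mul Kr Kr) as Kp.
    pose proof (inK_opp Kp) as Ko.
    pose proof (opp_square_root (f := g) (n := n) eq_refl) as E; fold r in E.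
    destruct (field_laws_K Ko Kx Kz) as [_ [_ [_ [_ [Sym _]]]]].
    pose proof (proj2 (proj1 (O _ _ _ Kx Ko Kz) (Sym E)) P) as P1.
    assert (P2 : L zeroK (mulC r r)) by (apply root_pos; auto).
    destruct (O _ _ _ Kz Kp Ko) as [_ [_ [_ [_ [Add _]]]]]; specialize (Add P2).
    pose proof (value_self (@below_refl (st r))) as V.
    assert (E1 : eqC (addC (mulC r r) (oppC (mulC r r))) zeroK) by (law (st r); ring).
    assert (E2 : eqC (addC zeroK (oppC (mulC r r))) (oppC (mulC r r)))
      by (law (st r); ring).
    pose proof (proj1 (proj1 (O _ _ _ (inK_add Kz Ko) Ko (inK_add Kp Ko)) E2) Add) as P3.
    pose proof (proj2 (proj1 (O _ _ _ (inK_add Kp Ko) Kz Ko) E1) P3) as P4.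
    destruct (O zeroK _ zeroK Kz Ko Kz) as [_ [_ [Trans _]]].
    exact (proj1 (proj2 (O zeroK zeroK zeroK Kz Kz Kz)) (Trans P1 P4)).
Qed.

End Field.
End Model.

Theorem theorem3p28 : proves (extend ACA0w DeltaCA) (Imp ORD SEP1).
Proof.
  assert (TR : forall G (B : fm G), RCA0w B -> extend ACA0w DeltaCA B).
  { intros G B H; apply ext_base, ext_base, H. }
  apply normal_completeness; [exact TR|]; intros M HM Hsat.
  assert (AM : arith_model M).
  { apply (arith_model_of_normal TR); auto; intros G; apply ext_base, ext_new. }
  pose proof (eqM_eq HM) as E; intros HO Y Z disj.
  assert (D : forall f g, Y ⋅ f <> Z ⋅ g).
  { intros f g e; apply (disj f g), E, e. }
  destruct (separation D E HO) as [X HX]; exists X; intros g.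
  destruct (HX g) as [H1 H2]; split; [apply E, H1|intros H; apply H2, E, H].
Qed.
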